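(* Let $T\in C_{00}$ act on $\mathcal H$, let $V\in\mathcal L(\mathcal K)$ be a minimal isometric dilation of $T$, and let $L,L_*\subset\mathcal K$ be wandering subspaces for $V$ such that $\mathcal K=M_+(L_* )=\mathcal H\oplus M_+(L)$. Then $T$ has a reducing subspace such that the restriction of $T$ to it has defects of dimension $1$ if and only if there exist $y\in L$, $y_*\in L_*$, $y,y_*\ne0$, and a scalar inner function $u$, such that $y=u(V)y_*$. In this case the characteristic function of the reduced operator is precisely $u$; that is, for a given inner function $u$, such $y,y_*$ with $y=u(V)y_*$ exist if and only if $T$ has a reducing subspace $M$ such that $T|M$ has defects of dimension $1$ and the characteristic function of $T|M$ is $u$ (up to coincidence).
   Context: A contraction $T$ on a Hilbert space is in $C_{00}$ if $T^n\to0$ and $T^{*n}\to0$ strongly. A closed subspace $M$ is reducing for $T$ if $M$ and $M^\perp$ are invariant under $T$ (it may be the whole space). For a contraction $R$, put $D_R=(I-R^*R)^{1/2}$ and let $\mathcal D_R$ be the closure of the range of $D_R$; $R$ has defects of dimension $d$ if $\dim\mathcal D_R=\dim\mathcal D_{R^*}=d$. The characteristic function of $R$ is $\Theta_R(z)=-R+zD_{R^*}(I-zR^* )^{-1}D_R|\mathcal D_R\in\mathcal L(\mathcal D_R,\mathcal D_{R^*})$, $|z|<1$. Two operator-valued analytic functions $\Theta:\mathbb D\to\mathcal L(\mathcal E,\mathcal E_* )$, $\Theta':\mathbb D\to\mathcal L(\mathcal E',\mathcal E'_* )$ coincide if there are unitary operators $\omega:\mathcal E\to\mathcal E'$, $\omega_*:\mathcal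 E_*\to\mathcal E'_*$ with $\Theta'(\lambda)\omega=\omega_*\Theta(\lambda)$ for all $\lambda\in\mathbb D$. Characteristic functions are identified up to coincidence, and a scalar function $u$ is regarded as $\mathcal L(\mathbb C,\mathbb C)$-valued. An isometric dilation of $T\in\mathcal L(\mathcal H)$ is an isometry $V\in\mathcal L(\mathcal K)$, $\mathcal K\supset\mathcal H$, with $P_{\mathcal H}V^n|\mathcal H=T^n$ for all $n\in\mathbb N$; it is minimal if $\mathcal K=\bigvee_{n\ge0}V^n\mathcal H$. A subspace $X\subset\mathcal K$ is wandering for $V$ if $V^nX\perp V^mX$ for $n\ne m$, and then $M_+(X)=\bigoplus_{n=0}^\infty V^nX$. For $T\in C_{00}$ such $L,L_*$ always exist. A scalar inner function is $u\in H^2$ with $|u|=1$ a.e. on the unit circle; if $u(z)=\sum_{n\ge0}u_nz^n$ and $y_*\in L_*$, then $u(V)y_*=\sum_{n\ge0}u_nV^ny_*$. *)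

(* Defs.v *)
From HB Require Import structures.
From mathcomp Require Import all_boot all_order all_algebra.
From mathcomp Require Import complex.
From mathcomp Require Import all_classical all_reals all_analysis.

Set Implicit Arguments.
Unset Strict Implicit.
Unset Printing Implicit Defensive.

Import Order.TTheory GRing.Theory Num.Theory.
Import numFieldNormedType.Exports.

Local Open Scope classical_set_scope.
Local Open Scope complex_scope.
Local Open Scope ring_scope.

(* Complex Hilbert spaces; the inner product is linear in the first variable. *)
HB.mixin Record CompleteNormedModule_isHilbert (R : realType) H
    & CompleteNormedModule R[i] H := {
  inner : H -> H -> R[i];
  inner_linearl : forall (a : R[i]) (x y z : H),
    inner (a *: x + y) z = a * inner x z + inner y z;
  innerC : forall x y : H, inner x y = Num.conj (inner y x);
  inner_norm : forall x : H, inner x x = `|x| ^+ 2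
}.

#[short(type="hilbertType")]
HB.structure Definition Hilbert (R : realType) :=
  {H of CompleteNormedModule R[i] H & CompleteNormedModule_isHilbert R H}.

Section inner_is_dot.
Context {R : realType} {H : hilbertType R}.

Let inner_bilinear : bilinear_for *%R (Num.conj \; *%R) (@inner R H).
Proof.
split=> [z|z] a x y /=; first exact: inner_linearl.
by rewrite innerC inner_linearl rmorphD rmorphM /= -!innerC.
Qed.

HB.instance Definition _ :=
  bilinear_isBilinear.Build R[i] H H R[i] *%R (Num.conj \; *%R)
    (@inner R H) inner_bilinear.

Let inner_hermitian x y :
  @inner R H x y = (-1) ^+ false * Num.conj (inner y x).
Proof. by rewrite mul1r -innerC. Qed.

HB.instance Definition _ :=
  isHermitianSesquilinear.Build R[i] H false Num.conj (@inner R H)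
    inner_hermitian.

Let inner_gt0 (x : H) : x != 0 -> 0 < inner x x.
Proof. by move=> x0; rewrite inner_norm exprn_gt0// normr_gt0. Qed.

HB.instance Definition _ := isDotProduct.Build R[i] H (@inner R H) inner_gt0.

End inner_is_dot.

(* C as a Hilbert space over itself. The alias carries the completeness
   instance, which cannot be attached to R[i]^o since the library already
   attaches one to the regular module of a realType. *)
Definition complex_line (R : realType) : Type := R[i]^o.

Section complex_hilbert.
Context {R : realType}.
Local Notation C := R[i].
Local Notation C1 := (complex_line R).

HB.instance Definition _ := NormedModule.copy C1 C^o.

Let complex_complete (F : set_system C1) :
  ProperFilter F -> cauchy F -> cvg F.
Proof.
move=> FF /cauchyP Fc.
have normE (z : C) : `|z| = (Num.sqrt (complex.Re z ^+ 2 + complex.Im z ^+ 2))%:C.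
  exact: normc_def.
have Re_le (z : C) : `|complex.Re z|%:C <= `|z|.
  by rewrite normE lecR -sqrtr_sqr ler_wsqrtr// lerDl sqr_ge0.
have Im_le (z : C) : `|complex.Im z|%:C <= `|z|.
  by rewrite normE lecR -sqrtr_sqr ler_wsqrtr// lerDr sqr_ge0.
have le_ReIm (z : C) : `|z| <= (`|complex.Re z| + `|complex.Im z|)%:C.
  rewrite normE lecR -[leRHS]ger0_norm ?addr_ge0// -sqrtr_sqr ler_wsqrtr//.
  rewrite sqrrD !real_normK ?num_real// lerD2r lerDl.
  by rewrite mulrn_wge0// mulr_ge0.
have cvg_part (p : C -> R) : (forall x y : C, p (x - y) = p x - p y) ->
    (forall z, `|p z|%:C <= `|z|) -> cvg (p @ F).
  move=> pB p_le; apply/cauchy_cvgP/cauchyP => e e0.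
  have e0' : 0 < e%:C by rewrite ltcR.
  have [x Fx] := Fc _ e0'; exists (p x).
  suff : F (p @^-1` ball (p x) e) by [].
  apply: filterS Fx => y; rewrite -!ball_normE /= => xy.
  rewrite -ltcR; apply: le_lt_trans xy.
  by have := p_le ((x : C) - (y : C)); rewrite pB.
have /cvg_ex[/= a Fa] := cvg_part _ (raddfB (@complex.Re R)) Re_le.
have /cvg_ex[/= b Fb] := cvg_part _ (raddfB (@complex.Im R)) Im_le.
apply/cvg_ex; exists ((a +i* b : C) : C1).
apply/cvgrPdist_lt => e e0.
have [e1 eE] : exists e1, e = e1%:C.
  by exists (complex.Re e); rewrite RRe_real// gtr0_real.
rewrite {}eE ltcR in e0 *.
have e20 : 0 < e1 / 2 by rewrite divr_gt0.
move/cvgrPdist_lt : Fa => /(_ _ e20) Fa.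
move/cvgrPdist_lt : Fb => /(_ _ e20) Fb.
near=> z.
apply: le_lt_trans (le_ReIm _) _; rewrite ltcR (splitr e1) ltrD//.
  by rewrite raddfB /=; near: z.
by rewrite raddfB /=; near: z.
Unshelve. all: by end_near. Qed.

HB.instance Definition _ := Uniform_isComplete.Build C1 complex_complete.

Let cinner (x y : C1) : C := (x : C) * Num.conj (y : C).

Let cinner_linearl (a : C) (x y z : C1) :
  cinner (a *: x + y) z = a * cinner x z + cinner y z.
Proof. by rewrite /cinner mulrDl -mulrA. Qed.

Let cinnerC (x y : C1) : cinner x y = Num.conj (cinner y x).
Proof. by rewrite /cinner [RHS]rmorphM /= (@conjCK C) mulrC. Qed.

Let cinner_norm (x : C1) : cinner x x = `|x| ^+ 2.
Proof. by rewrite /cinner -normCK. Qed.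

HB.instance Definition _ := CompleteNormedModule_isHilbert.Build R C1
  cinner_linearl cinnerC cinner_norm.

End complex_hilbert.

Definition linear_subspace {R : realType} {H : hilbertType R} (X : set H) :=
  X 0 /\ forall (a : R[i]) x y, X x -> X y -> X (a *: x + y).

Definition closed_subspace {R : realType} {H : hilbertType R} : set (set H) :=
  [set X | linear_subspace X /\ closed X].

Record csubspace {R : realType} (H : hilbertType R) := CSubspace {
  csubspace_set : set H;
  csubspaceP : closed_subspace csubspace_set
}.

(* A closed subspace, seen as a Hilbert space in its own right. *)
Record csubspace_type {R : realType} {H : hilbertType R} (M : csubspace H) :=
  CSubspaceElt {
    incl : H;
    inclP : incl \in csubspace_set M
  }.
Coercion csubspace_type : csubspace >-> Sortclass.

Section csubspace_hilbert.
Context {R : realType} {H : hilbertType R} (M : csubspace H).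
Local Notation C := R[i].

HB.instance Definition _ := [isSub for @incl R H M].
HB.instance Definition _ := [Choice of csubspace_type M by <:].

Let Mpred : {pred H} := fun x => x \in csubspace_set M.

Let Mpred_closed : submod_closed Mpred.
Proof.
have [[M0 Mlin] _] := csubspaceP M.
split; first exact/mem_set.
by move=> a x y /set_mem Mx /set_mem My; apply/mem_set/Mlin.
Qed.

HB.instance Definition _ := GRing.isSubmodClosed.Build C H Mpred Mpred_closed.
HB.instance Definition _ :=
  GRing.SubChoice_isSubLmodule.Build C H Mpred (csubspace_type M)
    (GRing.subsemimodClosedP Mpred).

Let sub_norm (x : M) : C := `|incl x|.

Let sub_normD (x y : M) : sub_norm (x + y) <= sub_norm x + sub_norm y.
Proof. exact: ler_normD. Qed.

Let sub_normZ (a : C) (x : M) : sub_norm (a *: x) = `|a| * sub_norm x.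
Proof. exact: normrZ. Qed.

Let sub_norm0_eq0 (x : M) : sub_norm x = 0 -> x = 0.
Proof. by move=> /normr0_eq0 x0; apply: val_inj. Qed.

HB.instance Definition _ := Lmodule_isNormed.Build C (csubspace_type M)
  sub_normD sub_normZ sub_norm0_eq0.

Let sub_complete (F : set_system (csubspace_type M)) :
  ProperFilter F -> cauchy F -> cvg F.
Proof.
move=> FF /cauchyP Fc.
have /cvg_ex[/= l Fl] : cvg (@incl R H M @ F).
  apply/cauchy_cvgP/cauchyP => e e0.
  have [x Fx] := Fc _ e0; exists (incl x).
  suff : F (@incl R H M @^-1` ball (incl x) e) by [].
  by apply: filterS Fx => y; rewrite -!ball_normE.
have Ml : l \in csubspace_set M.
  apply/mem_set; move: l Fl; apply: (closed_cvg _ (csubspaceP M).2).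
  by apply: nearW => x; exact/set_mem/inclP.
apply/cvg_ex; exists (CSubspaceElt Ml).
apply/cvgrPdist_lt => e e0.
by move/cvgrPdist_lt : Fl => /(_ _ e0).
Qed.

HB.instance Definition _ :=
  Uniform_isComplete.Build (csubspace_type M) sub_complete.

Lemma incl_continuous : continuous (@incl R H M).
Proof.
move=> x; apply/(@cvgrPdist_lt _ _ _ (nbhs x)) => e e0.
have /(@cvgrPdist_lt _ _ _ (nbhs x)) : (id @ nbhs x) --> x by exact: cvg_id.
by move=> /(_ _ e0).
Qed.

Let sub_inner (x y : M) : C := inner (incl x) (incl y).

Let sub_inner_linearl (a : C) (x y z : M) :
  sub_inner (a *: x + y) z = a * sub_inner x z + sub_inner y z.
Proof. exact: inner_linearl. Qed.

Let sub_innerC (x y : M) : sub_inner x y = Num.conj (sub_inner y x).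
Proof. exact: innerC. Qed.

Let sub_inner_norm (x : M) : sub_inner x x = `|x| ^+ 2.
Proof. exact: inner_norm. Qed.

HB.instance Definition _ := CompleteNormedModule_isHilbert.Build R
  (csubspace_type M) sub_inner_linearl sub_innerC sub_inner_norm.

End csubspace_hilbert.

Record bop {R : realType} (H K : hilbertType R) := BOp {
  bop_fun :> {linear H -> K};
  bop_continuous : continuous bop_fun
}.

Section bop_pointed.
Context {R : realType} (H K : hilbertType R).

Let zero_continuous : continuous (\0 : {linear H -> K}).
Proof. by move=> x; exact: cvg_cst. Qed.

HB.instance Definition _ := gen_eqMixin (bop H K).
HB.instance Definition _ := gen_choiceMixin (bop H K).
HB.instance Definition _ := isPointed.Build (bop H K) (BOp zero_continuous).
End bop_pointed.

Section operators.
Context {R : realType}.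
Implicit Types H K : hilbertType R.

Definition contraction_op {H} (T : bop H H) := forall x, `|T x| <= `|x|.

Definition isometric {H K} (V : bop H K) := forall x, `|V x| = `|x|.

Definition unitary {H K} (U : bop H K) :=
  isometric U /\ forall y, exists x, U x = y.

Definition adjoint {H K} (A : bop H K) : bop K H :=
  get [set B : bop K H | forall x y, inner (A x) y = inner x (B y)].

(* The order of R[i] makes 0 <= z mean that z is real and nonnegative. *)
Definition positive_op {H} (A : bop H H) := forall x, 0 <= inner (A x) x.

Definition sqrt_op {H} (A : H -> H) : bop H H :=
  get [set B : bop H H | positive_op B /\ forall x, B (B x) = A x].

Definition inv_op {H} (A : H -> H) : bop H H :=
  get [set B : bop H H | forall x, A (B x) = x /\ B (A x) = x].

Definition C00 {H} (T : bop H H) :=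
  [/\ contraction_op T,
      forall x, iter n T x @[n --> \oo] --> (0 : H) &
      forall x, iter n (adjoint T) x @[n --> \oo] --> (0 : H)].

Definition invariant {H} (T : bop H H) (X : set H) :=
  forall x, X x -> X (T x).

Definition orthocomp {H} (X : set H) : set H :=
  [set y | forall x, X x -> inner x y = 0].

Definition reducing {H} (T : bop H H) (M : csubspace H) :=
  invariant T (csubspace_set M) /\
  invariant T (orthocomp (csubspace_set M)).

Section restriction.
Context {H : hilbertType R} (T : bop H H) (M : csubspace H).
Hypothesis TM : invariant T (csubspace_set M).

Let restr (x : M) : M :=
  CSubspaceElt (mem_set (TM (set_mem (inclP x)))).

Let restr_linear : linear restr.
Proof. by move=> a x y; apply: val_inj; rewrite /= linearP. Qed.

HB.instance Definition _ := GRing.isLinear.Build R[i] M M *:%R restr restr_linear.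

Let restr_continuous : continuous restr.
Proof.
move=> x; apply/(@cvgrPdist_lt _ _ _ (nbhs x)) => e e0.
have Tincl : {for x, continuous (T \o @incl R H M)}.
  by apply: continuous_comp; [exact: incl_continuous|exact: bop_continuous].
by move/(@cvgrPdist_lt _ _ _ (nbhs x)) : Tincl => /(_ _ e0).
Qed.

Definition restriction : bop M M := BOp restr_continuous.
End restriction.

Section range.
Context {H K : hilbertType R} (A : bop H K).

Let closure_range_subspace : closed_subspace (closure (range A)).
Proof.
split; last exact: closed_closure.
split; first by apply: subset_closure; exists 0 => //; rewrite linear0.
move=> a x y clx cly; move=> B /nbhs_normP[e /= e0 eB].
pose d := e / (2 * (`|a| + 1)).
have a1 : 0 < `|a| + 1 by rewrite ltr_wpDl.
have d0 : 0 < d by rewrite divr_gt0// mulr_gt0.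
have [_ [[u _ <-] xu]] := clx _ (nbhsx_ballx x _ d0).
have e20 : 0 < e / 2 by rewrite divr_gt0.
have [_ [[v _ <-] yv]] := cly _ (nbhsx_ballx y _ e20).
exists (A (a *: u + v)); split; first by exists (a *: u + v).
apply: eB => /=; rewrite linearP opprD addrACA -scalerBr.
apply: le_lt_trans (ler_normD _ _) _; rewrite normrZ [ltRHS](splitr e).
move: xu yv; rewrite -!ball_normE /= => xu yv.
apply: ler_ltD => //; apply: (@le_trans _ _ ((`|a| + 1) * d)).
  by apply: ler_pM => //; [rewrite lerDl|exact: ltW].
by rewrite /d mulrC invfM mulrA divfK// gt_eqF.
Qed.

Definition closed_range : csubspace K := CSubspace closure_range_subspace.
End range.

Definition defect_op {H} (T : bop H H) : bop H H :=
  sqrt_op (fun x => x - adjoint T (T x)).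

Definition defect_space {H} (T : bop H H) : csubspace H :=
  closed_range (defect_op T).

Definition has_dim H (d : nat) :=
  exists b : 'I_d -> H,
    forall x, exists! c : {ffun 'I_d -> R[i]}, x = \sum_i c i *: b i.

Definition has_defects {H} (T : bop H H) (d : nat) :=
  has_dim (defect_space T) d /\ has_dim (defect_space (adjoint T)) d.

(* The value at x is the element of D_(T^* ) whose image in H is
   - T x + z D_(T^* ) (I - z T^* )^-1 D_T x; this vector lies in D_(T^* )
   because T D_T = D_(T^* ) T. *)
Definition char_fun {H} (T : bop H H) (z : R[i]) (x : defect_space T) :
    defect_space (adjoint T) :=
  get [set y : defect_space (adjoint T) |
    incl y = - T (incl x) +
      z *: defect_op (adjoint T)
             (inv_op (fun h => h - z *: adjoint T h)
                     (defect_op T (incl x)))].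

Definition coincide {E Es E' Es' : hilbertType R}
    (Theta : R[i] -> E -> Es) (Theta' : R[i] -> E' -> Es') :=
  exists (w : bop E E') (ws : bop Es Es'),
    [/\ unitary w, unitary ws &
        forall z, `|z| < 1 -> forall x, Theta' z (w x) = ws (Theta z x)].

Definition scalar_fun (f : R[i] -> R[i]) (z : R[i]) (c : complex_line R) :
  complex_line R := f z *: c.

Definition proj {K} (H : csubspace K) (x : K) : H :=
  get [set h : H | forall k : H, inner (x - incl h) (incl k) = 0].

Definition isometric_dilation {K} (H : csubspace K) (T : bop H H)
    (V : bop K K) :=
  isometric V /\ forall n (h : H), proj H (iter n V (incl h)) = iter n T h.

(* The left-hand side is the closed linear span of the V^n H. *)
Definition minimal_dilation {K} (H : csubspace K) (V : bop K K) :=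
  smallest closed_subspace (\bigcup_n (iter n V @` csubspace_set H)) = setT.

Definition wandering {K} (V : bop K K) (X : set K) :=
  linear_subspace X /\
  forall n m : nat, n != m -> forall x y, X x -> X y ->
    inner (iter n V x) (iter m V y) = 0.

(* Orthogonal series converge exactly when they are square summable, so for a
   wandering X this set is the Hilbert space direct sum of the V^n X. *)
Definition Mplus {K} (V : bop K K) (X : set K) : set K :=
  [set k | exists s : nat -> K, (forall n, X (s n)) /\
    series (fun n => iter n V (s n)) @ \oo --> k].

Definition orthogonal_decomposition {H} (X Y : set H) :=
  (forall x y, X x -> Y y -> inner x y = 0) /\
  [set x + y | x in X & y in Y] = setT.

(* u(V) y = sum_n u_n V^n y, where u_n are the Taylor coefficients of u *)
Definition fcalc {H} (u : nat -> R[i]) (V : bop H H) (y : H) : H :=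
  limn (series (fun n => u n *: iter n V y)).

End operators.

Section inner_functions.
Context {R : realType}.
Local Notation mu := (@lebesgue_measure R).
Local Notation circle := (`[0, 2 * pi]%classic : set R).

(* Functions on the unit circle are functions of the angle t in [0, 2 pi]. *)
Definition square_integrable (f : R -> R[i]) :=
  [/\ measurable_fun circle (fun t => complex.Re (f t)),
      measurable_fun circle (fun t => complex.Im (f t)) &
      mu.-integrable circle
        (fun t => (complex.Re (f t) ^+ 2 + complex.Im (f t) ^+ 2)%:E)].

Definition circle_integral (f : R -> R[i]) : R[i] :=
  (\int[mu]_(t in circle) complex.Re (f t))
  +i* (\int[mu]_(t in circle) complex.Im (f t)).

Definition fourier_coef (f : R -> R[i]) (k : int) : R[i] :=
  ((2 * pi)^-1)%:C *
  circle_integral (fun t => f t * (cos (k%:~R * t) -i* sin (k%:~R * t))).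

(* An element of H^2 is given by its sequence of Taylor coefficients. *)
Definition hardy2 (u : nat -> R[i]) :=
  cvgn (series (fun n => `|u n| ^+ 2 : R[i]^o)).

Definition disc_fun (u : nat -> R[i]) (z : R[i]) : R[i] :=
  limn (series (fun n => u n * z ^+ n : R[i]^o)).

(* f is the L^2 boundary function of u: this determines f almost everywhere. *)
Definition boundary_function (u : nat -> R[i]) (f : R -> R[i]) :=
  square_integrable f /\
  forall k : int, fourier_coef f k = if k is Posz n then u n else 0.

Definition inner_function (u : nat -> R[i]) :=
  hardy2 u /\
  exists2 f, boundary_function u f &
    {ae mu, forall t, circle t -> `|f t| = 1}.

End inner_functions.

(* Main.v *)
From HB Require Import structures.
Require Import Defs.
From mathcomp Require Import all_boot all_order all_algebra.
From mathcomp Require Import complex.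
From mathcomp Require Import all_classical all_reals all_analysis.
From mathcomp Require Import measurable_realfun.
From mathcomp Require Import ring lra.
(** Both directions rest on the geometry of the dilation.  The space L is the
closed span of the gaps V h - T h with h in H, the space Ls is the kernel of
V^*, onto which I - V V^* projects, and V^* extends T^*.  Moreover

  |V h - T h|^2 = |h|^2 - |T h|^2,  |(I - V V^* ) h|^2 = |h|^2 - |T^* h|^2,

so that L and Ls are isometric copies of the two defect spaces of T.

From a reducing subspace to a pair ([reducing_to_pair]).  Suppose that T|M has
defects of dimension 1.  On M this means I - T^*T = a^2 <.,e> e and
I - T T^* = a^2 <.,f> f for unit vectors e, f and one and the same number a > 0
([has_defects1P]), and then y = (V e - T e) / a and ys = (I - V V^* ) f / a are
unit vectors of L and Ls.  The telescoping identity

  y - V^N V^*^N y = sum_(n < N) V^n (I - V V^* ) V^*^n y = sum_(n < N) u_n V^n ys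

has for coefficients u_n the Taylor coefficients of the characteristic
function, and its left-hand side tends to y because T^*^N tends to 0.  So
y = u(V) ys.  Since y is wandering, the sequence u has autocorrelation
sum_n u_n conj(u_(n+k)) = <V^k y, y> = 0 for k > 0 and = 1 for k = 0, which says
that u is inner.

From a pair to a reducing subspace ([pair_to_reducing]).  Given y = u(V) ys, the
closed span K1 of the orbit V^n ys reduces V, and M is the intersection of H
and K1.  The heart of the matter is that this orbit has multiplicity one
([multiplicity_one]): a vector of L orthogonal to y is orthogonal to all of K1.
So L and Ls meet K1 only in the multiples of y and of ys.  Hence M reduces T, the
gaps of vectors of M are multiples of y, their projections to Ls are multiples
of ys, and the defects of T|M have dimension at most 1.  They do not vanish: if
V^* y = 0, then y is a vector of Ls orthogonal to H, against minimality.
The Taylor coefficients of the characteristic function are again those of u.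

It remains to relate sequences with boundary functions: u is inner exactly when
its autocorrelation is that of a unit mass ([inner_function_autocorrelation],
[inner_function_norm]).  The numbers sum_n u_n conj(u_(n+k)) are the Fourier
coefficients of |f|^2, where f is the boundary function, which exists by
[riesz_fischer], and an integrable function is determined by its Fourier
coefficients ([fourier_uniqueness_real]).

Finally, unitary maps between lines are multiplications by unimodular numbers.
A scalar function which coincides with the characteristic function is therefore
a unimodular multiple k u of the u found above ([char_coef_coincide]), and it
suffices to replace y by k y. *)

Set Implicit Arguments.
Unset Strict Implicit.
Unset Printing Implicit Defensive.
Import Order.TTheory GRing.Theory Num.Theory.
Import numFieldNormedType.Exports.
Local Open Scope classical_set_scope.
Local Open Scope complex_scope.
Local Open Scope ring_scope.
Local Notation incl := Defs.incl.
Local Notation proj := Defs.proj.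

(** * Real-valued norms and convergence *)

(** The norm of a complex normed space is a complex number.  Taking its real part
gives access to the theory of ordered fields. *)
Definition rnorm {R : realType} {V : normedZmodType R[i]} (x : V) : R :=
  complex.Re `|x|.

Section real_norm.
Context {R : realType} {V : normedZmodType R[i]}.
Implicit Types x y : V.

Lemma rnormE x : `|x| = (rnorm x)%:C.
Proof. by rewrite /rnorm RRe_real// ger0_real. Qed.

Lemma rnorm_ge0 x : 0 <= rnorm x.
Proof. by rewrite -lecR -rnormE normr_ge0. Qed.

Lemma rnorm_eq0 x : (rnorm x == 0) = (x == 0).
Proof. by rewrite -(inj_eq (@complexI R)) -rnormE normr_eq0. Qed.

Lemma rnorm0 : rnorm (0 : V) = 0.
Proof. by apply/eqP; rewrite rnorm_eq0. Qed.

Lemma rnormN x : rnorm (- x) = rnorm x.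
Proof. by rewrite /rnorm normrN. Qed.

Lemma rdistrC x y : rnorm (x - y) = rnorm (y - x).
Proof. by rewrite /rnorm distrC. Qed.

Lemma rnormD x y : rnorm (x + y) <= rnorm x + rnorm y.
Proof. by rewrite -lecR rmorphD /= -!rnormE ler_normD. Qed.

Lemma rnormB x y : rnorm (x - y) <= rnorm x + rnorm y.
Proof. by rewrite -(rnormN y) rnormD. Qed.

End real_norm.

Section scalars.
Context {R : realType}.
Implicit Types a b : R[i].

Lemma rnormM a b : rnorm (a * b) = rnorm a * rnorm b.
Proof. by apply: (@complexI R); rewrite rmorphM /= -!rnormE normrM. Qed.

Lemma rnormX a n : rnorm (a ^+ n) = rnorm a ^+ n.
Proof. by apply: (@complexI R); rewrite rmorphXn /= -!rnormE normrX. Qed.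

Lemma rnormC a : rnorm (Num.conj a) = rnorm a.
Proof. by rewrite /rnorm norm_conjC. Qed.

Lemma rnormR (r : R) : rnorm (r%:C) = `|r|.
Proof. by rewrite /rnorm normc_def /= expr0n /= addr0 sqrtr_sqr. Qed.

Lemma rnorm_sqr a : (rnorm a ^+ 2)%:C = a * Num.conj a.
Proof. by rewrite -normCK rmorphXn /= -rnormE. Qed.

Lemma conjR (r : R) : Num.conj (r%:C : R[i]) = r%:C.
Proof. by rewrite conj_Creal// complex_real. Qed.

Lemma posC_real a : 0 <= a -> exists2 r : R, 0 <= r & a = r%:C.
Proof.
move=> a0; exists (complex.Re a); last by rewrite RRe_real// ger0_real.
by rewrite -lecR RRe_real// ger0_real.
Qed.

Lemma rnormZ (V : normedModType R[i]) a (x : V) :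
  rnorm (a *: x) = rnorm a * rnorm x.
Proof. by apply: (@complexI R); rewrite rmorphM /= -!rnormE normrZ. Qed.

End scalars.

Lemma cvg_seq_ext {U : topologicalType} (x y : nat -> U) (l : U) :
  (forall n, x n = y n) -> x @ \oo --> l -> y @ \oo --> l.
Proof. by move=> /funext ->. Qed.

Lemma cvg_seqMr {R : realType} (x : nat -> R) (l c : R) :
  x @ \oo --> l -> x n * c @[n --> \oo] --> l * c.
Proof. by move=> xl; apply: cvgM => //; exact: cvg_cst. Qed.

Lemma cvg_seqMl {R : realType} (x : nat -> R) (l c : R) :
  x @ \oo --> l -> c * x n @[n --> \oo] --> c * l.
Proof. by move=> xl; apply: cvgM => //; exact: cvg_cst. Qed.

Section sequences.
Context {R : realType} {V : normedModType R[i]}.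
Implicit Types (x y : nat -> V) (l m : V).

Lemma cvg_rnormP x l : x @ \oo --> l <->
  forall e : R, 0 < e -> exists N, forall n, (N <= n)%N -> rnorm (x n - l) < e.
Proof.
split=> [/cvgrPdist_lt xl e e0|xl].
  have /xl[N _ xN] : 0 < e%:C by rewrite ltcR.
  exists N => n Nn; have := xN n Nn.
  by rewrite distrC rnormE ltcR.
apply/cvgrPdist_lt => e e0.
have [r _ er] := posC_real (ltW e0).
have /xl[N xN] : 0 < r by rewrite -ltcR -er.
by exists N => // n Nn; rewrite distrC rnormE er ltcR xN.
Qed.

Lemma cvg_rnorm0P x l : x @ \oo --> l <-> rnorm (x n - l) @[n --> \oo] --> (0 : R).
Proof.
split=> [/cvg_rnormP xl|/cvgrPdist_lt xl].
  apply/cvgrPdist_lt => e /xl[N xN]; exists N => // n Nn.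
  by rewrite sub0r normrN ger0_norm ?rnorm_ge0 ?xN.
apply/cvg_rnormP => e /xl[N _ xN]; exists N => n /xN.
by rewrite sub0r normrN ger0_norm ?rnorm_ge0.
Qed.

Lemma cvg_seq_unique x l m : x @ \oo --> l -> x @ \oo --> m -> l = m.
Proof. exact: (cvg_unique (@norm_hausdorff _ V)). Qed.

Lemma cvg_seqB x y l m : x @ \oo --> l -> y @ \oo --> m ->
  x n - y n @[n --> \oo] --> l - m.
Proof. exact: cvgB. Qed.

Lemma cvg_seqD x y l m : x @ \oo --> l -> y @ \oo --> m ->
  x n + y n @[n --> \oo] --> l + m.
Proof. exact: cvgD. Qed.

Lemma cvg_seqZ (a : R[i]) x l : x @ \oo --> l -> a *: x n @[n --> \oo] --> a *: l.
Proof. exact: cvgZl_tmp. Qed.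

Lemma cvg_rnorm x l : x @ \oo --> l -> rnorm (x n) @[n --> \oo] --> rnorm l.
Proof.
move=> /cvg_rnormP xl; apply/cvgrPdist_lt => e /xl[N xN]; exists N => // n Nn.
apply: le_lt_trans (xN _ Nn); rewrite ler_norml; apply/andP; split.
  have := rnormD (x n - l) l; rewrite subrK; lra.
have := rnormD (l - x n) (x n); rewrite subrK rdistrC; lra.
Qed.

End sequences.

Lemma cauchy_rnorm_cvg {R : realType} {V : completeNormedModType R[i]}
    (x : nat -> V) :
  (forall e : R, 0 < e -> exists N, forall n m, (N <= n)%N -> (N <= m)%N ->
    rnorm (x n - x m) < e) -> cvgn x.
Proof.
move=> xc; apply/cauchy_cvgP/cauchyP => e e0.
have [r _ er] := posC_real (ltW e0).
have /xc[N xN] : 0 < r by rewrite -ltcR -er.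
exists (x N); exists N => // n /= Nn.
by rewrite -ball_normE /= rnormE er ltcR xN.
Qed.

Lemma cauchy_rnorm_cvg_le {R : realType} {V : completeNormedModType R[i]}
    (x : nat -> V) :
  (forall e : R, 0 < e -> exists N, forall n m, (N <= n)%N -> (n <= m)%N ->
    rnorm (x m - x n) < e) -> cvgn x.
Proof.
move=> xc; apply: cauchy_rnorm_cvg => e /xc[N xN]; exists N => n m Nn Nm.
by have [nm|/ltnW mn] := leqP n m; [rewrite rdistrC|]; exact: xN.
Qed.

Lemma series_tail {R : realType} (v : nat -> R) : cvgn (series v) ->
  forall e : R, 0 < e -> exists N, forall n m, (N <= n)%N -> (n <= m)%N ->
    `|\sum_(n <= k < m) v k| < e.
Proof.
move=> cv e e0; have e2 : 0 < e / 2 by rewrite divr_gt0.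
have /cvgrPdist_lt/(_ _ e2)[N _ vN] : series v @ \oo --> limn (series v) by exact: cv.
exists N => n m Nn nm; rewrite -sub_series_geq//.
have h1 := vN _ Nn; have h2 := vN _ (leq_trans Nn nm).
have -> : series v m - series v n =
    (limn (series v) - series v n) - (limn (series v) - series v m) by ring.
rewrite [ltRHS]splitr.
apply: le_lt_trans (ler_normB _ _) _; rewrite ltrD//=.
Qed.

Lemma rnorm_sum {R : realType} {V : normedZmodType R[i]} (I : Type)
    (r : seq I) (P : pred I) (F : I -> V) :
  rnorm (\sum_(i <- r | P i) F i) <= \sum_(i <- r | P i) rnorm (F i).
Proof.
elim/big_ind2: _ => //; first by rewrite rnorm0.
by move=> x a y b xa yb; apply: le_trans (rnormD _ _) _; exact: lerD.
Qed.

Lemma series_rnorm_cvg {R : realType} {V : completeNormedModType R[i]}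
    (v : nat -> R) (x : nat -> V) :
  (forall n, rnorm (x n) <= v n) -> cvgn (series v) -> cvgn (series x).
Proof.
move=> xv cv; apply: cauchy_rnorm_cvg_le => e e0.
have [N vN] := series_tail cv e0; exists N => n m Nn nm.
rewrite sub_series_geq//; apply: le_lt_trans (vN _ _ Nn nm).
apply: le_trans (rnorm_sum (index_iota n m) xpredT x) _.
by apply: le_trans (ler_norm _); exact: ler_sum.
Qed.

(** * Geometry of Hilbert spaces *)
Section hilbert.
Context {R : realType} {H : hilbertType R}.
Implicit Types (x y z : H) (a : R[i]).

Lemma innerDl x y z : inner (x + y) z = inner x z + inner y z.
Proof. exact: linearDl. Qed.

Lemma innerDr x y z : inner x (y + z) = inner x y + inner x z.
Proof. exact: linearDr. Qed.

Lemma innerBl x y z : inner (x - y) z = inner x z - inner y z.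
Proof. exact: linearBl. Qed.

Lemma innerBr x y z : inner x (y - z) = inner x y - inner x z.
Proof. exact: linearBr. Qed.

Lemma innerNl x y : inner (- x) y = - inner x y.
Proof. exact: linearNl. Qed.

Lemma innerNr x y : inner x (- y) = - inner x y.
Proof. exact: linearNr. Qed.

Lemma innerZl a x y : inner (a *: x) y = a * inner x y.
Proof. exact: linearZl_LR. Qed.

Lemma innerZr a x y : inner x (a *: y) = Num.conj a * inner x y.
Proof. exact: linearZr_LR. Qed.

Lemma inner0l x : inner 0 x = 0.
Proof. exact: linear0l. Qed.

Lemma inner0r x : inner x 0 = 0.
Proof. exact: linear0r. Qed.

Lemma inner_suml (I : Type) (r : seq I) (P : pred I) (F : I -> H) y :
  inner (\sum_(i <- r | P i) F i) y = \sum_(i <- r | P i) inner (F i) y.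
Proof. exact: linear_sumlz. Qed.

Lemma inner_sumr (I : Type) (r : seq I) (P : pred I) (F : I -> H) y :
  inner y (\sum_(i <- r | P i) F i) = \sum_(i <- r | P i) inner y (F i).
Proof. exact: linear_sumr. Qed.

Lemma inner_eq0C x y : inner x y = 0 -> inner y x = 0.
Proof. by move=> xy; rewrite innerC xy rmorph0. Qed.

Lemma innerxx x : inner x x = (rnorm x ^+ 2)%:C.
Proof. by rewrite inner_norm rnormE rmorphXn. Qed.

Lemma innerxx_eq0 x : inner x x = 0 -> x = 0.
Proof.
by rewrite innerxx => /(@complexI R _ 0)/eqP; rewrite sqrf_eq0 rnorm_eq0 => /eqP.
Qed.

Lemma inner_inj x y : (forall z, inner x z = inner y z) -> x = y.
Proof.
move=> xy; apply/eqP; rewrite -subr_eq0; apply/eqP/innerxx_eq0.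
by rewrite innerBl xy subrr.
Qed.

Lemma pythagoras x y : inner x y = 0 ->
  rnorm (x + y) ^+ 2 = rnorm x ^+ 2 + rnorm y ^+ 2.
Proof.
move=> xy; apply: (@complexI R); rewrite rmorphD /= -!innerxx.
by rewrite innerDl !innerDr xy (inner_eq0C xy) addr0 add0r.
Qed.

Lemma parallelogram x y :
  rnorm (x + y) ^+ 2 + rnorm (x - y) ^+ 2 =
  2 * rnorm x ^+ 2 + 2 * rnorm y ^+ 2.
Proof.
apply: (@complexI R); rewrite mulr2n !mulrDl !mul1r !rmorphD /= -!innerxx.
by rewrite !(innerDl, innerDr, innerNl, innerNr); ring.
Qed.

(** Pythagoras for the component of x orthogonal to y.  This one identity yields
the inequality of Cauchy and Schwarz, that of Bessel, and the fact that a
point of minimal distance is an orthogonal projection. *)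
Lemma rnorm_sub_proj x y : y != 0 ->
  rnorm (x - (inner x y / inner y y) *: y) ^+ 2 =
  rnorm x ^+ 2 - rnorm (inner x y) ^+ 2 / rnorm y ^+ 2.
Proof.
move=> y0; have yy0 : inner y y != 0 by apply: contra_neq y0 => /innerxx_eq0.
set z := _ *: y; have xzz : inner (x - z) z = 0.
  by rewrite innerZr innerBl innerZl divfK// subrr mulr0.
have := pythagoras xzz; rewrite subrK => ->.
suff -> : rnorm (inner x y) ^+ 2 / rnorm y ^+ 2 = rnorm z ^+ 2 by rewrite addrK.
have ry0 : rnorm y != 0 by rewrite rnorm_eq0.
rewrite rnormZ innerxx !rnormM -fmorphV rnormR ger0_norm.
  by field.
by rewrite invr_ge0 exprn_ge0// rnorm_ge0.
Qed.

Lemma cauchy_schwarz x y : rnorm (inner x y) <= rnorm x * rnorm y.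
Proof.
have [->|y0] := eqVneq y 0; first by rewrite inner0r !rnorm0 mulr0.
have := rnorm_sub_proj x y0; have := sqr_ge0 (rnorm (x - (inner x y / inner y y) *: y)).
move=> /[swap] ->; rewrite subr_ge0 ler_pdivrMr; last first.
  by rewrite exprn_gt0// lt_def rnorm_eq0 y0 rnorm_ge0.
by rewrite -exprMn ler_sqr// nnegrE ?mulr_ge0 ?rnorm_ge0.
Qed.

Lemma cvg_innerl (x : nat -> H) l y : x @ \oo --> l ->
  (inner (x n) y : R[i]^o) @[n --> \oo] --> (inner l y : R[i]^o).
Proof.
move=> /cvg_rnormP xl; apply/cvg_rnormP => e e0.
have y0 : 0 < rnorm y + 1 by rewrite ltr_wpDl// rnorm_ge0.
have [|N xN] := xl (e / (rnorm y + 1)); first by rewrite divr_gt0.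
exists N => n /xN; rewrite ltr_pdivlMr// => xe.
rewrite -innerBl; apply: le_lt_trans (cauchy_schwarz _ _) _.
by apply: le_lt_trans xe; rewrite ler_wpM2l ?rnorm_ge0// lerDl.
Qed.

Lemma cvg_unique_inner (x : nat -> H) l y (c : R[i]) : x @ \oo --> l ->
  (exists N, forall n, (N <= n)%N -> inner (x n) y = c) -> inner l y = c.
Proof.
move=> /(@cvg_innerl _ _ y) xl [N xN].
apply/eqP; rewrite -subr_eq0 -rnorm_eq0.
apply/eqP/le_anti; rewrite rnorm_ge0 andbT; apply/ler_addgt0Pr => e e0.
have [M xM] := (cvg_rnormP _ _).1 xl e e0.
rewrite add0r rdistrC; apply: ltW.
by rewrite -(xN (maxn N M)) ?leq_maxl// xM ?leq_maxr.
Qed.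

End hilbert.

Section subspaces.
Context {R : realType} {H : hilbertType R}.
Implicit Types (x y z : H) (a : R[i]).

Section subspace_closed.
Context {X : set H} (linX : linear_subspace X).

Lemma subspace0 : X 0. Proof. exact: linX.1. Qed.

Lemma subspaceZ a x : X x -> X (a *: x).
Proof. by move=> Xx; rewrite -[_ *: _]addr0; apply: linX.2 => //; exact: subspace0. Qed.

Lemma subspaceD x y : X x -> X y -> X (x + y).
Proof. by move=> Xx Xy; rewrite -(scale1r x); apply: linX.2. Qed.

Lemma subspaceN x : X x -> X (- x).
Proof. by move=> Xx; rewrite -scaleN1r; apply: subspaceZ. Qed.

Lemma subspaceB x y : X x -> X y -> X (x - y).
Proof. by move=> Xx Xy; apply: subspaceD => //; apply: subspaceN. Qed.

End subspace_closed.

Lemma closed_cvgn (X : set H) (x : nat -> H) l : closed X ->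
  (forall n, X (x n)) -> x @ \oo --> l -> X l.
Proof. by move=> cX Xx; apply: (closed_cvg _ cX); apply: nearW. Qed.

Lemma closure_seq (X : set H) l : closure X l ->
  exists2 x : nat -> H, (forall n, X (x n)) & x @ \oo --> l.
Proof.
move=> clX.
have /choice[x xP] : forall n : nat, exists y, X y /\ rnorm (y - l) < n.+1%:R^-1.
  move=> n; have e0 : 0 < (n.+1%:R^-1)%:C :> R[i] by rewrite ltcR invr_gt0.
  have [y [Xy ly]] := clX _ (nbhsx_ballx l _ e0).
  exists y; split => //; move: ly.
  by rewrite -ball_normE /= rnormE ltcR rdistrC.
exists x => [n|]; first exact: (xP n).1.
apply/cvg_rnormP => e e0.
exists (Num.truncn e^-1) => n Nn; apply: lt_le_trans (xP n).2 _.
rewrite -(invrK e) lef_pV2 ?posrE ?invr_gt0//.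
by apply: ltW; rewrite -truncn_lt_nat ?invr_ge0 ?ltW.
Qed.

Lemma seq_closed (X : set H) :
  (forall (x : nat -> H) l, (forall n, X (x n)) -> x @ \oo --> l -> X l) ->
  closed X.
Proof. by move=> cX l /closure_seq[x Xx xl]; exact: cX xl. Qed.

Lemma cvg_inner_eq0 (x : nat -> H) l y : x @ \oo --> l ->
  (forall n, inner (x n) y = 0) -> inner l y = 0.
Proof. by move=> xl xy; apply: (cvg_unique_inner xl); exists 0. Qed.

Lemma orthocomp_closed_subspace (X : set H) : closed_subspace (orthocomp X).
Proof.
split; first split.
- by move=> x _; rewrite inner0r.
- move=> a x y xX yX z Xz.
  by rewrite innerDr innerZr xX// yX// mulr0 addr0.
apply: seq_closed => x l xX xl y Xy; apply: inner_eq0C.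
by apply: (cvg_inner_eq0 xl) => n; apply: inner_eq0C; exact: xX.
Qed.

(** By the parallelogram identity, applied to midpoints, a sequence of X which
minimizes the distance to x is a Cauchy sequence.  At its limit l the residue
x - l is orthogonal to X, as removing its component along a vector of X would
bring l closer to x. *)
Theorem projection_exists (X : set H) x : closed_subspace X ->
  exists2 m, X m & forall k, X k -> inner (x - m) k = 0.
Proof.
move=> [linX cX].
pose D := [set rnorm (x - m) ^+ 2 | m in X].
have D0 : D (rnorm (x - 0) ^+ 2) by exists 0 => //; exact: (subspace0 linX).
have Dlb : has_lbound D by exists 0 => _ [m _ <-]; exact: sqr_ge0.
have Dinf : has_inf D by split => //; exists (rnorm (x - 0) ^+ 2).
pose d := inf D.
have dle m : X m -> d <= rnorm (x - m) ^+ 2.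
  by move=> Xm; apply: ge_inf => //; exists m.
have /choice[m mP] : forall n : nat, exists m, X m /\
    rnorm (x - m) ^+ 2 < d + n.+1%:R^-1.
  move=> n; have [|_ [m Xm <-] lt] := @inf_adherent _ D n.+1%:R^-1 _ Dinf.
    by rewrite invr_gt0.
  by exists m.
(* The midpoint of m n and m k is in X, so it is not closer to x than d. *)
have close n k : rnorm (m n - m k) ^+ 2 <= 2 * n.+1%:R^-1 + 2 * k.+1%:R^-1.
  have := parallelogram (x - m k) (x - m n).
  have -> : x - m k - (x - m n) = m n - m k by rewrite opprB addrC subrKA.
  rewrite [x - m k + _]addrACA -opprD -(mulr2n x).
  have -> : x *+ 2 - (m k + m n) = 2%:R *: (x - 2%:R^-1 *: (m k + m n)).
    by rewrite scalerBr scalerA mulfV ?pnatr_eq0// scale1r scaler_nat.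
  have Xmid : X (2%:R^-1 *: (m k + m n)).
    by apply: (subspaceZ linX); apply: (subspaceD linX); exact: (mP _).1.
  have := dle _ Xmid; rewrite rnormZ.
  have -> : rnorm (2%:R : R[i]) = 2.
    by rewrite -[2%:R](rmorph_nat (@real_complex R)) rnormR ger0_norm.
  have := (mP n).2; have := (mP k).2.
  rewrite -[X in _ = _ -> _ <= X]mulrDr.
  set A := rnorm (x - m k) ^+ 2; set B := rnorm (x - m n) ^+ 2.
  rewrite addrC (addrC _ (m n)).
  rewrite exprMn (_ : 2 ^+ 2 = 4 :> R); last by rewrite -natrX.
  move: k.+1%:R^-1 n.+1%:R^-1 => p q; lra.
have [l ml] : exists l : H, m @ \oo --> l.
  apply/cvg_ex/cauchy_rnorm_cvg => e e0.
  exists (Num.truncn (4 / e ^+ 2)).+1 => n k Nn Nk.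
  have small j : (Num.truncn (4 / e ^+ 2) < j)%N -> j.+1%:R^-1 < e ^+ 2 / 4.
    move=> Nj; rewrite -[e ^+ 2 / 4]invf_div ltf_pV2 ?posrE ?divr_gt0 ?exprn_gt0//.
    rewrite -truncn_lt_nat ?divr_ge0 ?exprn_ge0// ?ltW//.
    by apply: ltn_trans Nj _.
  rewrite -(@ltr_pXn2r _ 2) ?nnegrE ?rnorm_ge0 ?ltW//.
  have := close n k; have := small _ Nn; have := small _ Nk.
  move: n.+1%:R^-1 k.+1%:R^-1 => p q; lra.
have Xl : X l by apply: (closed_cvgn cX _ ml) => n; exact: (mP n).1.
exists l => // k Xk.
have [->|k0] := eqVneq k 0; first by rewrite inner0r.
have ld : rnorm (x - l) ^+ 2 <= d.
  apply/ler_addgt0Pr => e e0.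
  have xml : (fun n => x - m n) @ \oo --> x - l by apply: cvgB => //; exact: cvg_cst.
  have sq : rnorm (x - m n) ^+ 2 @[n --> \oo] --> rnorm (x - l) ^+ 2.
    by rewrite expr2; apply: cvgM; exact: cvg_rnorm.
  apply: (ler_cvg_to sq (cvg_cst (d + e))).
  exists (Num.truncn e^-1) => // n /= Nn.
  apply: le_trans (ltW (mP n).2) _; rewrite lerD2l.
  rewrite -(invrK e) lef_pV2 ?posrE ?invr_gt0//.
  by apply: ltW; rewrite -truncn_lt_nat ?invr_ge0 ?ltW.
have := rnorm_sub_proj (x - l) k0.
rewrite -addrA -opprD.
have : X (l + inner (x - l) k / inner k k *: k).
  by apply: (subspaceD linX) => //; exact: (subspaceZ linX).
move=> /dle dl E; move: dl; rewrite E => dl.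
apply/eqP; rewrite -rnorm_eq0 -sqrf_eq0.
have k1 : 0 < rnorm k ^+ 2 by rewrite exprn_gt0// lt_def rnorm_eq0 k0 rnorm_ge0.
have : rnorm (inner (x - l) k) ^+ 2 / rnorm k ^+ 2 <= 0 by lra.
rewrite pmulr_lle0 ?invr_gt0// => q0.
by rewrite -[_ == 0]/(_ == 0 :> R) eq_le q0 sqr_ge0.
Qed.

Lemma orthocompK (X : set H) : closed_subspace X -> orthocomp (orthocomp X) `<=` X.
Proof.
move=> cX x xX; have [m Xm mP] := projection_exists x cX.
suff -> : x = m by [].
have xm : orthocomp X (x - m) by move=> k /mP/inner_eq0C.
apply/eqP; rewrite -subr_eq0; apply/eqP/innerxx_eq0.
by rewrite innerBr (xX _ xm) (mP _ Xm) subr0.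
Qed.

End subspaces.

(** * Bounded operators and adjoints *)
Section operators.
Context {R : realType}.
Implicit Types H K : hilbertType R.

Lemma bopZ H K (A : bop H K) a x : A (a *: x) = a *: A x.
Proof. exact: linearZ_LR. Qed.

Lemma bopD H K (A : bop H K) x y : A (x + y) = A x + A y.
Proof. exact: linearD. Qed.

Lemma bopB H K (A : bop H K) x y : A (x - y) = A x - A y.
Proof. exact: linearB. Qed.

Lemma bop0 H K (A : bop H K) : A 0 = 0.
Proof. exact: linear0. Qed.

Lemma bop_sum H K (A : bop H K) (I : Type) (r : seq I) (P : pred I) (F : I -> H) :
  A (\sum_(i <- r | P i) F i) = \sum_(i <- r | P i) A (F i).
Proof. exact: linear_sum. Qed.

Lemma bop_bounded H K (A : bop H K) :
  exists2 c : R, 0 <= c & forall x, rnorm (A x) <= c * rnorm x.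
Proof.
have := continuous_linear_bounded 0 (@bop_continuous _ _ _ A 0).
move=> /linear_boundedP/pinfty_ex_gt0[r r0 Ar].
have [s s0 rs] := posC_real (ltW r0).
by exists s => // x; have := Ar x; rewrite !rnormE rs -rmorphM lecR.
Qed.

Lemma bop_cvg H K (A : bop H K) (x : nat -> H) l :
  x @ \oo --> l -> A (x n) @[n --> \oo] --> A l.
Proof.
by move=> xl; apply: (@cvg_comp _ _ _ x (bop_fun A) \oo _ _ xl); exact: bop_continuous.
Qed.

(** This is how all concrete bounded operators below are built. *)
Lemma bounded_linear_bop H K (f : H -> K) (c : R) : linear f ->
  (forall x, rnorm (f x) <= c * rnorm x) -> exists A : bop H K, A =1 f.
Proof.
move=> lf fc.
pose L := GRing.isLinear.Build R[i] H K *:%R f lf.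
pose F : {linear H -> K} := HB.pack f L.
have cF : continuous F.
  move=> x; apply/(@cvgrPdist_lt _ _ _ (nbhs x)) => e e0.
  have [r _ er] := posC_real (ltW e0).
  have c1 : 0 < `|c| + 1 by rewrite ltr_wpDl.
  have r0 : 0 < r by rewrite -ltcR -er.
  have d0 : 0 < (r / (`|c| + 1))%:C :> R[i] by rewrite ltcR divr_gt0.
  apply: filterS (nbhsx_ballx x _ d0) => y.
  rewrite -ball_normE /= !rnormE er !ltcR => xy.
  rewrite -(linearB F); apply: le_lt_trans (fc _) _.
  move: xy; rewrite ltr_pdivlMr// => xy; apply: le_lt_trans xy.
  rewrite mulrC ler_wpM2l ?rnorm_ge0//.
  by apply: le_trans (ler_norm c) _; rewrite lerDl.
by exists (BOp cF).
Qed.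

End operators.

Section adjoints.
Context {R : realType}.
Implicit Types H K : hilbertType R.

(** A nonzero phi does not vanish at some z orthogonal to its kernel.  Every
x is the sum of a multiple of z and of an element of the kernel, so that phi is
proportional to the inner product with z. *)
Lemma riesz H (phi : H -> R[i]) (c : R) :
  (forall a x y, phi (a *: x + y) = a * phi x + phi y) ->
  (forall x, rnorm (phi x) <= c * rnorm x) ->
  exists y, forall x, phi x = inner x y.
Proof.
move=> lphi bphi.
have phi0 : phi 0 = 0.
  by have := lphi (-1) 0 0; rewrite scaler0 addr0 mulN1r addNr.
have phiB x y : phi (x - y) = phi x - phi y.
  by rewrite addrC -scaleN1r lphi mulN1r addrC.
have phiZ a x : phi (a *: x) = a * phi x by rewrite -[a *: x]addr0 lphi phi0 addr0.
have ker : closed_subspace [set x | phi x = 0].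
  split; first by split => // a x y /= x0 y0; rewrite lphi x0 y0 mulr0 addr0.
  apply: seq_closed => x l x0 /cvg_rnormP xl.
  apply/eqP; rewrite -rnorm_eq0; apply/eqP/le_anti; rewrite rnorm_ge0 andbT.
  apply/ler_addgt0Pr => e e0; rewrite add0r.
  have c1 : 0 < `|c| + 1 by rewrite ltr_wpDl.
  have [|N xN] := xl (e / (`|c| + 1)); first by rewrite divr_gt0.
  have := xN N (leqnn _); rewrite ltr_pdivlMr// => xe; apply: le_trans (ltW xe).
  rewrite -[phi l]subr0 -(x0 N) -phiB; apply: le_trans (bphi _) _.
  rewrite rdistrC mulrC ler_wpM2l ?rnorm_ge0//.
  by apply: le_trans (ler_norm c) _; rewrite lerDl.
have [phi_eq0|/existsNP[x1 x10]] := pselect (forall x, phi x = 0).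
  by exists 0 => x; rewrite phi_eq0 inner0r.
have [m m0 mP] := projection_exists x1 ker.
pose z := x1 - m; have phiz : phi z != 0 by rewrite phiB m0 subr0; apply/eqP.
have zz : inner z z != 0.
  by apply: contra_neq phiz => /innerxx_eq0 ->.
exists ((Num.conj (phi z / inner z z)) *: z) => x.
rewrite innerZr (@conjCK R[i]).
have /mP : phi (x - (phi x / phi z) *: z) = 0.
  by rewrite phiB phiZ divfK// subrr.
move=> /inner_eq0C; rewrite innerBl innerZl => /eqP; rewrite subr_eq0 => /eqP ->.
by field; rewrite zz phiz.
Qed.

(** The vector given by [riesz] depends linearly on y, and the bound of A is a
bound for its adjoint. *)
Lemma adjoint_exists H K (A : bop H K) :
  exists B : bop K H, forall x y, inner (A x) y = inner x (B y).
Proof.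
have [c c0 Ac] := bop_bounded A.
have /choice[f fP] y : exists z, forall x, inner (A x) y = inner x z.
  apply: (@riesz _ _ (c * rnorm y)) => [a u v|x].
    by rewrite linearP innerDl innerZl.
  apply: le_trans (cauchy_schwarz _ _) _.
  by rewrite mulrAC ler_wpM2r ?rnorm_ge0.
have lf : linear f.
  move=> a x y; apply: inner_inj => z.
  rewrite innerC -fP innerDr innerZr !fP -innerZr -innerDr.
  by rewrite [RHS]innerC.
have [|B Bf] := @bounded_linear_bop _ _ _ f c lf.
  move=> y; have [->|fy] := eqVneq (f y) 0.
    by rewrite rnorm0 mulr_ge0 ?rnorm_ge0.
  have fy0 : 0 < rnorm (f y) by rewrite lt_def rnorm_eq0 fy rnorm_ge0.
  rewrite -(ler_pM2l fy0) -expr2.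
  have -> : rnorm (f y) ^+ 2 = rnorm (inner (A (f y)) y).
    by rewrite fP innerxx rnormR ger0_norm// sqr_ge0.
  apply: le_trans (cauchy_schwarz _ _) _.
  by rewrite mulrA (mulrC _ c) ler_wpM2r ?rnorm_ge0.
by exists B => x y; rewrite Bf.
Qed.

Lemma adjointP H K (A : bop H K) x y : inner (A x) y = inner x (adjoint A y).
Proof.
by have := getPex (adjoint_exists A); exact.
Qed.

Lemma adjointP' H K (A : bop H K) x y : inner x (A y) = inner (adjoint A x) y.
Proof. by rewrite innerC adjointP -innerC. Qed.

Lemma adjoint_unique H K (A : bop H K) (f : K -> H) :
  (forall x y, inner (A x) y = inner x (f y)) -> adjoint A =1 f.
Proof.
move=> Af y; apply: inner_inj => z.
by rewrite innerC -adjointP Af -innerC.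
Qed.

Lemma adjointK H K (A : bop H K) : adjoint (adjoint A) =1 A.
Proof. by apply: adjoint_unique => x y; rewrite adjointP'. Qed.

Lemma adjoint_contraction H (A : bop H H) :
  (forall x, rnorm (A x) <= rnorm x) -> forall x, rnorm (adjoint A x) <= rnorm x.
Proof.
move=> Ac x; have [->|Ax] := eqVneq (adjoint A x) 0; first by rewrite rnorm0 rnorm_ge0.
have Ax0 : 0 < rnorm (adjoint A x) by rewrite lt_def rnorm_eq0 Ax rnorm_ge0.
rewrite -(ler_pM2r Ax0) -expr2.
have -> : rnorm (adjoint A x) ^+ 2 = rnorm (inner x (A (adjoint A x))).
  by rewrite adjointP' innerxx rnormR ger0_norm// sqr_ge0.
apply: le_trans (cauchy_schwarz _ _) _.
by rewrite ler_wpM2l ?rnorm_ge0.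
Qed.

End adjoints.

(** * Neumann series *)
Section neumann.
Context {R : realType} {H : hilbertType R}.

Lemma iter_linear (A : bop H H) n : linear (iter n A).
Proof. by elim: n => [|n IH] a x y //=; rewrite IH linearP. Qed.

Lemma iter_contraction (A : bop H H) n x :
  (forall x, rnorm (A x) <= rnorm x) -> rnorm (iter n A x) <= rnorm x.
Proof. by move=> Ac; elim: n => //= n; apply: le_trans. Qed.

Lemma neumann_series (A : bop H H) (z : R[i]) :
  (forall x, rnorm (A x) <= rnorm x) -> rnorm z < 1 ->
  forall x, cvgn (series (fun n => z ^+ n *: iter n A x)).
Proof.
move=> Ac z1 x.
apply: (@series_rnorm_cvg _ _ (geometric (rnorm x) (rnorm z))).
  move=> n; rewrite rnormZ rnormX mulrC ler_wpM2r ?exprn_ge0 ?rnorm_ge0//.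
  exact: iter_contraction.
by apply: is_cvg_geometric_series; rewrite ger0_norm// rnorm_ge0.
Qed.

(** The sum f of the Neumann series is a two-sided inverse of I - z A.  Any other
inverse agrees with it, and so does the one which [inv_op] chooses. *)
Lemma inv_op_cvg (A : bop H H) (z : R[i]) :
  (forall x, rnorm (A x) <= rnorm x) -> rnorm z < 1 ->
  forall x, series (fun n => z ^+ n *: iter n A x) @ \oo -->
    inv_op (fun h => h - z *: A h) x.
Proof.
move=> Ac z1.
pose s x := series (fun n => z ^+ n *: iter n A x).
have cs x : cvgn (s x) by exact: neumann_series.
pose f x : H := limn (s x).
have sf x : s x @ \oo --> f x by exact: cs.
have sE x n : s x n - z *: A (s x n) = x - z ^+ n *: iter n A x.
  rewrite /s /series /=; elim: n => [|n IH].
    by rewrite big_geq// linear0 scaler0 subr0 expr0 scale1r subrr.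
  rewrite big_nat_recr//= linearD scalerDr opprD addrACA IH bopZ scalerA -exprS.
  by rewrite addrA subrK.
have z0 x : z ^+ n *: iter n A x @[n --> \oo] --> (0 : H).
  apply/cvg_rnorm0P.
  apply: (@squeeze_cvgr _ _ _ _ (cst 0) (geometric (rnorm x) (rnorm z))).
  - apply: nearW => n /=; rewrite subr0 rnorm_ge0 rnormZ rnormX mulrC.
    rewrite ler_wpM2r ?exprn_ge0 ?rnorm_ge0//; exact: iter_contraction.
  - exact: cvg_cst.
  - by apply: cvg_geometric; rewrite ger0_norm// rnorm_ge0.
have right x : f x - z *: A (f x) = x.
  have h1 : s x n - z *: A (s x n) @[n --> \oo] --> f x - z *: A (f x).
    by apply: cvg_seqB; [|apply: cvg_seqZ; apply: bop_cvg]; exact: sf.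
  have h2 : s x n - z *: A (s x n) @[n --> \oo] --> x.
    apply: (@cvg_seq_ext _ (fun n => x - z ^+ n *: iter n A x)) => [n|]; first by rewrite sE.
    by rewrite -[X in _ --> X]subr0; apply: cvg_seqB => //; exact: cvg_cst.
  exact: (cvg_seq_unique h1 h2).
have lf : linear f.
  move=> a x y; apply: (cvg_seq_unique (sf _)).
  have : a *: s x n + s y n @[n --> \oo] --> a *: f x + f y.
    by apply: cvg_seqD; [apply: cvg_seqZ|]; exact: sf.
  apply: cvg_seq_ext => n; rewrite /s /series /= scaler_sumr -big_split /=; apply: eq_bigr => k _.
  by rewrite iter_linear scalerDr !scalerA mulrC.
have fb x : rnorm (f x) <= (1 - rnorm z)^-1 * rnorm x.
  have z2 : 0 < 1 - rnorm z by rewrite subr_gt0.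
  rewrite mulrC ler_pdivlMr// mulrBr mulr1 lerBlDr.
  rewrite -{1}[f x](subrK (z *: A (f x))) right (mulrC (rnorm (f x))).
  apply: le_trans (rnormD _ _) _; rewrite lerD2l rnormZ.
  by rewrite ler_wpM2l ?rnorm_ge0.
have [B Bf] := bounded_linear_bop lf fb.
(* f commutes with A, so that the right inverse is also a left inverse. *)
have fAC x : f (A x) = A (f x).
  apply: (cvg_seq_unique (sf _)).
  have := bop_cvg (A := A) (sf x); apply: cvg_seq_ext => n.
  rewrite /s /series /= linear_sum; apply: eq_bigr => k _.
  by rewrite bopZ -iterS -iterSr.
have fA x : f (x - z *: A x) = x.
  by rewrite addrC -scaleNr lf fAC scaleNr addrC right.
have invP : [set B : bop H H | forall x, B x - z *: A (B x) = x /\ B (x - z *: A x) = x] B.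
  by move=> x; rewrite !Bf.
have IP := getPex (ex_intro _ B invP); move=> x.
suff -> : inv_op (fun h => h - z *: A h) x = f x by exact: sf.
by have [_] := IP (f x); rewrite right.
Qed.

End neumann.

(** * Defects of dimension one *)
Section rank_one.
Context {R : realType} {H : hilbertType R}.
Implicit Types (e f x y z : H).

(** A positive operator has a real quadratic form.  Polarization, with the
vectors x + y and x + iy, then shows that it is self-adjoint. *)
Lemma positive_symmetric (B : bop H H) : positive_op B ->
  forall x y, inner (B x) y = inner x (B y).
Proof.
move=> B0 x y.
have real z : Num.conj (inner (B z) z) = inner (B z) z.
  by rewrite conj_Creal// ger0_real.
have := real (x + y); have := real (x + 'i *: y).
rewrite !linearD !bopZ !(innerDl, innerDr, innerZl, innerZr) !(rmorphD, rmorphM) /= !real.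
have ci : Num.conj ('i : R[i]) = - 'i by exact: conjCi.
rewrite !ci rmorphN /= ci opprK.
move=> E1 E2; rewrite [RHS]innerC; move: E1 E2.
set p := inner (B x) y; set q := inner (B y) x.
set P := Num.conj p; set Q := Num.conj q => E1 E2.
have h1 : P - Q = q - p.
  apply: (mulfI (neq0Ci R[i])); apply: (addrI (inner (B x) x + inner (B y) y)).
  transitivity (inner (B x) x + - 'i * Q + ('i * P + - 'i * ('i * inner (B y) y))).
    have -> : - 'i * ('i * inner (B y) y) = inner (B y) y.
      by rewrite mulrA mulNr -expr2 sqrCi mulNr mulN1r opprK.
    by ring.
  rewrite E1.
  have -> : 'i * (- 'i * inner (B y) y) = inner (B y) y.
    by rewrite mulrA mulrN -expr2 sqrCi opprK mul1r.
  by ring.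
have h2 : P + Q = p + q.
  apply: (addrI (inner (B x) x + inner (B y) y)).
  transitivity (inner (B x) x + Q + (P + inner (B y) y)); first by ring.
  by rewrite E2; ring.
apply: (@mulfI _ 2%:R); first by rewrite pnatr_eq0.
transitivity ((p + q) - (q - p)); first by ring.
by rewrite -h1 -h2; ring.
Qed.

(** The orthogonal projection to the line of e, when e has norm 1. *)
Definition along e x : H := inner x e *: e.

Lemma inner_unit e : rnorm e = 1 -> inner e e = 1.
Proof. by rewrite innerxx => ->; rewrite expr1n. Qed.

Lemma along_linear e : linear (along e).
Proof. by move=> a x y; rewrite /along innerDl innerZl scalerDl scalerA. Qed.

Lemma along_ortho e x : rnorm e = 1 -> inner (x - along e x) e = 0.
Proof. by move=> /inner_unit e1; rewrite innerBl innerZl e1 mulr1 subrr. Qed.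

Lemma alongK e x : rnorm e = 1 -> along e (along e x) = along e x.
Proof. by move=> /inner_unit e1; rewrite /along innerZl e1 mulr1. Qed.

Lemma along_symmetric e x y : inner (along e x) y = inner x (along e y).
Proof. by rewrite innerZl innerZr -innerC mulrC. Qed.

Lemma along_bop e : rnorm e = 1 -> exists A : bop H H, A =1 along e.
Proof.
move=> e1; apply: (bounded_linear_bop (@along_linear e) (c := 1)) => x.
by rewrite rnormZ mul1r e1 mulr1 (le_trans (cauchy_schwarz _ _))// e1 mulr1.
Qed.

Lemma sqrt_opP (A : H -> H) :
  (exists B : bop H H, positive_op B /\ forall x, B (B x) = A x) ->
  positive_op (sqrt_op A) /\ forall x, sqrt_op A (sqrt_op A x) = A x.
Proof. exact: getPex. Qed.

(** The default point of the type of bounded operators is 0. *)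
Lemma sqrt_op_none (A : H -> H) x :
  ~ (exists B : bop H H, positive_op B /\ forall x, B (B x) = A x) ->
  sqrt_op A x = 0.
Proof.
move=> nA; rewrite /sqrt_op getPN// => B BA; apply: nA.
by exists B.
Qed.

(** A positive square root B of the multiple a^2 P of the projection to e is
determined: it kills what is orthogonal to e, because |B z|^2 = <B^2 z, z>, hence
maps e to a multiple b e by symmetry, and b^2 = a^2. *)
Lemma sqrt_op_along (A : H -> H) e (a : R) : rnorm e = 1 -> 0 < a ->
  (forall x, A x = (a ^+ 2)%:C *: along e x) ->
  forall x, sqrt_op A x = a%:C *: along e x.
Proof.
move=> e1 a0 AE; have ee := inner_unit e1.
have [|B0 BB] := @sqrt_opP A.
  have [P PE] := along_bop e1.
  have [||B BE] := @bounded_linear_bop _ _ _ (fun x => a%:C *: P x) a.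
  - by move=> c x y; rewrite linearP scalerDr !scalerA (mulrC c).
  - move=> x; rewrite rnormZ rnormR (ger0_norm (ltW a0)) ler_pM2l//.
    by rewrite PE rnormZ e1 mulr1 (le_trans (cauchy_schwarz _ _))// e1 mulr1.
  exists B; split=> x; rewrite !BE ?bopZ !PE ?AE.
    rewrite innerZl /along innerZl (innerC e) -rnorm_sqr -rmorphM.
    by rewrite -[0]/(0%:C) lecR mulr_ge0 ?sqr_ge0// ltW.
  rewrite scalerA -rmorphM -expr2; congr (_ *: _).
  by rewrite /along innerZl ee mulr1.
set B := sqrt_op A in B0 BB *.
have Bperp z : inner z e = 0 -> B z = 0.
  move=> ze; apply: innerxx_eq0.
  by rewrite positive_symmetric// BB AE /along ze scale0r scaler0 inner0r.
have BeE : B e = inner (B e) e *: e.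
  apply: inner_inj => z; rewrite -[z in LHS](subrK (along e z)) innerDr.
  rewrite positive_symmetric// Bperp ?along_ortho// inner0r add0r.
  by rewrite -along_symmetric.
have [b b0 bE] := posC_real (B0 e).
have ab : b = a.
  have : inner (B (B e)) e = (a ^+ 2)%:C.
    by rewrite BB AE innerZl innerZl ee !mulr1.
  rewrite {1}BeE bopZ innerZl bE -rmorphM -expr2 => /complexI/eqP.
  by rewrite eqrXn2 ?(ltW a0)// => /eqP.
move=> x; rewrite -[x in LHS](subrK (along e x)) linearD Bperp ?along_ortho//.
by rewrite add0r bopZ BeE bE ab /along !scalerA mulrC.
Qed.

(** What defects of dimension 1 amount to: the defect operators are a P_e and
a P_f, where P_e and P_f are the projections to the lines of e and f. *)
Definition rank_one_defects (T : bop H H) (a : R) e f :=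
  [/\ 0 < a, rnorm e = 1, rnorm f = 1,
      forall x, x - adjoint T (T x) = (a ^+ 2)%:C *: along e x &
      forall x, x - T (adjoint T x) = (a ^+ 2)%:C *: along f x].

Lemma defect_op_along (T : bop H H) (a : R) e : rnorm e = 1 -> 0 < a ->
  (forall x, x - adjoint T (T x) = (a ^+ 2)%:C *: along e x) ->
  forall x, defect_op T x = a%:C *: along e x.
Proof. exact: sqrt_op_along. Qed.

Lemma defect_space_along (T : bop H H) (a : R) e : rnorm e = 1 -> 0 < a ->
  (forall x, x - adjoint T (T x) = (a ^+ 2)%:C *: along e x) ->
  forall x, csubspace_set (defect_space T) x <-> x = along e x.
Proof.
move=> e1 a0 TE x; have DE := defect_op_along e1 a0 TE.
split=> [/closure_seq[s sT sx]|->]; last first.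
  apply: subset_closure; exists (a^-1%:C *: x) => //.
  by rewrite DE /along innerZl scalerA mulrA -rmorphM mulfV ?gt_eqF// mul1r.
apply: inner_inj => z; rewrite along_symmetric.
apply/eqP; rewrite -subr_eq0 -innerBr; apply/eqP.
apply: (cvg_inner_eq0 sx) => n; have [y _ <-] := sT n.
rewrite DE innerZl innerBr -along_symmetric.
by rewrite alongK ?subrr ?mulr0.
Qed.

Lemma has_dim1_along (T : bop H H) (a : R) e : rnorm e = 1 -> 0 < a ->
  (forall x, x - adjoint T (T x) = (a ^+ 2)%:C *: along e x) ->
  has_dim (defect_space T) 1.
Proof.
move=> e1 a0 TE; have DP := defect_space_along e1 a0 TE.
have ee := inner_unit e1.
have De : csubspace_set (defect_space T) e.
  by apply/DP; rewrite /along ee scale1r.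
exists (fun=> CSubspaceElt (mem_set De)) => x.
exists [ffun=> inner (incl x) e]; split.
  apply: val_inj; rewrite big_ord1 ffunE /=.
  by apply/DP; exact/set_mem/inclP.
move=> c ->; apply/ffunP => i; rewrite ffunE ord1 big_ord1 /=.
by rewrite innerZl ee mulr1.
Qed.

(** If I - T^*T had no positive square root, the defect operator would be 0 and
the defect space could not have dimension 1. *)
Lemma has_dim1_defect (T : bop H H) : has_dim (defect_space T) 1 ->
  exists a e, [/\ 0 < a, rnorm e = 1 &
    forall x, x - adjoint T (T x) = (a ^+ 2)%:C *: along e x].
Proof.
move=> [b bP]; pose v := b ord0.
have v0 : v != 0.
  apply/eqP => v0; have [c [_ cu]] := bP 0.
  have h1 := cu [ffun=> 0]; have h2 := cu [ffun=> 1].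
  have : [ffun=> 0] = [ffun=> 1] :> {ffun 'I_1 -> R[i]}.
    by rewrite -h1 ?h2// big_ord1 -/v v0 scaler0.
  by move=> /ffunP/(_ ord0); rewrite !ffunE => /eqP; rewrite eq_sym oner_eq0.
have vP x : csubspace_set (defect_space T) x -> exists c, x = c *: incl v.
  move=> Dx; have [c [xc _]] := bP (CSubspaceElt (mem_set Dx)).
  by exists (c ord0); move/(congr1 (@Defs.incl _ _ _)): xc; rewrite big_ord1.
have w0 : rnorm (incl v) != 0.
  by rewrite rnorm_eq0; apply: contra_neq v0 => v0; exact: val_inj.
have wD : csubspace_set (defect_space T) (incl v) by exact/set_mem/inclP.
(* A defect space spanned by v <> 0 excludes a zero defect operator. *)
have nondeg : ~ (forall x, defect_op T x = 0).
  move=> D0; have [s sD /cvg_rnormP sv] := closure_seq wD.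
  have [|N /(_ N (leqnn _))] := sv (rnorm (incl v)).
    by rewrite lt_def w0 rnorm_ge0.
  by have [y _ <-] := sD N; rewrite D0 sub0r rnormN ltxx.
have [ex|nex] := pselect (exists B : bop H H,
    positive_op B /\ forall x, B (B x) = x - adjoint T (T x)); last first.
  by case: nondeg => x; exact: sqrt_op_none.
have [D0 DD] := sqrt_opP ex; rewrite -/(defect_op T) in D0 DD.
pose e := (rnorm (incl v))^-1%:C *: incl v.
have e1 : rnorm e = 1.
  by rewrite rnormZ rnormR ger0_norm ?invr_ge0 ?rnorm_ge0// mulVf.
have ee := inner_unit e1.
(* D_T maps into the line of e, and is symmetric: it is a multiple of P_e. *)
have DE x : defect_op T x = along e (defect_op T x).
  have [|c xc] := vP (defect_op T x).
    by apply: subset_closure; exists x.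
  have -> : defect_op T x = (c * (rnorm (incl v))%:C) *: e.
    by rewrite xc scalerA -mulrA -rmorphM mulfV// mulr1.
  by rewrite /along innerZl ee mulr1.
have [a a0 aE] := posC_real (D0 e).
have DaE x : defect_op T x = a%:C *: along e x.
  rewrite DE {1}/along positive_symmetric// DE {1}/along aE innerZr conjR.
  by rewrite /along scalerA.
have a1 : 0 < a.
  rewrite lt_def a0 andbT; apply/eqP => a00; apply: nondeg => x.
  by rewrite DaE a00 scale0r.
exists a, e; split=> // x.
rewrite -DD !DaE /along innerZl innerZl ee mulr1 !scalerA rmorphXn expr2.
by rewrite mulrA.
Qed.

(** The two defect operators have the same norm, because
T (I - T^*T) e = (I - T T^* ) T e, where T e is a multiple of f.  If T e = 0, both
have norm 1. *)
Lemma has_defects1P (T : bop H H) :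
  has_defects T 1 <-> exists a e f, rank_one_defects T a e f.
Proof.
split=> [[/has_dim1_defect[a [e [a0 e1 aE]]] /has_dim1_defect[b [f [b0 f1 bE]]]]|].
  have {}bE x : x - T (adjoint T x) = (b ^+ 2)%:C *: along f x.
    by rewrite -bE adjointK.
  exists a, e, f; split=> //.
  suff -> : a = b by [].
  have swap : (a ^+ 2)%:C *: T e = (b ^+ 2)%:C *: along f (T e).
    by rewrite -bE -linearB aE bopZ /along inner_unit// scale1r.
  have sq : a ^+ 2 = b ^+ 2 -> a = b.
    by move=> /eqP; rewrite eqrXn2 ?(ltW a0) ?(ltW b0)// => /eqP.
  have nz (r : R) : 0 < r -> (r ^+ 2)%:C != 0 :> R[i].
    by move=> r0; rewrite (inj_eq (@complexI R) _ 0) gt_eqF// exprn_gt0.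
  (* If T e = 0, then T^* f = 0 as well, and both defects have size 1. *)
  have [Te0|Te0] := eqVneq (T e) 0; apply: sq.
    have a1 : a ^+ 2 = 1.
      have := congr1 (inner^~ e) (aE e); rewrite Te0 linear0 subr0 innerZl.
      by rewrite /along innerZl !inner_unit// !mulr1 => /esym/(@complexI R _ 1).
    have Tf0 : adjoint T f = 0.
      have : (b ^+ 2)%:C *: adjoint T f = (a ^+ 2)%:C *: along e (adjoint T f).
        by rewrite -aE -linearB bE bopZ /along inner_unit// scale1r.
      rewrite /along -adjointP' Te0 inner0r scale0r scaler0.
      by move=> /eqP; rewrite scaler_eq0 (negbTE (nz _ b0)) => /eqP.
    have := congr1 (inner^~ f) (bE f); rewrite Tf0 linear0 subr0 innerZl.
    by rewrite /along innerZl !inner_unit// !mulr1 a1 => /(@complexI R 1).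
  have p0 : inner (T e) f != 0.
    apply: contra_neq Te0 => p0; apply/eqP.
    move/eqP: swap; rewrite /along p0 scale0r scaler0 scaler_eq0.
    by rewrite (negbTE (nz _ a0)).
  have := congr1 (inner^~ f) swap; rewrite /along !innerZl inner_unit// mulr1.
  by move=> /(mulIf p0)/complexI.
move=> [a [e [f [a0 e1 f1 eE fE]]]]; split; first exact: has_dim1_along eE.
apply: (has_dim1_along f1 a0) => x.
by rewrite adjointK.
Qed.

(** The Taylor coefficients of the characteristic function, a scalar function once
the defect spaces are identified with the lines of e and f. *)
Definition char_coef (T : bop H H) (a : R) e f (n : nat) : R[i] :=
  if n is k.+1 then (a ^+ 2)%:C * inner (iter k (adjoint T) e) f
  else - inner (T e) f.

(** T e is a multiple of f since T maps the first defect space to the second.  The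
other term of the characteristic function maps e to a multiple of f because D_T is
a P_e and D_(T^* ) is a P_f, and the Neumann series of (I - z T^* )^-1 gives its
expansion in powers of z. *)
Lemma char_fun_along (T : bop H H) (a : R) e f (z : R[i]) :
  (forall x, rnorm (T x) <= rnorm x) ->
  rank_one_defects T a e f -> rnorm z < 1 ->
  exists2 c : R[i],
    series (fun n => char_coef T a e f n * z ^+ n : R[i]^o) @ \oo --> (c : R[i]^o) &
    forall x : defect_space T, incl (char_fun z x) = (c * inner (incl x) e) *: f.
Proof.
move=> Tc [a0 e1 f1 eE fE] z1.
have ee := inner_unit e1.
pose h := inv_op (fun h => h - z *: adjoint T h) e.
pose c := - inner (T e) f + z * ((a ^+ 2)%:C * inner h f).
exists c.
  have Tc' := adjoint_contraction Tc.
  have hcv := cvg_innerl (y := f) (inv_op_cvg Tc' z1 (x := e)).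
  rewrite -(cvg_shiftn 1) /=.
  have hc : (fun _ : nat => (- inner (T e) f : R[i]^o)) @ \oo -->
      (- inner (T e) f : R[i]^o) by exact: cvg_cst.
  have := cvg_seqD hc (cvg_seqZ (a := z * (a ^+ 2)%:C) hcv).
  rewrite -/h; have -> : (- inner (T e) f : R[i]^o) + (z * (a ^+ 2)%:C) *: (inner h f : R[i]^o) = c.
    by rewrite /c mulrA.
  apply: cvg_seq_ext => n; rewrite /series /= addn1 big_nat_recl//= expr0 mulr1.
  congr (_ + _); rewrite inner_suml scaler_sumr; apply: eq_bigr => k _.
  rewrite innerZl (exprS z).
  transitivity ((z * (a ^+ 2)%:C) * (z ^+ k * inner (iter k (adjoint T) e) f)) => //.
  by ring.
have DE := defect_op_along e1 a0 eE.
have fE' x : x - adjoint (adjoint T) (adjoint T x) = (a ^+ 2)%:C *: along f x.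
  by rewrite adjointK.
have DE' := defect_op_along f1 a0 fE'.
have nz : (a ^+ 2)%:C != 0 :> R[i].
  by rewrite (inj_eq (@complexI R) _ 0) gt_eqF// exprn_gt0.
have TeE : T e = inner (T e) f *: f.
  apply: (scalerI nz); rewrite -/(along f (T e)) -fE -linearB eE bopZ.
  by rewrite /along ee scale1r.
move=> x.
have xE : incl x = inner (incl x) e *: e.
  by have /(defect_space_along e1 a0 eE) := set_mem (inclP x).
set p := inner (incl x) e in xE *.
have val : - T (incl x) +
      z *: defect_op (adjoint T) (inv_op (fun h => h - z *: adjoint T h)
        (defect_op T (incl x))) = (c * p) *: f.
  have -> : defect_op T (incl x) = (a%:C * p) *: e by rewrite DE /along -/p scalerA.
  rewrite [inv_op _ _]bopZ -/h DE' /along innerZl xE bopZ TeE !scalerA.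
  by rewrite -scaleNr -scalerDl /c rmorphXn; congr (_ *: _); ring.
have Df : csubspace_set (defect_space (adjoint T)) ((c * p) *: f).
  by apply/(defect_space_along f1 a0 fE'); rewrite /along innerZl inner_unit// mulr1.
have := @getPex _ [set y : defect_space (adjoint T) | incl y = - T (incl x) +
      z *: defect_op (adjoint T) (inv_op (fun h => h - z *: adjoint T h)
        (defect_op T (incl x)))].
by rewrite /= -/(char_fun z x) val; apply; exists (CSubspaceElt (mem_set Df)).
Qed.

End rank_one.

(** * Power series with bounded coefficients *)

(** Near 0 the tail of the series is at most 2 c |z|, so that a nonzero constant
term would dominate it. *)
Lemma power_series_head (R : realType) (a : nat -> R[i]) (c : R) :
  (forall n, rnorm (a n) <= c) ->
  (forall z : R[i], 0 < rnorm z < 1 ->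
     series (fun n => a n * z ^+ n : R[i]^o) @ \oo --> (0 : R[i]^o)) ->
  a 0%N = 0.
Proof.
move=> ac az; have c0 : 0 <= c by apply: le_trans (ac 0%N); exact: rnorm_ge0.
have small (r : R) : 0 < r -> r < 1 / 2 -> rnorm (a 0%N) <= 2 * c * r.
  move=> r0 r1; set z : R[i] := r%:C.
  have rz : rnorm z = r by rewrite rnormR ger0_norm// ltW.
  have z1 : 0 < rnorm z < 1 by rewrite rz; apply/andP; split; lra.
  have /cvg_rnorm := az z z1; rewrite rnorm0 -(cvg_shiftn 1) => cv.
  rewrite -subr_le0; apply: (ler_cvg_to (cvg_cst _) cv); apply: nearW => N /=.
  rewrite addn1 /series /= big_nat_recl//= expr0 mulr1.
  set t := \sum_(0 <= i < N) _.
  have geom : \sum_(0 <= i < N) r ^+ i <= 2.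
    have := subrX1 r N; rewrite big_mkord; set s := \sum_(i < N) _ => E.
    have : 0 <= r ^+ N by rewrite exprn_ge0 ?ltW.
    have : 0 <= s by apply: sumr_ge0 => i _; rewrite exprn_ge0 ?ltW.
    nra.
  have tb : rnorm t <= 2 * c * r.
    apply: le_trans (rnorm_sum (index_iota 0 N) xpredT _) _.
    apply: (@le_trans _ _ (\sum_(0 <= i < N) (c * r) * r ^+ i)).
      apply: ler_sum => i _; rewrite rnormM rnormX rz exprS -mulrA.
      by rewrite ler_wpM2r ?(mulr_ge0, exprn_ge0)// ltW.
    rewrite -mulr_sumr; have : 0 <= c * r by rewrite mulr_ge0// ltW.
    nra.
  have := rnormB (a 0%N + t) t; rewrite addrK.
  lra.
apply/eqP; rewrite -rnorm_eq0; apply/eqP/le_anti; rewrite rnorm_ge0 andbT.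
apply/ler_addgt0Pr => e e0; rewrite add0r.
pose d := 2 * c + 1 + e; have d0 : 0 < d by rewrite /d; lra.
have d1 : 0 < e / (3 * d) by rewrite divr_gt0// mulr_gt0.
have d2 : (e / (3 * d)) * (3 * d) = e by rewrite divfK// gt_eqF// mulr_gt0.
apply: le_trans (small (e / (3 * d)) d1 _) _; rewrite /d in d1 d2 *; nra.
Qed.

Lemma power_series_eq0 (R : realType) (a : nat -> R[i]) (c : R) :
  (forall n, rnorm (a n) <= c) ->
  (forall z : R[i], rnorm z < 1 ->
     series (fun n => a n * z ^+ n : R[i]^o) @ \oo --> (0 : R[i]^o)) ->
  forall n, a n = 0.
Proof.
move=> ac az; elim/ltn_ind => n IH; rewrite -[n]addn0.
apply: (@power_series_head _ (fun m => a (n + m)%N) c) => [m|z /andP[z0 z1]]; first exact: ac.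
have := az z z1; rewrite -(cvg_shiftn n) => /(cvg_seqZ (a := z ^- n)); rewrite scaler0.
apply: cvg_seq_ext => N; rewrite /series /= addnC.
rewrite (big_cat_nat (leq0n n) (leq_addr N n))/= big_nat_cond big1 ?add0r; last first.
  by move=> i /andP[/andP[_ /IH ->]]; rewrite mul0r.
rewrite -[X in \sum_(X <= _ < _) _]add0n big_addn addKn scaler_sumr.
apply: eq_bigr => i _; rewrite addnC exprD.
have zn : z ^+ n != 0 by rewrite expf_neq0// -rnorm_eq0 gt_eqF.
transitivity (z ^- n * (a (n + i)%N * (z ^+ n * z ^+ i))) => //.
by rewrite mulrCA mulKf.
Qed.

Lemma power_series_inj (R : realType) (a b : nat -> R[i]) (c : R) :
  (forall n, rnorm (a n) <= c) -> (forall n, rnorm (b n) <= c) ->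
  (forall z : R[i], rnorm z < 1 -> exists2 l : R[i]^o,
     series (fun n => a n * z ^+ n : R[i]^o) @ \oo --> l &
     series (fun n => b n * z ^+ n : R[i]^o) @ \oo --> l) ->
  a =1 b.
Proof.
move=> ac bc ab n; apply/eqP; rewrite -subr_eq0; apply/eqP.
apply: (@power_series_eq0 _ (fun m => a m - b m) (c + c)) => [m|z z1].
  by apply: le_trans (rnormB _ _) _; exact: lerD.
have [l al bl] := ab z z1.
have := cvg_seqB al bl; rewrite subrr; apply: cvg_seq_ext => N.
rewrite /series /= -sumrB; apply: eq_bigr => i _.
by rewrite mulrBl.
Qed.

(** * Orbits of wandering vectors *)
Section isometries.
Context {R : realType} {K : hilbertType R} (V : bop K K).
Hypothesis isoV : isometric V.

Lemma isometric_rnorm x : rnorm (V x) = rnorm x.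
Proof. by rewrite /rnorm isoV. Qed.

(** By polarization, with the vectors x + y and x + iy. *)
Lemma isometric_inner x y : inner (V x) (V y) = inner x y.
Proof.
have xx z : inner (V z) (V z) = inner z z by rewrite !innerxx isometric_rnorm.
have := xx (x + y); have := xx (x + 'i *: y).
rewrite !linearD !bopZ !(innerDl, innerDr, innerZl, innerZr) !xx.
have ci : Num.conj ('i : R[i]) = - 'i by exact: conjCi.
rewrite !ci; set p := inner (V x) (V y); set q := inner (V y) (V x).
set P := inner x y; set Q := inner y x => E1 E2.
have h1 : p - q = P - Q.
  apply: (mulfI (neq0Ci R[i])).
  move/eqP: E1; rewrite -subr_eq0 => /eqP E1.
  apply/eqP; rewrite -subr_eq0 -oppr_eq0; apply/eqP; rewrite -E1; ring.
have h2 : p + q = P + Q.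
  move/eqP: E2; rewrite -subr_eq0 => /eqP E2.
  apply/eqP; rewrite -subr_eq0; apply/eqP; rewrite -E2; ring.
apply: (@mulfI _ 2%:R); first by rewrite pnatr_eq0.
transitivity ((p - q) + (p + q)); first by ring.
by rewrite h1 h2; ring.
Qed.

Lemma isometric_adjointK x : adjoint V (V x) = x.
Proof. by apply: inner_inj => y; rewrite -adjointP' isometric_inner. Qed.

Lemma iter_bopD n x y : iter n V (x + y) = iter n V x + iter n V y.
Proof. by elim: n => //= n ->; rewrite linearD. Qed.

Lemma iter_bopB n x y : iter n V (x - y) = iter n V x - iter n V y.
Proof. by elim: n => //= n ->; rewrite bopB. Qed.

Lemma iter_bopZ n a x : iter n V (a *: x) = a *: iter n V x.
Proof. by elim: n => //= n ->; rewrite bopZ. Qed.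

Lemma iter_bop_sum n (I : Type) (r : seq I) (P : pred I) (F : I -> K) :
  iter n V (\sum_(i <- r | P i) F i) = \sum_(i <- r | P i) iter n V (F i).
Proof. by elim: n => //= n ->; rewrite bop_sum. Qed.

Lemma iter_inner n x y : inner (iter n V x) (iter n V y) = inner x y.
Proof. by elim: n => //= n IH; rewrite isometric_inner. Qed.

Lemma iter_rnorm n x : rnorm (iter n V x) = rnorm x.
Proof. by elim: n => //= n IH; rewrite isometric_rnorm. Qed.

Lemma iter_adjoint_inner n x y : inner x (iter n V y) = inner (iter n (adjoint V) x) y.
Proof. by elim: n x y => // n IH x y; rewrite iterS adjointP' IH -iterSr. Qed.

(** A single vector of an orbit is the sum of the series with one nonzero term. *)
Lemma Mplus_iter (X : set K) n x : linear_subspace X -> X x -> Mplus V X (iter n V x).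
Proof.
move=> linX Xx; exists (fun k => if k == n then x else 0); split.
  by move=> k; case: ifP => // _; exact: (subspace0 linX).
rewrite -(cvg_shiftn n.+1) /=.
apply: (@cvg_seq_ext _ (fun=> iter n V x)); last exact: cvg_cst.
move=> k; rewrite /series /= (bigD1_seq n)/= ?iota_uniq ?eqxx//; last first.
  by rewrite mem_index_iota /= addnS ltnS leq_addl.
rewrite big1 ?addr0// => i /negbTE ->.
by elim: i => //= i ->; rewrite linear0.
Qed.

Lemma Mplus_inner0 (X : set K) y x : (forall n z, X z -> inner (iter n V z) y = 0) ->
  Mplus V X x -> inner x y = 0.
Proof.
move=> yX [s [Xs sx]]; apply: (cvg_inner_eq0 sx) => n.
by rewrite inner_suml big1// => i _; exact: yX.
Qed.

End isometries.

Section shift_orbits.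
Context {R : realType} {K : hilbertType R} (V : bop K K).
Hypothesis isoV : isometric V.

(** By induction: the n-th term is removed from a residue which has the same inner
product with w n as x itself. *)
Lemma bessel (w : nat -> K) x n :
  (forall i j, i != j -> inner (w i) (w j) = 0) -> (forall i, w i != 0) ->
  rnorm (x - \sum_(0 <= i < n) (inner x (w i) / inner (w i) (w i)) *: w i) ^+ 2 =
  rnorm x ^+ 2 - \sum_(0 <= i < n) rnorm (inner x (w i)) ^+ 2 / rnorm (w i) ^+ 2.
Proof.
move=> ww w0; elim: n => [|n IH]; first by rewrite !big_geq// !subr0.
rewrite !big_nat_recr//= !opprD !addrA.
have <- : inner (x - \sum_(0 <= i < n) (inner x (w i) / inner (w i) (w i)) *: w i) (w n) =
    inner x (w n).
  rewrite innerBl inner_suml big_nat_cond big1 ?subr0// => i /andP[/andP[_ i_n] _].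
  by rewrite innerZl (ww i n) ?mulr0// ltn_eqF.
by rewrite rnorm_sub_proj// IH.
Qed.

(** The series condition is Parseval's identity for the coefficients of y along
the orbit of ys.  As <V^m ys, V^j y> = <V^(m-j) ys, y>, [bessel] shows that the
distance of V^m ys to the span of y, V y, ..., V^m y tends to 0.  If all V^m x are
orthogonal to the orbit of y, then <x, V^i ys> = <V^m x, V^(m+i) ys> is, for every
m, at most |x| times that distance with m+i in place of m. *)
Lemma multiplicity_one (y ys x : K) : y != 0 ->
  (forall i j, i != j -> inner (iter i V y) (iter j V y) = 0) ->
  series (fun i => rnorm (inner (iter i V ys) y) ^+ 2) @ \oo -->
    rnorm ys ^+ 2 * rnorm y ^+ 2 ->
  (forall n m, inner (iter n V x) (iter m V y) = 0) ->
  forall i, inner x (iter i V ys) = 0.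
Proof.
move=> y0 yy parseval xy i.
have ny0 : rnorm y ^+ 2 != 0 by rewrite sqrf_eq0 rnorm_eq0.
pose w j := iter j V y.
have w0 j : w j != 0 by rewrite -rnorm_eq0 iter_rnorm// rnorm_eq0.
pose p m := \sum_(0 <= j < m.+1)
  (inner (iter m V ys) (w j) / inner (w j) (w j)) *: w j.
have pE m : rnorm (iter m V ys - p m) ^+ 2 = rnorm ys ^+ 2 -
    series (fun i => rnorm (inner (iter i V ys) y) ^+ 2) m.+1 / rnorm y ^+ 2.
  rewrite bessel// iter_rnorm// /series /= mulr_suml; congr (_ - _).
  rewrite big_nat_rev/=; apply: eq_big_nat => j /andP[_ jm].
  rewrite add0n subSS iter_rnorm//; congr (rnorm _ ^+ 2 / _).
  have {1}-> : m = ((m - j) + j)%N by rewrite subnK.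
  by rewrite iterD /w iter_inner.
have p0 : rnorm (iter m V ys - p m) ^+ 2 @[m --> \oo] --> (0 : R).
  have lim : (fun m => rnorm ys ^+ 2 - series (fun i => rnorm (inner (iter i V ys) y) ^+ 2)
      (m + 1)%N / rnorm y ^+ 2) @ \oo --> (0 : R).
    rewrite -[X in _ --> X](subrr (rnorm ys ^+ 2)).
    rewrite -{3}[rnorm ys ^+ 2](mulfK ny0); apply: cvgB; first exact: cvg_cst.
    by rewrite -(cvg_shiftn 1) in parseval; exact: cvg_seqMr parseval.
  by apply: cvg_seq_ext lim => m; rewrite pE addn1.
apply/eqP; rewrite -rnorm_eq0 -sqrf_eq0.
rewrite eq_le sqr_ge0 andbT.
have bound m : rnorm (inner x (iter i V ys)) ^+ 2 <=
    rnorm x ^+ 2 * rnorm (iter (m + i) V ys - p (m + i)%N) ^+ 2.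
  have -> : inner x (iter i V ys) = inner (iter m V x) (iter (m + i) V ys - p (m + i)%N).
    rewrite innerBr [X in _ - X]inner_sumr [X in _ - X]big1 ?subr0; last first.
      by move=> j _; rewrite innerZr xy mulr0.
    by rewrite iterD iter_inner.
  rewrite -exprMn ler_sqr ?nnegrE ?mulr_ge0 ?rnorm_ge0//.
  by rewrite -(iter_rnorm isoV m x); exact: cauchy_schwarz.
rewrite -(mulr0 (rnorm x ^+ 2)).
have lim : rnorm x ^+ 2 * rnorm (iter (m + i) V ys - p (m + i)%N) ^+ 2 @[m --> \oo] -->
    rnorm x ^+ 2 * 0.
  by rewrite -(cvg_shiftn i) in p0; exact: cvg_seqMl p0.
by apply: (ler_cvg_to (cvg_cst _) lim); apply: nearW => m; exact: bound.
Qed.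

Lemma rnorm_orbit_sum (u : nat -> R[i]) ys n m :
  (forall i j, i != j -> inner (iter i V ys) (iter j V ys) = 0) ->
  rnorm (\sum_(n <= i < m) u i *: iter i V ys) ^+ 2 =
  \sum_(n <= i < m) rnorm (u i) ^+ 2 * rnorm ys ^+ 2.
Proof.
move=> yy; have [nm|mn] := leqP n m; last first.
  by rewrite !big_geq ?(ltnW mn)// rnorm0 expr0n.
rewrite -(subnKC nm); elim: (m - n)%N => [|d IH].
  by rewrite addn0 !big_geq// rnorm0 expr0n.
rewrite addnS !big_nat_recr ?leq_addr//= pythagoras.
  by rewrite IH rnormZ iter_rnorm// exprMn.
rewrite inner_suml big_nat_cond big1// => i /andP[/andP[_ i_n] _].
by rewrite innerZl innerZr yy ?mulr0// ltn_eqF.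
Qed.

Lemma orbit_series_cvg (u : nat -> R[i]) ys :
  (forall i j, i != j -> inner (iter i V ys) (iter j V ys) = 0) ->
  cvgn (series (fun n => rnorm (u n) ^+ 2)) ->
  cvgn (series (fun n => u n *: iter n V ys)).
Proof.
move=> yy cu; apply: cauchy_rnorm_cvg_le => e e0.
pose d := rnorm ys ^+ 2 + 1.
have d0 : 0 < d by rewrite ltr_wpDl// sqr_ge0.
have [|N uN] := series_tail cu (e := e ^+ 2 / d); first by rewrite divr_gt0// exprn_gt0.
exists N => n m Nn nm.
rewrite sub_series_geq// -(@ltr_pXn2r _ 2) ?nnegrE ?rnorm_ge0 ?ltW//.
rewrite rnorm_orbit_sum// -mulr_suml.
have s0 : 0 <= \sum_(n <= i < m) rnorm (u i) ^+ 2 by apply: sumr_ge0 => i _; exact: sqr_ge0.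
have := uN n m Nn nm; rewrite (ger0_norm s0) ltr_pdivlMr//; apply: le_lt_trans.
by rewrite ler_wpM2l// /d lerDl.
Qed.

Lemma orbit_sum_inner (u : nat -> R[i]) ys y k :
  (forall i j, i != j -> inner (iter i V ys) (iter j V ys) = 0) ->
  series (fun n => u n *: iter n V ys) @ \oo --> y ->
  inner y (iter k V ys) = u k * (rnorm ys ^+ 2)%:C.
Proof.
move=> yy uy; apply: (cvg_unique_inner uy); exists k.+1 => n kn.
rewrite /series /= inner_suml (bigD1_seq k) ?iota_uniq ?mem_index_iota//=.
rewrite innerZl iter_inner// innerxx big1 ?addr0// => i ik.
by rewrite innerZl yy ?mulr0.
Qed.

(** Expand the first y in its series; [orbit_sum_inner] gives <V^(n+k) ys, y>. *)
Lemma orbit_sum_correlation (u : nat -> R[i]) ys y k :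
  (forall i j, i != j -> inner (iter i V ys) (iter j V ys) = 0) ->
  series (fun n => u n *: iter n V ys) @ \oo --> y ->
  series (fun n => u n * Num.conj (u (n + k)%N) * (rnorm ys ^+ 2)%:C : R[i]^o) @ \oo -->
    (inner (iter k V y) y : R[i]^o).
Proof.
move=> yy uy.
have h : (fun n => iter k V (series (fun n => u n *: iter n V ys) n)) @ \oo --> iter k V y.
  elim: k => //= k IH; exact: bop_cvg.
have := cvg_innerl (y := y) h; apply: cvg_seq_ext => n.
rewrite /series /= iter_bop_sum inner_suml; apply: eq_bigr => i _.
rewrite iter_bopZ innerZl -iterD addnC innerC (orbit_sum_inner _ yy uy).
by rewrite rmorphM /= conjR mulrA.
Qed.

End shift_orbits.

(** * The geometry of the dilation *)

(** A reducing subspace is invariant under the adjoint too, so that taking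
adjoints commutes with restricting. *)
Lemma restriction_adjoint {R : realType} {H : hilbertType R} (T : bop H H)
    (M : csubspace H) (TM : reducing T M) (x : M) :
  incl (adjoint (restriction (proj1 TM)) x) = adjoint T (incl x).
Proof.
have MT' (z : M) : csubspace_set M (adjoint T (incl z)).
  apply: orthocompK (csubspaceP M) _ _ => w /TM.2 Tw.
  by rewrite -adjointP; apply: inner_eq0C; apply: Tw; exact/set_mem/inclP.
rewrite (@adjoint_unique _ _ _ _ (fun z => CSubspaceElt (mem_set (MT' z))))// => z w.
exact: (adjointP T (incl z) (incl w)).
Qed.

Section dilation.
Context {R : realType} {K : hilbertType R} (H : csubspace K) (T : bop H H)
  (V : bop K K) (L Ls : set K).
Hypothesis dilT : isometric_dilation T V.
Hypothesis minV : minimal_dilation H V.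
Hypothesis wanL : wandering V L.
Hypothesis wanLs : wandering V Ls.
Hypothesis MLs : Mplus V Ls = setT.
Hypothesis decK : orthogonal_decomposition (csubspace_set H) (Mplus V L).

Let isoV : isometric V := dilT.1.
Local Notation V' := (adjoint V).
Let linL : linear_subspace L := wanL.1.
Let linLs : linear_subspace Ls := wanLs.1.

Lemma inclH (h : H) : csubspace_set H (incl h).
Proof. exact/set_mem/inclP. Qed.

Lemma proj_ortho x (k : H) : inner (x - incl (proj H x)) (incl k) = 0.
Proof.
have [m Hm mP] := projection_exists x (csubspaceP H).
have ex : exists h : H, forall k : H, inner (x - incl h) (incl k) = 0.
  by exists (CSubspaceElt (mem_set Hm)) => j; apply: mP; exact: inclH.
exact: (getPex ex).
Qed.

Lemma dilation_inner (h k : H) : inner (V (incl h)) (incl k) = inner (incl (T h)) (incl k).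
Proof.
have := dilT.2 1%N h; rewrite /= => <-.
by apply/eqP; rewrite -subr_eq0 -innerBl; apply/eqP; exact: proj_ortho.
Qed.

Lemma ortho_ML h n l : csubspace_set H h -> L l -> inner h (iter n V l) = 0.
Proof. by move=> Hh Ll; apply: decK.1 => //; exact: Mplus_iter. Qed.

Lemma in_H x : (forall n l, L l -> inner x (iter n V l) = 0) -> csubspace_set H x.
Proof.
move=> xL; have : setT x by []. 
rewrite -decK.2 => -[h Hh [m Mm hm]].
suff m0 : m = 0 by rewrite -hm m0 addr0.
apply: innerxx_eq0; have -> : inner m m = inner x m - inner h m.
  by rewrite -hm innerDl addrC addKr.
rewrite (decK.1 _ _ Hh Mm) subr0; apply: inner_eq0C.
by apply: Mplus_inner0 Mm => n z Lz; apply: inner_eq0C; exact: xL.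
Qed.

(** H is the orthogonal complement of M_+(L), which is invariant under V. *)
Lemma adjointV_H x : csubspace_set H x -> csubspace_set H (V' x).
Proof.
move=> Hx; apply: in_H => n l Ll.
by rewrite -adjointP' -iterS; exact: ortho_ML.
Qed.

Lemma incl_adjoint (h : H) : incl (adjoint T h) = V' (incl h).
Proof.
pose f (k : H) := CSubspaceElt (mem_set (adjointV_H (inclH k))).
rewrite (@adjoint_unique _ _ _ T f)// => x y.
rewrite -[LHS]/(inner (incl (T x)) (incl y)) -dilation_inner.
by rewrite adjointP.
Qed.

(** The part of V h which leaves H: V h = T h + gap h is the orthogonal decomposition
of V h. *)
Definition gap (h : H) : K := V (incl h) - incl (T h).

Lemma gap_ortho (h k : H) : inner (gap h) (incl k) = 0.
Proof. by rewrite innerBl dilation_inner subrr. Qed.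

Lemma gap_inner (h k : H) :
  inner (gap h) (gap k) = inner h k - inner (T h) (T k).
Proof.
have e : inner (incl (T h)) (V (incl k)) = inner (incl (T h)) (incl (T k)).
  by rewrite innerC dilation_inner -innerC.
by rewrite innerBr gap_ortho subr0 innerBl isometric_inner// e.
Qed.

(** The gap is orthogonal to H, hence lies in M_+(L).  As V h and T h are orthogonal
to V^n L for n > 0, only the term of index 0 remains. *)
Lemma gapL (h : H) : L (gap h).
Proof.
have : setT (gap h) by [].
rewrite -decK.2 => -[h' Hh' [m Mm hm]].
have h'0 : h' = 0.
  apply: innerxx_eq0; have -> : inner h' h' = inner (gap h) h' - inner m h'.
    by rewrite -hm innerDl addrK.
  rewrite (inner_eq0C (decK.1 _ _ Hh' Mm)) subr0.
  exact: (gap_ortho h (CSubspaceElt (mem_set Hh'))).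
have {hm} gm : gap h = m by rewrite -hm h'0 add0r.
have [s [Ls' sm]] := Mm.
suff -> : gap h = s 0%N by [].
have gV n l : L l -> inner (gap h) (iter n.+1 V l) = 0.
  move=> Ll; rewrite innerBl (ortho_ML _ (inclH _) Ll) subr0 iterS.
  by rewrite isometric_inner// ortho_ML//; exact: inclH.
apply/eqP; rewrite -subr_eq0; apply/eqP/innerxx_eq0; rewrite {1}gm.
have sm' : (fun n => \sum_(0 <= i < n) iter i.+1 V (s i.+1)) @ \oo --> m - s 0%N.
  have c0 : (fun=> s 0%N) @ \oo --> s 0%N by exact: cvg_cst.
  have := sm; rewrite -(cvg_shiftn 1) => /cvg_seqB/(_ c0); apply: cvg_seq_ext => n.
  by rewrite /= addn1 /series /= big_nat_recl//= addrC addKr.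
apply: (cvg_inner_eq0 sm') => n; rewrite inner_suml big1// => i _.
by rewrite innerBr (inner_eq0C (gV _ _ (Ls' _))) (wanL.2 i.+1 0%N) ?subr0.
Qed.

Lemma adjointV_Ls s : Ls s -> V' s = 0.
Proof.
move=> Lss; apply: inner_inj => k; rewrite inner0l -adjointP'.
have : Mplus V Ls k by rewrite MLs.
move=> [t [Lt tk]]; apply: inner_eq0C.
apply: (cvg_inner_eq0 (bop_cvg (A := V) tk)) => n.
rewrite linear_sum inner_suml big1// => i _ /=.
by rewrite -iterS (wanLs.2 i.+1 0%N).
Qed.

(** The projection to Ls, which is the kernel of V^*. *)
Definition foot (x : K) : K := x - V (V' x).

(** In the expansion of x along the V^n Ls, the operator V V^* removes the term of
index 0 and fixes all others. *)
Lemma footLs x : Ls (foot x).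
Proof.
have : Mplus V Ls x by rewrite MLs.
move=> [s [Lss sx]]; suff -> : foot x = s 0%N by [].
have VV := bop_cvg (A := V) (bop_cvg (A := V') sx).
have := cvg_seqB sx VV; rewrite -(cvg_shiftn 1) => h1.
apply: (cvg_seq_unique h1).
apply: (@cvg_seq_ext _ (fun=> s 0%N)); last exact: cvg_cst.
move=> n; rewrite /= addn1 /series /= big_nat_recl//= !bopD (adjointV_Ls (Lss _)) bop0 add0r.
rewrite !bop_sum -addrA -sumrB big1 ?addr0// => i _.
by rewrite [V' _]isometric_adjointK// subrr.
Qed.

Lemma foot_inner x y : inner (foot x) (foot y) = inner x y - inner (V' x) (V' y).
Proof.
rewrite innerBr !innerBl isometric_inner// [inner _ (V (V' y))]adjointP'.
by rewrite [inner (V _) y]adjointP subrr subr0.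
Qed.

Lemma inner_foot x s : Ls s -> inner (foot x) s = inner x s.
Proof. by move=> Lss; rewrite innerBl adjointP (adjointV_Ls Lss) inner0r subr0. Qed.

Lemma foot_linear : linear foot.
Proof. by move=> a x y; rewrite /foot !(bopD, bopZ) scalerBr opprD addrACA. Qed.

Lemma minimal_ortho x : (forall n (h : H), inner x (iter n V (incl h)) = 0) -> x = 0.
Proof.
move=> xV; have : setT x by []. rewrite -minV => xx.
have := smallest_sub (orthocomp_closed_subspace [set x]) _ xx => /(_ _)/(_ x).
move=> h; apply: innerxx_eq0; apply: h => // _ [n _ [k Hk <-]] _ ->.
exact: (xV n (CSubspaceElt (mem_set Hk))).
Qed.

(** The minimality of the dilation in terms of L: a vector of L which is orthogonal
to all gaps is orthogonal to all V^n H, since V^(n+1) h = V^n (T h) + V^n (gap h). *)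
Lemma gap_dense l : L l -> (forall h, inner l (gap h) = 0) -> l = 0.
Proof.
move=> Ll lG; apply: minimal_ortho => n; elim: n => [|n IH] h.
  by apply: inner_eq0C; exact: (ortho_ML 0 (inclH h) Ll).
rewrite iterSr -[V (incl h)](subrK (incl (T h))) -/(gap h).
rewrite iter_bopD innerDr IH addr0; case: n {IH} => [|n]; first exact: lG.
by rewrite (wanL.2 0%N n.+1)//; exact: gapL.
Qed.

(** The analogue for Ls.  A vector s of Ls orthogonal to H lies in M_+(L), and
even in L because V^* s = 0.  It is also orthogonal to the gaps. *)
Lemma foot_dense s : Ls s -> (forall h : H, inner s (incl h) = 0) -> s = 0.
Proof.
move=> Lss sH; have V's := adjointV_Ls Lss.
suff Ls0 : L s by apply: gap_dense => // h; rewrite innerBr sH subr0 adjointP' V's inner0l.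
have : setT s by []. rewrite -decK.2 => -[h Hh [m Mm hm]].
have h0 : h = 0.
  apply: innerxx_eq0; have -> : inner h h = inner s h - inner m h.
    by rewrite -hm innerDl addrK.
  by rewrite (inner_eq0C (decK.1 _ _ Hh Mm)) subr0; exact: (sH (CSubspaceElt (mem_set Hh))).
have {hm} sm : s = m by rewrite -hm h0 add0r.
have [t [Lt tm]] := Mm; suff -> : s = t 0%N by [].
apply/eqP; rewrite -subr_eq0; apply/eqP/innerxx_eq0; rewrite {1}sm.
have tm' : (fun n => \sum_(0 <= i < n) iter i.+1 V (t i.+1)) @ \oo --> m - t 0%N.
  have c0 : (fun=> t 0%N) @ \oo --> t 0%N by exact: cvg_cst.
  have := tm; rewrite -(cvg_shiftn 1) => /cvg_seqB/(_ c0); apply: cvg_seq_ext => n.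
  by rewrite /= addn1 /series /= big_nat_recl//= addrC addKr.
apply: (cvg_inner_eq0 tm') => n; rewrite inner_suml big1// => i _.
rewrite innerBr (wanL.2 i.+1 0%N isT (t i.+1) (t 0%N))// subr0.
by rewrite iterS adjointP V's inner0r.
Qed.

(** * From a pair of vectors to a reducing subspace *)
Section from_pair.
Variables (y ys : K) (u : nat -> R[i]).
Hypotheses (Ly : L y) (Lys : Ls ys) (y0 : y != 0) (ys0 : ys != 0).
Hypothesis uy : series (fun n => u n *: iter n V ys) @ \oo --> y.

Let wy i j : i != j -> inner (iter i V y) (iter j V y) = 0.
Proof. by move=> ij; exact: wanL.2. Qed.

Let wys i j : i != j -> inner (iter i V ys) (iter j V ys) = 0.
Proof. by move=> ij; exact: wanLs.2. Qed.

Let yy0 : inner y y != 0.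
Proof. by apply: contra_neq y0 => /innerxx_eq0. Qed.

Let ysys0 : inner ys ys != 0.
Proof. by apply: contra_neq ys0 => /innerxx_eq0. Qed.

Let y_coef k : inner y (iter k V ys) = u k * inner ys ys.
Proof. by rewrite (orbit_sum_inner isoV _ wys uy) innerxx. Qed.

Lemma orbit_parseval :
  series (fun n => rnorm (u n) ^+ 2 * rnorm ys ^+ 2) @ \oo --> rnorm y ^+ 2.
Proof.
have := cvg_rnorm uy => h.
have : rnorm (series (fun n => u n *: iter n V ys) n) ^+ 2 @[n --> \oo] --> rnorm y ^+ 2.
  by rewrite expr2; apply: cvgM.
by apply: cvg_seq_ext => n; rewrite /series /= rnorm_orbit_sum.
Qed.

(** Parseval's identity for the coefficients of y is the hypothesis of
[multiplicity_one]. *)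
Let orbit_ortho x : (forall n m, inner (iter n V x) (iter m V y) = 0) ->
  forall i, inner x (iter i V ys) = 0.
Proof.
apply: multiplicity_one => //; rewrite mulrC.
have := cvg_seqMr (c := rnorm ys ^+ 2) orbit_parseval.
apply: cvg_seq_ext => n; rewrite /series /= mulr_suml; apply: eq_bigr => i _.
rewrite innerC rnormC y_coef innerxx rnormM rnormR ger0_norm ?sqr_ge0//.
by ring.
Qed.

Let L_split l : L l -> exists2 c, L (l - c *: y) & inner (l - c *: y) y = 0.
Proof.
move=> Ll; exists (inner l y / inner y y).
  by apply: (subspaceB linL) => //; exact: (subspaceZ linL).
by rewrite innerBl innerZl divfK// subrr.
Qed.

(** The vectors of L orthogonal to y are orthogonal to the whole orbit of ys.  For
n > i the inner product vanishes because V^* kills ys. *)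
Let L_ortho l : L l -> inner l y = 0 -> forall n i, inner (iter n V l) (iter i V ys) = 0.
Proof.
move=> Ll ly n i; have lys : forall i, inner l (iter i V ys) = 0.
  apply: orbit_ortho => a b; have [->|ab] := eqVneq a b; first by rewrite iter_inner.
  exact: wanL.2.
have [ni|i_n] := leqP n i; first by rewrite -(subnKC ni) iterD iter_inner.
rewrite -(subnK (ltnW i_n)) addnC iterD iter_inner//.
have := i_n; rewrite -subn_gt0; case: (n - i)%N => // d _.
by rewrite iterS adjointP (adjointV_Ls Lys) inner0r.
Qed.

(** The closed linear span of the orbit of ys, as a double orthogonal complement. *)
Let K1 := orthocomp (orthocomp [set iter n V ys | n in setT]).

Let K1_closed : closed_subspace K1.
Proof. exact: orthocomp_closed_subspace. Qed.

Let linK1 : linear_subspace K1 := K1_closed.1.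

Let K1P x : K1 x <-> forall z, (forall n, inner (iter n V ys) z = 0) -> inner z x = 0.
Proof.
split=> xK z zV; last by apply: xK => n; apply: zV; exists n.
by apply: xK => _ [n _ <-].
Qed.

Let K1_orbit n : K1 (iter n V ys).
Proof. by apply/K1P => z zV; apply: inner_eq0C. Qed.

Let K1_V x : K1 x -> K1 (V x).
Proof.
move=> /K1P xK; apply/K1P => z zV; rewrite adjointP'; apply: xK => n.
by rewrite -adjointP -iterS.
Qed.

Let K1_V' x : K1 x -> K1 (V' x).
Proof.
move=> /K1P xK; apply/K1P => z zV; rewrite -adjointP; apply: xK => -[|n].
  by rewrite /= adjointP' (adjointV_Ls Lys) inner0l.
by rewrite iterS isometric_inner.
Qed.

Let K1_y : K1 y.
Proof.
apply/K1P => z zV; apply: inner_eq0C; apply: (cvg_inner_eq0 uy) => n.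
by rewrite /series /= inner_suml big1// => i _; rewrite innerZl zV mulr0.
Qed.

Let K1_L l x : L l -> inner l y = 0 -> K1 x -> forall n, inner (iter n V l) x = 0.
Proof.
move=> Ll ly /K1P Kx n; apply: Kx => i; apply: inner_eq0C; exact: L_ortho.
Qed.

(** The difference d of the gap and its component along y is in L and orthogonal to
y, hence to K1, in particular to V h.  It is also orthogonal to T h, so that it is
orthogonal to the gap as well as to y: it vanishes. *)
Let K1_gap (h : H) : K1 (incl h) -> gap h = (inner (gap h) y / inner y y) *: y.
Proof.
move=> Kh; have Lg := gapL h; set c := _ / _.
have gy : inner (gap h - c *: y) y = 0 by rewrite innerBl innerZl divfK// subrr.
have Ld : L (gap h - c *: y) by apply: (subspaceB linL) => //; exact: (subspaceZ linL).
apply/eqP; rewrite -subr_eq0; apply/eqP/innerxx_eq0.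
rewrite {2}/gap !innerBr innerZr gy mulr0 subr0.
rewrite (K1_L Ld gy (K1_V Kh) 0) sub0r (inner_eq0C (ortho_ML 0 (inclH _) Ld)).
by rewrite oppr0.
Qed.

Let K1_Ls x : K1 x -> Ls x -> x = (inner x ys / inner ys ys) *: ys.
Proof.
move=> Kx Lx; set c := _ / _.
have xs : inner (x - c *: ys) ys = 0 by rewrite innerBl innerZl divfK// subrr.
have Ld : Ls (x - c *: ys) by apply: (subspaceB linLs) => //; exact: (subspaceZ linLs).
apply/eqP; rewrite -subr_eq0; apply/eqP/innerxx_eq0.
rewrite innerBr innerZr xs mulr0 subr0.
move/K1P: Kx; apply=> -[|n]; first by apply: inner_eq0C.
by rewrite iterS adjointP (adjointV_Ls Ld) inner0r.
Qed.

(** A vector of K1 is orthogonal to the V^n l with l in L orthogonal to y, so that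
only the orbit of y has to be tested. *)
Let K1_H x : K1 x -> (forall n, inner x (iter n V y) = 0) -> csubspace_set H x.
Proof.
move=> Kx xy; apply: in_H => n l Ll.
have [c Ld ly] := L_split Ll.
rewrite -(subrK (c *: y) l) iter_bopD iter_bopZ innerDr innerZr xy mulr0 addr0.
by apply: inner_eq0C; exact: K1_L.
Qed.

Let M_set : set H := [set h | K1 (incl h)].

Let M_closed : closed_subspace M_set.
Proof.
split; first split.
- exact: (subspace0 linK1).
- by move=> a x z Mx Mz; apply: linK1.2.
apply: seq_closed => x l Mx /cvg_rnormP xl.
apply: (closed_cvgn K1_closed.2 Mx); apply/cvg_rnormP => e /xl[N xN].
by exists N => n /xN.
Qed.

Definition pair_subspace : csubspace H := CSubspace M_closed.
Local Notation M := pair_subspace.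

(** K1 reduces V, and T h = V h - gap h where the gap of h is a multiple of y. *)
Lemma pair_reducing : reducing T M.
Proof.
have MT' x : M_set x -> M_set (adjoint T x).
  by rewrite /M_set /= incl_adjoint; exact: K1_V'.
split=> [x Mx|x xM z /MT' Mz]; last by rewrite adjointP' xM.
have TxE : incl (T x) = V (incl x) - gap x by rewrite opprB addrC subrK.
rewrite /= /M_set /= TxE.
apply: (subspaceB linK1); first exact: K1_V.
by rewrite K1_gap//; exact: (subspaceZ linK1).
Qed.

Local Notation Rst := (restriction (proj1 pair_reducing)).

Let M_K1 (x : M) : K1 (incl (incl x)).
Proof. exact: (set_mem (inclP x)). Qed.

(** The defects of T|M are spanned by V^* y and by f0, the part of ys orthogonal to y:
on M these vectors represent the functionals <gap x, y> and <x, ys>. *)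
Let gH_subproof : csubspace_set H (V' y).
Proof.
apply: in_H => n l Ll; rewrite -adjointP' -iterS.
exact: (wanL.2 0%N n.+1).
Qed.

Let gH : H := CSubspaceElt (mem_set gH_subproof).

Let gM : M := @CSubspaceElt _ _ M gH (mem_set (K1_V' K1_y : M_set gH)).

Let f0 := ys - (inner ys y / inner y y) *: y.

Let f0_K1 : K1 f0.
Proof.
by apply: (subspaceB linK1); [exact: (K1_orbit 0)|exact: (subspaceZ linK1)].
Qed.

Let fH_subproof : csubspace_set H f0.
Proof.
apply: K1_H => // -[|n]; first by rewrite /= innerBl innerZl divfK// subrr.
rewrite innerBl innerZl (@wy 0%N n.+1)// mulr0 subr0 iterS adjointP' (adjointV_Ls Lys).
by rewrite inner0l.
Qed.

Let fH : H := CSubspaceElt (mem_set fH_subproof).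

Let fM : M := @CSubspaceElt _ _ M fH (mem_set (f0_K1 : M_set fH)).

Let inner_gM (x : M) : inner (gap (incl x)) y = inner x gM.
Proof.
by rewrite innerBl adjointP (ortho_ML 0 (inclH _) Ly) subr0.
Qed.

Let inner_fM (x : M) : inner (incl (incl x)) ys = inner x fM.
Proof.
rewrite -[RHS]/(inner (incl (incl x)) f0) innerBr innerZr.
by rewrite (ortho_ML 0 (inclH _) Ly) mulr0 subr0.
Qed.

(** Both sides have the same inner product with z, since
<(I - T^*T) x, z> = <gap x, gap z> and the gaps are multiples of y. *)
Let defect_left (x : M) : x - adjoint Rst (Rst x) = (inner x gM / inner y y) *: gM.
Proof.
apply: inner_inj => z; rewrite innerBl -adjointP' innerZl.
transitivity (inner (gap (incl x)) (gap (incl z))); first by rewrite gap_inner.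
rewrite (K1_gap (M_K1 x)) (K1_gap (M_K1 z)) !inner_gM innerZl innerZr.
rewrite rmorphM /= fmorphV /= -(innerC y y) -innerC.
by field.
Qed.

Let foot_M (x : M) : foot (incl (incl x)) = (inner x fM / inner ys ys) *: ys.
Proof.
rewrite -inner_fM -(inner_foot _ Lys); apply: K1_Ls; last exact: footLs.
apply: (subspaceB linK1); first exact: M_K1.
by apply: K1_V; apply: K1_V'; exact: M_K1.
Qed.

Let defect_right (x : M) : x - Rst (adjoint Rst x) = (inner x fM / inner ys ys) *: fM.
Proof.
apply: inner_inj => z; rewrite innerBl adjointP innerZl.
transitivity (inner (foot (incl (incl x))) (foot (incl (incl z)))).
  by rewrite foot_inner -!incl_adjoint -!(restriction_adjoint pair_reducing).
rewrite !foot_M innerZl innerZr.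
rewrite rmorphM /= fmorphV /= -(innerC ys ys) -innerC.
by field.
Qed.

(** The two defects have the same size a = |V^* y| / |y| = |f0| / |ys|: the squares
of both norms are given by Pythagoras in terms of |<ys, y>|. *)
Let norms : rnorm gM * rnorm ys = rnorm fM * rnorm y.
Proof.
have sq : rnorm gM ^+ 2 * rnorm ys ^+ 2 = rnorm fM ^+ 2 * rnorm y ^+ 2.
  have ny0 : rnorm y ^+ 2 != 0 by rewrite sqrf_eq0 rnorm_eq0.
  have nys0 : rnorm ys ^+ 2 != 0 by rewrite sqrf_eq0 rnorm_eq0.
  have -> : rnorm fM ^+ 2 = rnorm ys ^+ 2 - rnorm (inner ys y) ^+ 2 / rnorm y ^+ 2.
    by rewrite -rnorm_sub_proj.
  have -> : rnorm gM ^+ 2 = rnorm y ^+ 2 - rnorm (inner ys y) ^+ 2 / rnorm ys ^+ 2.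
    have fy : foot y = (inner y ys / inner ys ys) *: ys.
      rewrite -(inner_foot _ Lys); apply: K1_Ls; last exact: footLs.
      by apply: (subspaceB linK1) => //; apply: K1_V; exact: K1_V'.
    have := foot_inner y y; rewrite fy innerZl innerZr.
    rewrite rmorphM /= fmorphV /= -(innerC ys ys) -(innerC ys y) -[inner (V' y) _]/(inner gM gM).
    have -> : inner y ys / inner ys ys * (inner ys y / inner ys ys * inner ys ys) =
        inner y ys * inner ys y / inner ys ys by field.
    have -> : inner y ys * inner ys y = (rnorm (inner ys y) ^+ 2)%:C.
      by rewrite rnorm_sqr -innerC mulrC.
    rewrite !innerxx -fmorphV -rmorphM -rmorphB => /complexI ->.
    by rewrite opprB addrC subrK.
  by field; rewrite rnorm_eq0 y0 rnorm_eq0 ys0.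
by apply/eqP; rewrite -(@eqrXn2 _ 2) ?mulr_ge0 ?rnorm_ge0// !exprMn sq.
Qed.

Let ny_gt0 : 0 < rnorm y.
Proof. by rewrite lt_def rnorm_eq0 y0 rnorm_ge0. Qed.

Let nys_gt0 : 0 < rnorm ys.
Proof. by rewrite lt_def rnorm_eq0 ys0 rnorm_ge0. Qed.

(** If V^* y vanished, y would be a vector of Ls orthogonal to H. *)
Let ng_gt0 : 0 < rnorm gM.
Proof.
rewrite lt_def rnorm_ge0 andbT rnorm_eq0; apply: contra_neq y0 => g0.
have V'y : V' y = 0 by rewrite -[V' y]/(incl (incl gM)) g0.
have Lsy : Ls y by have := footLs y; rewrite /foot V'y linear0 subr0.
by apply: foot_dense => // h; apply: inner_eq0C; exact: (ortho_ML 0 (inclH h) Ly).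
Qed.

Let nf_gt0 : 0 < rnorm fM.
Proof. by rewrite -(pmulr_lgt0 _ ny_gt0) -norms mulr_gt0. Qed.

Let e : M := (rnorm gM)^-1%:C *: gM.
Let f : M := (rnorm fM)^-1%:C *: fM.
Let a : R := rnorm gM / rnorm y.

Let aE : a = rnorm fM / rnorm ys.
Proof.
rewrite /a -[in LHS](mulfK (lt0r_neq0 nys_gt0) (rnorm gM)) norms.
by field; rewrite !gt_eqF.
Qed.

(** The passage from an arbitrary generator g of a line to a unit vector. *)
Lemma rank_one_normalize (g : M) (c : R) (A : M -> M) : 0 < rnorm g -> 0 < c ->
  (forall x, A x = (inner x g / (c ^+ 2)%:C) *: g) ->
  let e := (rnorm g)^-1%:C *: g in
  rnorm e = 1 /\ forall x, A x = ((rnorm g / c) ^+ 2)%:C *: along e x.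
Proof.
move=> g0 c0 AE /=; split.
  by rewrite rnormZ rnormR ger0_norm ?invr_ge0 ?ltW// mulVf ?gt_eqF.
move=> x; rewrite AE /along innerZr conjR !scalerA; congr (_ *: _).
rewrite !rmorphXn !rmorphM !fmorphV /=.
by field; rewrite !(inj_eq (@complexI R) _ 0) !gt_eqF.
Qed.

Lemma pair_rank_one : rank_one_defects Rst a e f.
Proof.
have [e1 eP] := @rank_one_normalize gM (rnorm y)
  (fun x => x - adjoint Rst (Rst x)) ng_gt0 ny_gt0
  (fun x => etrans (defect_left x) (congr1 (fun t => (_ / t) *: _) (innerxx y))).
have [f1 fP] := @rank_one_normalize fM (rnorm ys)
  (fun x => x - Rst (adjoint Rst x)) nf_gt0 nys_gt0
  (fun x => etrans (defect_right x) (congr1 (fun t => (_ / t) *: _) (innerxx ys))).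
split=> //; first exact: divr_gt0.
by rewrite aE.
Qed.

Let scale_eq : (a ^+ 2)%:C * (rnorm gM)^-1%:C * (rnorm fM)^-1%:C * (rnorm ys ^+ 2)%:C =
  (rnorm ys / rnorm y)%:C.
Proof.
rewrite -!rmorphM; congr (_%:C); rewrite /a.
have -> : (rnorm gM / rnorm y) ^+ 2 / rnorm gM / rnorm fM * rnorm ys ^+ 2 =
    (rnorm gM * rnorm ys) * rnorm ys / (rnorm y ^+ 2 * rnorm fM).
  by field; rewrite !gt_eqF.
by rewrite norms; field; rewrite !gt_eqF.
Qed.

(** The coefficient of index k+1 is <V^*^k V^* y, ys> = <y, V^(k+1) ys> up to
normalization.  The factor |ys| / |y| is 1 when u is inner. *)
Lemma pair_char_coef n :
  char_coef Rst a e f n = u n * (rnorm ys / rnorm y)%:C.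
Proof.
have adj k (x : M) : incl (incl (iter k (adjoint Rst) x)) = iter k V' (incl (incl x)).
  by elim: k => //= k IH; rewrite (restriction_adjoint pair_reducing) incl_adjoint IH.
rewrite -scale_eq; case: n => [|k]; rewrite /char_coef.
  rewrite bopZ innerZl innerZr conjR -inner_fM.
  have -> : incl (incl (Rst gM)) = V (V' y) - gap gH by rewrite opprB addrC subrK.
  rewrite innerBl adjointP (adjointV_Ls Lys) inner0r sub0r.
  rewrite (K1_gap (M_K1 gM)) (inner_gM gM) innerZl (y_coef 0) !innerxx.
  rewrite /a !rmorphXn !rmorphM !fmorphV /=.
  by field; rewrite !(inj_eq (@complexI R) _ 0) !gt_eqF.
rewrite iter_bopZ innerZl innerZr conjR -inner_fM adj.
have -> : inner (iter k V' (incl (incl gM))) ys = u k.+1 * (rnorm ys ^+ 2)%:C.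
  by rewrite -innerxx -y_coef iter_adjoint_inner iterSr.
by ring.
Qed.

Lemma pair_to_reducing : exists (M' : csubspace H) (TM : reducing T M') a' e' f',
  rank_one_defects (restriction (proj1 TM)) a' e' f' /\
  forall n, char_coef (restriction (proj1 TM)) a' e' f' n =
    u n * (rnorm ys / rnorm y)%:C.
Proof.
exists pair_subspace, pair_reducing, a, e, f; split; first exact: pair_rank_one.
exact: pair_char_coef.
Qed.

End from_pair.

(** * From a reducing subspace to a pair of vectors *)
Section from_reducing.
Hypothesis T_C00 : C00 T.
Variables (M : csubspace H) (TM : reducing T M).
Local Notation Rst := (restriction (proj1 TM)).
Variables (a : R) (e f : M).
Hypothesis rk : rank_one_defects Rst a e f.

Let a0 : 0 < a. Proof. by case: rk. Qed.
Let e1 : rnorm e = 1. Proof. by case: rk. Qed.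
Let f1 : rnorm f = 1. Proof. by case: rk. Qed.
Let defe (x : M) : x - adjoint Rst (Rst x) = (a ^+ 2)%:C *: along e x.
Proof. by case: rk. Qed.
Let deff (x : M) : x - Rst (adjoint Rst x) = (a ^+ 2)%:C *: along f x.
Proof. by case: rk. Qed.

Let gapM (x : M) := gap (incl x).
Let footM (x : M) := foot (incl (incl x)).

Let gapM_inner (x z : M) : inner (gapM x) (gapM z) = inner (x - adjoint Rst (Rst x)) z.
Proof. by rewrite gap_inner innerBl -adjointP'. Qed.

Let footM_inner (x z : M) : inner (footM x) (footM z) = inner (x - Rst (adjoint Rst x)) z.
Proof.
transitivity (inner x z - inner (adjoint Rst x) (adjoint Rst z)).
  by rewrite foot_inner -!incl_adjoint -!(restriction_adjoint TM).
by rewrite innerBl [inner (Rst _) z]adjointP.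
Qed.

Let decomp (x c : M) : x = inner x c *: c + (x - along c x).
Proof. by rewrite addrC subrK. Qed.

(** The foot of a vector of M orthogonal to f is 0, since the norm of the foot is
given by the defect of T^*. *)
Let footME (x : M) : footM x = inner x f *: footM f.
Proof.
rewrite {1}(decomp x f) {1}/footM.
have -> : incl (incl (inner x f *: f + (x - along f x))) =
  inner x f *: incl (incl f) + incl (incl (x - along f x)) by [].
rewrite foot_linear -/(footM f) -/(footM (x - along f x)); set d := x - _.
suff -> : footM d = 0 by rewrite addr0.
by apply: innerxx_eq0; rewrite footM_inner deff /along along_ortho// scale0r scaler0 inner0l.
Qed.

Let y := a^-1%:C *: gapM e.
Let ys := a^-1%:C *: footM f.

Let footME' (x : M) : footM x = (a%:C * inner x f) *: ys.
Proof.
by rewrite footME /ys scalerA mulrAC -rmorphM mulfV ?gt_eqF// mul1r.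
Qed.

Let unit_of (x : K) : inner x x = (a ^+ 2)%:C -> rnorm (a^-1%:C *: x) = 1.
Proof.
rewrite innerxx => /complexI/eqP; rewrite eqrXn2 ?rnorm_ge0 ?(ltW a0)// => /eqP xa.
by rewrite rnormZ rnormR xa ger0_norm ?invr_ge0 ?(ltW a0)// mulVf ?gt_eqF.
Qed.

Let y1 : rnorm y = 1.
Proof.
by apply: unit_of; rewrite gapM_inner defe innerZl /along innerZl !inner_unit// !mulr1.
Qed.

Let ys1 : rnorm ys = 1.
Proof.
by apply: unit_of; rewrite footM_inner deff innerZl /along innerZl !inner_unit// !mulr1.
Qed.

Let V'y : V' y = a%:C *: incl (incl e).
Proof.
rewrite bopZ /gapM /gap bopB isometric_adjointK// -incl_adjoint.
have -> : incl (adjoint T (T (incl e))) = incl (incl (adjoint Rst (Rst e))).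
  by rewrite (restriction_adjoint TM).
have -> : incl (incl e) - incl (incl (adjoint Rst (Rst e))) =
  incl (incl (e - adjoint Rst (Rst e))) by [].
rewrite defe /along inner_unit// scale1r.
have -> : incl (incl ((a ^+ 2)%:C *: e)) = (a ^+ 2)%:C *: incl (incl e) by [].
by rewrite scalerA -rmorphM; congr (_%:C *: _); field; rewrite gt_eqF.
Qed.

Let iterV'y k : iter k.+1 V' y = a%:C *: incl (incl (iter k (adjoint Rst) e)).
Proof.
rewrite iterSr V'y iter_bopZ; congr (_ *: _).
by elim: k => //= k ->; rewrite (restriction_adjoint TM) incl_adjoint.
Qed.

(** The terms of the telescoping sum are char_coef V^n ys.  For n = 0 this is because
foot V = 0, and for n > 0 because V^* y is a multiple of e. *)
Let foot_iter n : foot (iter n V' y) = char_coef Rst a e f n *: ys.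
Proof.
have foot0 x : foot (V x) = 0 by rewrite /foot isometric_adjointK// subrr.
have footZ c x : foot (c *: x) = c *: foot x.
  by rewrite /foot !bopZ scalerBr.
case: n => [|k].
  rewrite /= footZ /gapM /gap addrC -scaleN1r foot_linear foot0 addr0 scalerA.
  rewrite -[foot _]/(footM (Rst e)) footME' scalerA; congr (_ *: _).
  by rewrite mulrN1 mulNr mulrA -rmorphM mulVf ?gt_eqF// mul1r.
rewrite iterV'y footZ -/(footM _) footME' scalerA; congr (_ *: _).
by rewrite /char_coef rmorphXn mulrA.
Qed.

Let partial N : series (fun n => char_coef Rst a e f n *: iter n V ys) N =
  y - iter N V (iter N V' y).
Proof.
rewrite /series /=; elim: N => [|N IH]; first by rewrite big_geq// subrr.
rewrite big_nat_recr//= IH -iter_bopZ -foot_iter /foot.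
by rewrite iter_bopB -iterSr addrA subrK.
Qed.

Lemma reducing_to_pair : exists y ys,
  [/\ L y, Ls ys, rnorm y = 1, rnorm ys = 1 &
      series (fun n => char_coef Rst a e f n *: iter n V ys) @ \oo --> y].
Proof.
exists y, ys; split=> //.
- by apply: (subspaceZ linL); exact: gapL.
- by apply: (subspaceZ linLs); exact: footLs.
apply: (@cvg_seq_ext _ (fun N => y - iter N V (iter N V' y))) => [N|].
  by rewrite partial.
rewrite -[X in _ --> X]subr0; apply: cvg_seqB; first exact: cvg_cst.
apply/cvg_rnorm0P; rewrite -(cvg_shiftn 1).
have [_ _ /(_ (incl e))/cvg_rnorm0P T0] := T_C00.
have := cvg_seqMl (c := a) T0; rewrite mulr0; apply: cvg_seq_ext => k.
rewrite /= addn1 !subr0 (iter_rnorm isoV) iterV'y rnormZ rnormR ger0_norm ?(ltW a0)//.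
congr (_ * _); rewrite -[rnorm (iter _ _ _)]/(rnorm (incl (iter k (adjoint T) (incl e)))).
congr rnorm; congr incl.
by elim: k => //= k ->; rewrite (restriction_adjoint TM).
Qed.

End from_reducing.

End dilation.

(** * Uniqueness of Fourier coefficients *)
Section trig_poly.
Context {R : realType}.

Inductive trig_poly : (R -> R) -> Prop :=
| trig_cos (k : int) : trig_poly (fun t => cos (k%:~R * t))
| trig_sin (k : int) : trig_poly (fun t => sin (k%:~R * t))
| trigD f g : trig_poly f -> trig_poly g -> trig_poly (fun t => f t + g t)
| trigZ a f : trig_poly f -> trig_poly (fun t => a * f t).

Lemma eq_trig_poly f g : trig_poly f -> (forall t, g t = f t) -> trig_poly g.
Proof. by move=> tf fg; rewrite (_ : g = f)//; exact/funext. Qed.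

Lemma trig_cst a : trig_poly (fun=> a).
Proof.
apply: (eq_trig_poly (trigZ a (trig_cos 0))) => t.
by rewrite mul0r cos0 mulr1.
Qed.

Lemma trigM_cos k f : trig_poly f -> trig_poly (fun t => f t * cos (k%:~R * t)).
Proof.
elim=> [j|j|g h _ IHg _ IHh|a g _ IHg].
- apply: (eq_trig_poly (trigZ 2^-1 (trigD (trig_cos (j + k)) (trig_cos (j - k))))) => t.
  by rewrite rmorphD rmorphB /= mulrDl mulrBl cosD cosB; field.
- apply: (eq_trig_poly (trigZ 2^-1 (trigD (trig_sin (j + k)) (trig_sin (j - k))))) => t.
  by rewrite rmorphD rmorphB /= mulrDl mulrBl sinD sinB; field.
- by apply: (eq_trig_poly (trigD IHg IHh)) => t; rewrite mulrDl.
- by apply: (eq_trig_poly (trigZ a IHg)) => t; rewrite mulrA.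
Qed.

Lemma trigM_sin k f : trig_poly f -> trig_poly (fun t => f t * sin (k%:~R * t)).
Proof.
elim=> [j|j|g h _ IHg _ IHh|a g _ IHg].
- apply: (eq_trig_poly (trigZ 2^-1 (trigD (trig_sin (j + k))
    (trigZ (-1) (trig_sin (j - k)))))) => t.
  by rewrite rmorphD rmorphB /= mulrDl mulrBl sinD sinB; field.
- apply: (eq_trig_poly (trigZ 2^-1 (trigD (trig_cos (j - k))
    (trigZ (-1) (trig_cos (j + k)))))) => t.
  by rewrite !rmorphD rmorphN /= !mulrDl mulNr !cosD cosN sinN; field.
- by apply: (eq_trig_poly (trigD IHg IHh)) => t; rewrite mulrDl.
- by apply: (eq_trig_poly (trigZ a IHg)) => t; rewrite mulrA.
Qed.

Lemma trigM f g : trig_poly f -> trig_poly g -> trig_poly (fun t => f t * g t).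
Proof.
move=> tf; elim=> [j|j|g1 g2 _ IH1 _ IH2|a g1 _ IH].
- exact: trigM_cos.
- exact: trigM_sin.
- by apply: (eq_trig_poly (trigD IH1 IH2)) => t; rewrite mulrDr.
- by apply: (eq_trig_poly (trigZ a IH)) => t; rewrite mulrCA.
Qed.

Lemma trigX f n : trig_poly f -> trig_poly (fun t => f t ^+ n).
Proof.
move=> tf; elim: n => [|n IH].
  by apply: (eq_trig_poly (trig_cst 1)) => t; rewrite expr0.
by apply: (eq_trig_poly (trigM tf IH)) => t; rewrite exprS.
Qed.

Lemma trig_continuous f : trig_poly f -> continuous f.
Proof.
elim=> [k|k|g h _ cg _ ch|a g _ cg] t.
- by apply: continuous_comp; [apply: mulrl_continuous|exact: continuous_cos].
- by apply: continuous_comp; [apply: mulrl_continuous|exact: continuous_sin].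
- by apply: cvgD; [exact: cg|exact: ch].
- by apply: cvgM; [exact: cvg_cst|exact: cg].
Qed.

Lemma trig_bounded f : trig_poly f -> exists M, forall t, `|f t| <= M.
Proof.
elim=> [k|k|g h _ [M gM] _ [N hN]|a g _ [M gM]].
- by exists 1 => t; rewrite ler_norml cos_geN1 cos_le1.
- by exists 1 => t; rewrite ler_norml sin_geN1 sin_le1.
- exists (M + N) => t; apply: le_trans (ler_normD _ _) _; exact: lerD.
- exists (`|a| * M) => t; rewrite normrM ler_wpM2l//.
Qed.

(** The polynomials (1 - x^n)^(2^n), known from the proof of the theorem of Stone
and Weierstrass, separate [0, 1/2[ from ]1/2, 1].  Both limits follow from the
inequality of Bernoulli. *)
Lemma separating_le (x : R) n : 0 <= x <= 1 -> 0 <= (1 - x ^+ n) ^+ (2 ^ n) <= 1.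
Proof.
move=> /andP[x0 x1]; have x2 : 0 <= 1 - x ^+ n by rewrite subr_ge0 exprn_ile1.
by rewrite exprn_ge0//= exprn_ile1// gerBl exprn_ge0.
Qed.

Lemma bernoulli (x : R) n : -1 <= x -> 1 + n%:R * x <= (1 + x) ^+ n.
Proof.
move=> x1; elim: n => [|n IH]; first by rewrite mul0r addr0 expr0.
rewrite exprS -natr1; have h : 0 <= 1 + x by lra.
apply: (@le_trans _ _ ((1 + x) * (1 + n%:R * x))); last by rewrite ler_wpM2l.
have : 0 <= n%:R * x ^+ 2 by rewrite mulr_ge0 ?ler0n ?sqr_ge0.
rewrite expr2; lra.
Qed.

Lemma separating_low (x : R) : 0 <= x -> x < 2^-1 ->
  (1 - x ^+ n) ^+ (2 ^ n) @[n --> \oo] --> (1 : R).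
Proof.
move=> x0 x1; have x2 : `|2 * x| < 1 by rewrite ger0_norm; lra.
apply: (@squeeze_cvgr _ _ _ _ (fun n => 1 - (2 * x) ^+ n) (cst 1)).
- apply: nearW => n.
  have /andP[_ ->] : 0 <= (1 - x ^+ n) ^+ (2 ^ n) <= 1.
    by apply: separating_le; apply/andP; split; lra.
  rewrite andbT exprMn; have := @bernoulli (- x ^+ n) (2 ^ n).
  rewrite mulrN natrX; apply.
  by rewrite lerN2 exprn_ile1//; lra.
- rewrite -[X in _ --> X]subr0; apply: cvgB; first exact: cvg_cst.
  exact: cvg_expr.
- exact: cvg_cst.
Qed.

Lemma separating_high (x : R) : 2^-1 < x -> x <= 1 ->
  (1 - x ^+ n) ^+ (2 ^ n) @[n --> \oo] --> (0 : R).
Proof.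
move=> x0 x1; have x2 : `|(2 * x)^-1| < 1.
  by rewrite ger0_norm ?invr_ge0; [rewrite invf_lt1; lra|lra].
apply: (@squeeze_cvgr _ _ _ _ (cst 0) (fun n => (2 * x)^-1 ^+ n)).
- apply: nearW => n.
  have /andP[-> _]/= : 0 <= (1 - x ^+ n) ^+ (2 ^ n) <= 1.
    by apply: separating_le; apply/andP; split; lra.
  have b1 := @bernoulli (x ^+ n) (2 ^ n).
  have xn : 0 < x ^+ n by rewrite exprn_gt0//; lra.
  have xn1 : x ^+ n <= 1 by rewrite exprn_ile1//; lra.
  set p := (1 - x ^+ n) ^+ (2 ^ n); set q := (1 + x ^+ n) ^+ (2 ^ n) in b1.
  have pq : p * q <= 1.
    rewrite -exprMn exprn_ile1//; have := mulr_ge0 (ltW xn) (ltW xn); nra.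
  have p0 : 0 <= p by rewrite exprn_ge0// subr_ge0.
  have qx : (2 * x) ^+ n <= q.
    rewrite exprMn -natrX; apply: le_trans (b1 _); lra.
  have z0 : 0 < (2 * x) ^+ n by rewrite exprn_gt0//; lra.
  rewrite exprVn -[leRHS]mul1r ler_pdivlMr//.
  apply: le_trans pq; rewrite ler_wpM2l//.
- exact: cvg_cst.
- exact: cvg_expr.
Qed.

End trig_poly.

Section fourier_uniqueness.
Context {R : realType}.
Local Notation mu := (@lebesgue_measure R).
Local Notation circle := (`[0, 2 * pi]%classic : set R).
Local Notation integrable g := (mu.-integrable circle (EFin \o g)).
Local Notation integral g := (\int[mu]_(t in circle) g t).

Lemma pi2_gt0 : 0 < 2 * pi :> R.
Proof. by rewrite mulr_gt0// pi_gt0. Qed.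

Lemma circle_measure : mu circle = (2 * pi)%:E.
Proof. by rewrite lebesgue_measure_itv/= lte_fin pi2_gt0 oppr0 adde0. Qed.

Lemma trig_measurable f : trig_poly f -> measurable_fun circle f.
Proof.
by move=> /trig_continuous cf; apply: measurable_funTS; exact: continuous_measurable_fun.
Qed.

Lemma integrableM_bounded (g h : R -> R) M : integrable g -> measurable_fun circle h ->
  (forall t, `|h t| <= M) -> integrable (fun t => g t * h t).
Proof.
move=> ig mh hM.
have bh : [bounded h t | t in circle].
  exists `|M|; split; first exact: num_real.
  move=> x Mx t _ /=; apply: le_trans (hM t) _.
  by apply: le_trans (ler_norm M) (ltW Mx).
have := @integrableMl _ _ _ mu circle (measurable_itv _) _ _ ig mh bh.
by apply: eq_integrable => // t _; rewrite EFinM.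
Qed.

Lemma ae2S (P Q S : R -> Prop) : (forall t, P t -> Q t -> S t) ->
  {ae mu, forall t, P t} -> {ae mu, forall t, Q t} -> {ae mu, forall t, S t}.
Proof.
by move=> PQS; apply: filterS2 => //; exact: (ae_filter_ringOfSetsType mu).
Qed.

Lemma aeS (P Q : R -> Prop) : (forall t, P t -> Q t) ->
  {ae mu, forall t, P t} -> {ae mu, forall t, Q t}.
Proof. by move=> PQ aeP; apply: (ae2S _ aeP aeP) => t Pt _; exact: PQ. Qed.

Lemma integral_EFin (g : R -> R) : integrable g ->
  (\int[mu]_(t in circle) (g t)%:E)%E = (integral g)%:E.
Proof.
by move=> ig; rewrite /Rintegral fineK// (@integrable_fin_num _ _ _ mu circle).
Qed.

Section uniqueness.
Variable g : R -> R.
Hypothesis ig : integrable g.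
Hypothesis g_cos : forall k : int, integral (fun t => g t * cos (k%:~R * t)) = 0.
Hypothesis g_sin : forall k : int, integral (fun t => g t * sin (k%:~R * t)) = 0.

Lemma trig_integral0 f : trig_poly f ->
  integrable (fun t => g t * f t) /\ integral (fun t => g t * f t) = 0.
Proof.
move=> tf; split.
  by have [M fM] := trig_bounded tf; exact: integrableM_bounded (trig_measurable tf) fM.
have int h : trig_poly h -> integrable (fun t => g t * h t).
  by move=> th; have [M hM] := trig_bounded th; exact: integrableM_bounded (trig_measurable th) hM.
elim: tf => [k|k|f1 f2 t1 I1 t2 I2|a f1 t1 I1].
- exact: g_cos.
- exact: g_sin.
- under eq_Rintegral do rewrite mulrDr.
  by rewrite RintegralD ?I1 ?I2 ?addr0//; [exact: int|exact: int].
- under eq_Rintegral do rewrite mulrCA.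
  by rewrite RintegralZl ?I1 ?mulr0//; exact: int.
Qed.

(** The points of the arc from 0 to x are those whose angle to its midpoint x / 2
is at most x / 2. *)
Lemma arc_cos (x t : R) : 0 < x -> x < 2 * pi -> 0 < t -> t < 2 * pi ->
  (t < x -> cos (x / 2) < cos (t - x / 2)) /\
  (x < t -> cos (t - x / 2) < cos (x / 2)).
Proof.
move=> x0 x2 t0 t2.
have d0 : x / 2 \in `[0, pi] by rewrite in_itv/=; apply/andP; split; lra.
split=> tx.
  rewrite -[ltRHS]cos_norm ltr_cos ?d0//.
    rewrite ltr_norml; apply/andP; split; lra.
  rewrite in_itv/= normr_ge0/= ler_norml; apply/andP; split; lra.
have [tp|tp] := leP (t - x / 2) pi.
  rewrite ltr_cos ?d0//; first lra.
  by rewrite in_itv/=; apply/andP; split; lra.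
have -> : cos (t - x / 2) = cos (2 * pi - (t - x / 2)).
  by rewrite -[RHS]cosN opprB mulr_natl -[in RHS](cosD2pi _) subrK.
rewrite ltr_cos ?d0//; first lra.
by rewrite in_itv/=; apply/andP; split; lra.
Qed.

(** The trigonometric polynomial q is larger than 1/2 inside the arc from 0 to x and
smaller outside, with values in [0, 1].  So the trigonometric polynomials
1 - (1 - q^n)^(2^n) tend to the indicator function of the arc, boundedly and almost
everywhere, and the integrals of g against them all vanish. *)
Lemma arc_integral0 (x : R) : 0 < x -> x < 2 * pi ->
  \int[mu]_(t in `[0, x]) g t = 0.
Proof.
move=> x0 x2.
pose q t := 2^-1 + (cos (t - x / 2) - cos (x / 2)) / 4.
pose p n t := 1 - (1 - (q t) ^+ n) ^+ (2 ^ n).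
have tq : trig_poly q.
  apply: (eq_trig_poly (trigD (trig_cst (2^-1 - cos (x / 2) / 4))
    (trigD (trigZ (cos (x / 2) / 4) (trig_cos 1)) (trigZ (sin (x / 2) / 4) (trig_sin 1))))) => t.
  by rewrite /q cosB mul1r; field.
have tp n : trig_poly (p n).
  apply: (eq_trig_poly (trigD (trig_cst 1) (trigZ (-1) (trigX (2 ^ n)
    (trigD (trig_cst 1) (trigZ (-1) (trigX n tq))))))) => t.
  by rewrite /p !mulN1r.
have q01 t : 0 <= q t <= 1.
  have := cos_geN1 (x / 2); have := cos_le1 (x / 2).
  have := cos_geN1 (t - x / 2); have := cos_le1 (t - x / 2); rewrite /q => *.
  by apply/andP; split; lra.
have p01 n t : `|p n t| <= 1.
  have /andP[h1 h2] := separating_le n (q01 t).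
  by rewrite /p ler_norml; apply/andP; split; lra.
pose F n t := (g t * p n t)%:E.
pose f t := (g t * \1_(`[0, x]%classic : set R) t)%:E.
have mind : measurable_fun circle (\1_(`[0, x]%classic : set R) : R -> R).
  by apply: measurable_funTS; exact: measurable_indic.
have if1 : integrable (fun t => g t * \1_(`[0, x]%classic : set R) t).
  apply: (integrableM_bounded (M := 1)) => // t.
  by rewrite indicE; case: (_ \in _); rewrite ?normr1 ?normr0.
have [] := @dominated_convergence _ _ _ mu circle (measurable_itv _) F f
  (fun t => `|g t|%:E).
- by move=> n; have [/(measurable_int mu)] := trig_integral0 (tp n).
- exact: measurable_int if1.
- pose N := [set 0; x; 2 * pi] : set R.
  exists N; split.
  + by apply: measurableU; [apply: measurableU|]; exact: measurable_set1.
  + apply: countable_lebesgue_measure0; apply: finite_set_countable.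
    by rewrite !finite_setU; split; [split|]; exact: finite_set1.
  move=> t /=; apply: contra_notP => Nt; rewrite in_itv/= => /andP[t0 t2].
  have tN0 : t != 0 by apply/eqP => E; apply: Nt; left; left.
  have tNx : t != x by apply/eqP => E; apply: Nt; left; right.
  have tN2 : t != 2 * pi by apply/eqP => E; apply: Nt; right.
  have {}t0 : 0 < t by rewrite lt_def tN0.
  have {}t2 : t < 2 * pi by rewrite lt_neqAle tN2.
  suff pt : p n t @[n --> \oo] --> (\1_(`[0, x]%classic : set R) t : R).
    rewrite /F /f; apply: cvg_EFin; first by apply: nearW.
    by apply: cvgM => //; exact: cvg_cst.
  have [lo hi] := arc_cos x0 x2 t0 t2.
  have [tx|xt] := ltP t x.
    rewrite indicE mem_set/=; last by rewrite in_itv/= (ltW t0) (ltW tx).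
    rewrite -[X in _ --> X]subr0; apply: cvgB; first exact: cvg_cst.
    have := lo tx; have /andP[_ q1] := q01 t; move=> lt; apply: separating_high => //.
    by rewrite /q; lra.
  have {}xt : x < t by rewrite lt_def tNx.
  rewrite indicE memNset/=; last by rewrite in_itv/= (ltW t0) leNgt xt.
  rewrite -[X in _ --> X](subrr 1); apply: cvgB; first exact: cvg_cst.
  have := hi xt; have /andP[q0 _] := q01 t; move=> lt; apply: separating_low => //.
  by rewrite /q; lra.
- exact: integrable_norm.
- apply: aeW => t n _ /=; rewrite /F lee_fin normrM.
  by rewrite -[leRHS]mulr1 ler_wpM2l.
move=> fi _ Ff.
have F0 n : (\int[mu]_(t in circle) F n t = 0)%E.
  have [iF F0] := trig_integral0 (tp n).
  by rewrite /F (integral_EFin iF) F0.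
have f0 : (\int[mu]_(t in circle) f t = 0)%E.
  apply: (cvg_unique _ Ff); first exact: ereal_hausdorff.
  rewrite (_ : [sequence _]_n = cst 0%E); first exact: cvg_cst.
  by apply/funext => n; exact: F0.
have -> : `[0, x]%classic = circle `&` `[0, x].
  apply/seteqP; split=> t /=; rewrite !in_itv/=; last by case.
  move=> /andP[t0 tx]; rewrite t0 tx; split=> //.
  by apply: le_trans tx (ltW x2).
rewrite Rintegral_mkcondr /Rintegral -[RHS]/(fine 0) -f0; congr fine.
apply: eq_integral => t _; rewrite /f patchE indicE; case: ifP => _; by rewrite ?mulr1 ?mulr0.
Qed.

(** The indefinite integral of g vanishes by [arc_integral0].  By the Lebesgue
differentiation theorem, g is almost everywhere its derivative. *)
Lemma fourier_uniqueness_real : {ae mu, forall t, circle t -> g t = 0}.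
Proof.
pose f := g \_ circle.
pose F y := \int[mu]_(t in `]-oo, y]) f t.
have fT : mu.-integrable setT (EFin \o f).
  by rewrite -restrict_EFin; apply/(integrable_mkcond _ _).1.
have F0 y : 0 < y -> y < 2 * pi -> F y = 0.
  move=> y0 y2; rewrite /F /f -Rintegral_mkcondr.
  transitivity (\int[mu]_(t in `[0, y]) g t); last exact: arc_integral0.
  congr (Rintegral mu _ _); apply/seteqP; split=> t /=; rewrite !in_itv/=.
    by move=> [-> /andP[->]].
  by move=> /andP[t0 ty]; rewrite t0 ty (le_trans ty (ltW y2)).
have fy y : mu.-integrable `]-oo, y] (EFin \o f).
  exact: (integrableS measurableT).
have ae1 := FTC1Ny fy (integrable_locally (measurable_itv _) ig).
have ae2 : {ae mu, forall t, ~ ([set 0; 2 * pi] : set R) t}.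
  exists ([set 0; 2 * pi] : set R); split.
  - by apply: measurableU; exact: measurable_set1.
  - apply: countable_lebesgue_measure0; apply: finite_set_countable.
    by rewrite finite_setU; split; exact: finite_set1.
  - by move=> t /=; exact: contrapT.
apply: (ae2S _ ae1 ae2) => t [_ dF] nt tC.
have : f t = 0.
  rewrite -dF derive1E.
  rewrite (@near_eq_derive _ _ _ _ (cst 0)) ?derive_cst//.
  have tI : t \in `]0, 2 * pi[.
    move: tC; rewrite /= !in_itv/= !lt_neqAle => /andP[-> ->].
    rewrite !andbT; apply/andP; split; apply/eqP => E; apply: nt.
      by left.
    by right.
  by apply: filterS (near_in_itvoo tI) => y; rewrite in_itv/= => /andP[]; exact: F0.
by rewrite /f patchE mem_set.
Qed.

End uniqueness.
End fourier_uniqueness.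

(** * Square integrable functions on the circle *)
Section circle_L2.
Context {R : realType}.
Local Notation mu := (@lebesgue_measure R).
Local Notation circle := (`[0, 2 * pi]%classic : set R).
Local Notation integrable g := (mu.-integrable circle (EFin \o g)).
Local Notation integral g := (\int[mu]_(t in circle) g t).
Implicit Types (f g : R -> R[i]).

Definition expi (k : int) (t : R) : R[i] := cos (k%:~R * t) +i* sin (k%:~R * t).

Lemma expiD j k t : expi (j + k) t = expi j t * expi k t.
Proof.
rewrite /expi rmorphD /= mulrDl cosD sinD; apply/eqP.
by rewrite eq_complex /= eqxx/= addrC.
Qed.

Lemma expiN k t : expi (- k) t = Num.conj (expi k t).
Proof. by rewrite /expi rmorphN /= mulNr cosN sinN. Qed.

Lemma expi0 t : expi 0 t = 1.
Proof. by rewrite /expi mul0r cos0 sin0. Qed.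

Lemma rnorm_sqrE (z : R[i]) : rnorm z ^+ 2 = complex.Re z ^+ 2 + complex.Im z ^+ 2.
Proof.
rewrite /rnorm normc_def /= sqr_sqrtr//.
by rewrite addr_ge0 ?sqr_ge0.
Qed.

Lemma rnorm_expi k t : rnorm (expi k t) = 1.
Proof.
apply/eqP; rewrite -(@eqrXn2 _ 2) ?rnorm_ge0// rnorm_sqrE /=.
by rewrite cos2Dsin2 expr1n.
Qed.

Lemma Re_le_rnorm (z : R[i]) : `|complex.Re z| <= rnorm z.
Proof.
rewrite -(@ler_pXn2r _ 2) ?nnegrE ?rnorm_ge0// rnorm_sqrE.
by rewrite real_normK ?num_real// lerDl sqr_ge0.
Qed.

Lemma Im_le_rnorm (z : R[i]) : `|complex.Im z| <= rnorm z.
Proof.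
rewrite -(@ler_pXn2r _ 2) ?nnegrE ?rnorm_ge0// rnorm_sqrE.
by rewrite real_normK ?num_real// lerDr sqr_ge0.
Qed.

Lemma rnorm_le_ReIm (z : R[i]) : rnorm z <= `|complex.Re z| + `|complex.Im z|.
Proof.
rewrite -(@ler_pXn2r _ 2) ?nnegrE ?rnorm_ge0 ?addr_ge0// rnorm_sqrE.
rewrite -(real_normK (num_real (complex.Re z))) -(real_normK (num_real (complex.Im z))).
rewrite sqrrD -addrA lerD2l lerDr mulrn_wge0// mulr_ge0//.
Qed.

Definition cintegrable f :=
  integrable (fun t => complex.Re (f t)) /\ integrable (fun t => complex.Im (f t)).

Definition cmeasurable f :=
  measurable_fun circle (fun t => complex.Re (f t)) /\
  measurable_fun circle (fun t => complex.Im (f t)).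

Lemma Rint_integrableD (a b : R -> R) : integrable a -> integrable b ->
  integrable (fun t => a t + b t).
Proof.
move=> ia ib; have := @integrableD _ _ _ mu circle (measurable_itv _) _ _ ia ib.
by apply: eq_integrable => // t _; rewrite EFinD.
Qed.

Lemma Rint_integrableZ (c : R) (a : R -> R) : integrable a ->
  integrable (fun t => c * a t).
Proof.
move=> ia; have := @integrableZl _ _ _ mu circle (measurable_itv _) c _ ia.
by apply: eq_integrable => // t _; rewrite EFinM.
Qed.

Lemma Rint_le_integrable (a b : R -> R) : measurable_fun circle a -> integrable b ->
  (forall t, `|a t| <= b t) -> integrable a.
Proof.
move=> ma ib ab.
apply: (@le_integrable _ _ _ mu circle (measurable_itv _) _ _ _ _ ib) => //.
  exact/measurable_EFinP.
by move=> t _ /=; rewrite lee_fin; apply: le_trans (ab t) (ler_norm _).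
Qed.

Lemma Rint_cst (c : R) : integrable (fun=> c).
Proof.
apply: (@measurable_bounded_integrable _ _ _ mu) => //.
- by rewrite /= circle_measure ltry.
- by exists `|c|; split; [exact: num_real|move=> x cx t _ /=; exact: ltW].
Qed.

Lemma integral_cst (c : R) : integral (fun=> c) = c * (2 * pi).
Proof. by rewrite Rintegral_cst//= circle_measure. Qed.

Lemma cintegrableD f g : cintegrable f -> cintegrable g ->
  cintegrable (fun t => f t + g t).
Proof.
move=> [f1 f2] [g1 g2]; split.
- have := Rint_integrableD f1 g1; apply: eq_integrable => // t _ /=; congr (_%:E).
  by rewrite raddfD.
- have := Rint_integrableD f2 g2; apply: eq_integrable => // t _ /=; congr (_%:E).
  by rewrite raddfD.
Qed.

Lemma circle_integralD f g : cintegrable f -> cintegrable g ->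
  circle_integral (fun t => f t + g t) = circle_integral f + circle_integral g.
Proof.
move=> [f1 f2] [g1 g2]; rewrite /circle_integral.
under eq_Rintegral do rewrite raddfD.
under [X in _ +i* X]eq_Rintegral do rewrite raddfD.
by rewrite !RintegralD.
Qed.

Lemma Re_mul (z w : R[i]) : complex.Re (z * w) =
  complex.Re z * complex.Re w - complex.Im z * complex.Im w.
Proof. by case: z w => [a b] [c d]. Qed.

Lemma Im_mul (z w : R[i]) : complex.Im (z * w) =
  complex.Re z * complex.Im w + complex.Im z * complex.Re w.
Proof. by case: z w => [a b] [c d]. Qed.

Lemma cintegrableZ c f : cintegrable f -> cintegrable (fun t => c * f t).
Proof.
move=> [f1 f2]; split.
- have := Rint_integrableD (Rint_integrableZ (complex.Re c) f1)
    (Rint_integrableZ (- complex.Im c) f2).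
  by apply: eq_integrable => // t _ /=; rewrite Re_mul mulNr.
- have := Rint_integrableD (Rint_integrableZ (complex.Re c) f2)
    (Rint_integrableZ (complex.Im c) f1).
  by apply: eq_integrable => // t _ /=; rewrite Im_mul.
Qed.

Lemma circle_integralZ c f : cintegrable f ->
  circle_integral (fun t => c * f t) = c * circle_integral f.
Proof.
move=> [f1 f2]; rewrite /circle_integral; apply/eqP; rewrite eq_complex Re_mul Im_mul /=.
apply/andP; split; apply/eqP.
- under eq_Rintegral do rewrite Re_mul -mulNr.
  rewrite RintegralD ?(Rint_integrableZ _ f1) ?(Rint_integrableZ _ f2)//.
  by rewrite !RintegralZl// mulNr.
- under eq_Rintegral do rewrite Im_mul.
  rewrite RintegralD ?(Rint_integrableZ _ f1) ?(Rint_integrableZ _ f2)//.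
  by rewrite !RintegralZl.
Qed.

Lemma circle_integral_sum (I : Type) (r : seq I) (F : I -> R -> R[i]) :
  (forall i, cintegrable (F i)) ->
  cintegrable (fun t => \sum_(i <- r) F i t) /\
  circle_integral (fun t => \sum_(i <- r) F i t) =
    \sum_(i <- r) circle_integral (F i).
Proof.
move=> iF; elim: r => [|i r [IH1 IH2]].
  rewrite big_nil; split.
    split; (apply: eq_integrable (Rint_cst 0) => // t _ /=; by rewrite big_nil).
  rewrite /circle_integral.
  under eq_Rintegral do rewrite big_nil /=.
  under [X in _ +i* X]eq_Rintegral do rewrite big_nil /=.
  by rewrite integral_cst mul0r.
rewrite big_cons -IH2 -circle_integralD//; split.
  have := cintegrableD (iF i) IH1; congr cintegrable.
  by apply/funext => t; rewrite big_cons.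
by congr circle_integral; apply/funext => t; rewrite big_cons.
Qed.

Lemma eq_circle_integral f g : (forall t, f t = g t) -> circle_integral f = circle_integral g.
Proof. by move=> fg; congr circle_integral; exact/funext. Qed.

Lemma circle_integral_bound f (h : R -> R) : cintegrable f -> integrable h ->
  (forall t, rnorm (f t) <= h t) -> rnorm (circle_integral f) <= 2 * integral h.
Proof.
move=> [f1 f2] ih fh; apply: le_trans (rnorm_le_ReIm _) _ => /=.
have h1 : `|integral (fun t => complex.Re (f t))| <= integral h.
  apply: le_trans (le_normr_Rintegral _ _) _ => //.
  apply: le_Rintegral => //; first exact: integrable_norm.
  by move=> t _; apply: le_trans (Re_le_rnorm _) _.
have h2 : `|integral (fun t => complex.Im (f t))| <= integral h.
  apply: le_trans (le_normr_Rintegral _ _) _ => //.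
  apply: le_Rintegral => //; first exact: integrable_norm.
  by move=> t _; apply: le_trans (Im_le_rnorm _) _.
by apply: le_trans (lerD h1 h2) _; rewrite [leRHS]mulr_natl mulr2n.
Qed.

Definition sqint f : R := integral (fun t => rnorm (f t) ^+ 2).

Lemma L2P f : square_integrable f <->
  cmeasurable f /\ integrable (fun t => rnorm (f t) ^+ 2).
Proof.
have E : integrable (fun t => rnorm (f t) ^+ 2) = mu.-integrable circle
    (fun t => (complex.Re (f t) ^+ 2 + complex.Im (f t) ^+ 2)%:E).
  by congr (mu.-integrable circle _); apply/funext => t /=; rewrite rnorm_sqrE.
by rewrite E; split=> [[]|[[]]].
Qed.

Lemma cmeasurableD f g : cmeasurable f -> cmeasurable g ->
  cmeasurable (fun t => f t + g t).
Proof.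
move=> [f1 f2] [g1 g2]; split.
- have := measurable_funD f1 g1; congr (measurable_fun circle _).
  by apply/funext => t /=; rewrite raddfD.
- have := measurable_funD f2 g2; congr (measurable_fun circle _).
  by apply/funext => t /=; rewrite raddfD.
Qed.

Lemma cmeasurableM f g : cmeasurable f -> cmeasurable g ->
  cmeasurable (fun t => f t * g t).
Proof.
move=> [f1 f2] [g1 g2]; split.
- have := measurable_funB (measurable_funM f1 g1) (measurable_funM f2 g2).
  by congr (measurable_fun circle _); apply/funext => t /=; rewrite Re_mul.
- have := measurable_funD (measurable_funM f1 g2) (measurable_funM f2 g1).
  by congr (measurable_fun circle _); apply/funext => t /=; rewrite Im_mul.
Qed.

Lemma cmeasurable_conj f : cmeasurable f -> cmeasurable (fun t => Num.conj (f t)).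
Proof.
have cE (z : R[i]) : Num.conj z = complex.Re z -i* complex.Im z by case: z.
move=> [f1 f2]; split.
- by move: f1; congr (measurable_fun circle _); apply/funext => t; rewrite cE.
- have := measurable_funN f2; congr (measurable_fun circle _).
  by apply/funext => t /=; rewrite cE.
Qed.

Lemma cmeasurable_cst (c : R[i]) : cmeasurable (fun=> c).
Proof. by split; exact: measurable_cst. Qed.

Lemma cmeasurable_expi k : cmeasurable (expi k).
Proof.
by split; [exact: (trig_measurable (trig_cos k))|exact: (trig_measurable (trig_sin k))].
Qed.

Lemma cintegrable_le f (h : R -> R) : cmeasurable f -> integrable h ->
  (forall t, rnorm (f t) <= h t) -> cintegrable f.
Proof.
move=> [f1 f2] ih fh; split; apply: (Rint_le_integrable _ ih) => // t.
- exact: le_trans (Re_le_rnorm _) (fh t).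
- exact: le_trans (Im_le_rnorm _) (fh t).
Qed.

Lemma L2_le f (h : R -> R) : cmeasurable f -> integrable h ->
  (forall t, rnorm (f t) ^+ 2 <= h t) -> square_integrable f.
Proof.
move=> mf ih fh; apply/L2P; split=> //; apply: (Rint_le_integrable _ ih).
  have := measurable_funD (measurable_funX 2 mf.1) (measurable_funX 2 mf.2).
  by congr (measurable_fun circle _); apply/funext => t /=; rewrite rnorm_sqrE.
by move=> t; rewrite ger0_norm ?sqr_ge0.
Qed.

Lemma rnormD_sqr (z w : R[i]) : rnorm (z + w) ^+ 2 <= 2 * rnorm z ^+ 2 + 2 * rnorm w ^+ 2.
Proof.
have h1 := rnormD z w; have h2 := rnorm_ge0 (z + w).
apply: (@le_trans _ _ ((rnorm z + rnorm w) ^+ 2)).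
  by rewrite ler_sqr ?nnegrE ?addr_ge0 ?rnorm_ge0.
have := sqr_ge0 (rnorm z - rnorm w); nra.
Qed.

Lemma L2D f g : square_integrable f -> square_integrable g ->
  square_integrable (fun t => f t + g t).
Proof.
move=> /L2P[mf f2] /L2P[mg g2].
apply: (L2_le _ (Rint_integrableD (Rint_integrableZ 2 f2) (Rint_integrableZ 2 g2))).
  exact: cmeasurableD.
by move=> t; exact: rnormD_sqr.
Qed.

Lemma L2_expi k : square_integrable (expi k).
Proof.
apply: (L2_le (cmeasurable_expi k) (Rint_cst 1)) => t.
by rewrite rnorm_expi expr1n.
Qed.

Lemma L2M_expi f k : square_integrable f -> square_integrable (fun t => f t * expi k t).
Proof.
move=> /L2P[mf f2]; apply: (L2_le _ f2) => [|t].
  exact: cmeasurableM (cmeasurable_expi k).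
by rewrite rnormM rnorm_expi mulr1.
Qed.

Lemma sqintM_expi f k : sqint (fun t => f t * expi k t) = sqint f.
Proof.
by rewrite /sqint; under eq_Rintegral do rewrite rnormM rnorm_expi mulr1.
Qed.

Lemma L2Z c f : square_integrable f -> square_integrable (fun t => c * f t).
Proof.
move=> /L2P[mf f2]; apply: (L2_le _ (Rint_integrableZ (rnorm c ^+ 2) f2)) => [|t].
  by apply: cmeasurableM => //; exact: cmeasurable_cst.
by rewrite rnormM exprMn.
Qed.

Lemma L2_sum (I : Type) (r : seq I) (F : I -> R -> R[i]) :
  (forall i, square_integrable (F i)) ->
  square_integrable (fun t => \sum_(i <- r) F i t).
Proof.
move=> LF; elim: r => [|i r IH].
  apply: (L2_le _ (Rint_cst 0)) => [|t].
    have := cmeasurable_cst 0; congr cmeasurable; by apply/funext => t; rewrite big_nil.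
  by rewrite big_nil rnorm0 expr0n.
have := L2D (LF i) IH; congr square_integrable.
by apply/funext => t; rewrite big_cons.
Qed.

Lemma young (a b eps : R) : 0 < eps ->
  2 * (a * b) <= eps * a ^+ 2 + eps^-1 * b ^+ 2.
Proof.
move=> e0; have := sqr_ge0 (eps * a - b) => h.
have -> : eps * a ^+ 2 + eps^-1 * b ^+ 2 = 2 * (a * b) + eps^-1 * (eps * a - b) ^+ 2.
  by field; rewrite gt_eqF.
by rewrite lerDl mulr_ge0// invr_ge0 ltW.
Qed.

Lemma L2_integrable f g : square_integrable f -> square_integrable g ->
  cintegrable (fun t => f t * Num.conj (g t)).
Proof.
move=> /L2P[mf f2] /L2P[mg g2].
apply: (cintegrable_le _ (Rint_integrableD f2 g2)) => [|t].
  exact: cmeasurableM (cmeasurable_conj mg).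
rewrite rnormM rnormC; have := young (rnorm (f t)) (rnorm (g t)) ltr01.
have := mulr_ge0 (rnorm_ge0 (f t)) (rnorm_ge0 (g t)); rewrite invr1; lra.
Qed.

(** Young's inequality with a free parameter eps does the work of the inequality of
Cauchy and Schwarz, without square roots of integrals. *)
Lemma L2_bound f g (eps : R) : 0 < eps -> square_integrable f -> square_integrable g ->
  rnorm (circle_integral (fun t => f t * Num.conj (g t))) <=
  eps * sqint f + eps^-1 * sqint g.
Proof.
move=> e0 Lf Lg; have /L2P[mf f2] := Lf; have /L2P[mg g2] := Lg.
have i1 := Rint_integrableZ eps f2; have i2 := Rint_integrableZ eps^-1 g2.
have i3 := Rint_integrableD i1 i2.
have := circle_integral_bound (L2_integrable Lf Lg)
  (Rint_integrableZ 2^-1 i3) _.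
rewrite RintegralZl// RintegralD// !RintegralZl// mulVKf//; apply=> t.
rewrite rnormM rnormC; have := young (rnorm (f t)) (rnorm (g t)) e0; lra.
Qed.

Lemma L2_self f : square_integrable f ->
  circle_integral (fun t => f t * Num.conj (f t)) = (sqint f)%:C.
Proof.
move=> /L2P[_ f2]; apply/eqP; rewrite eq_complex /=; apply/andP; split; apply/eqP.
- by apply: eq_Rintegral => t _; rewrite -rnorm_sqr.
- under eq_Rintegral do rewrite -rnorm_sqr /=.
  by rewrite integral_cst mul0r.
Qed.

Lemma cos_sin_period (k : int) : cos (k%:~R * (2 * pi) : R) = 1 /\ sin (k%:~R * (2 * pi) : R) = 0.
Proof.
have nat_case (n : nat) : cos (n%:R * (2 * pi) : R) = 1 /\ sin (n%:R * (2 * pi) : R) = 0.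
  elim: n => [|n [IHc IHs]]; first by rewrite mul0r cos0 sin0.
  by rewrite -natr1 mulrDl mul1r mulr_natl cosD sinD -mulr_natl IHc IHs mulr_natl
    cos2pi sin2pi !mulr1 !mul0r mulr0 subr0 addr0.
case: k => n; first exact: nat_case.
rewrite NegzE rmorphN /= mulNr cosN sinN.
by have [-> ->] := nat_case n.+1; rewrite oppr0.
Qed.

Lemma integral_derive (F f : R -> R) : continuous f ->
  (forall t : R, is_derive t (1 : R) F (f t)) -> integral f = F (2 * pi) - F 0.
Proof.
move=> cf dF.
have cF : continuous F.
  move=> t; apply: differentiable_continuous; apply/derivable1_diffP.
  by have [] := dF t.
rewrite /Rintegral (@continuous_FTC2 _ f F 0 (2 * pi) pi2_gt0)//.
- exact: continuous_subspaceT.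
- split=> [t _||]; first by have [] := dF t.
  + apply: cvg_at_right_filter; exact: cF.
  + apply: cvg_at_left_filter; exact: cF.
- by move=> t _; rewrite derive1E; have [_ ->] := dF t.
Qed.

Lemma integral_cos (k : int) : k != 0 -> integral (fun t => cos (k%:~R * t)) = 0.
Proof.
move=> k0; have kR : k%:~R != 0 :> R by rewrite intr_eq0.
have dF (t : R) : is_derive t (1 : R) (fun t => (k%:~R)^-1 * sin (k%:~R * t) : R)
    (cos (k%:~R * t)).
  apply: is_derive_eq; rewrite /GRing.scale /= mulr1; by field.
rewrite (integral_derive (trig_continuous (trig_cos k)) dF).
by rewrite (cos_sin_period k).2 !mulr0 sin0 mulr0 subrr.
Qed.

Lemma integral_sin (k : int) : integral (fun t => sin (k%:~R * t)) = 0.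
Proof.
have [->|k0] := eqVneq k 0.
  by under eq_Rintegral do rewrite mul0r sin0; rewrite integral_cst mul0r.
have kR : k%:~R != 0 :> R by rewrite intr_eq0.
have dF (t : R) : is_derive t (1 : R) (fun t => - (k%:~R)^-1 * cos (k%:~R * t) : R)
    (sin (k%:~R * t)).
  apply: is_derive_eq; rewrite /GRing.scale /= mulr1; by field.
rewrite (integral_derive (trig_continuous (trig_sin k)) dF).
by rewrite (cos_sin_period k).1 !mulr0 cos0 subrr.
Qed.

Lemma circle_integral_expi (k : int) :
  circle_integral (expi k) = if k == 0 then (2 * pi)%:C else 0.
Proof.
rewrite /circle_integral /=; have [->|k0] := eqVneq k 0.
  under eq_Rintegral do rewrite mul0r cos0.
  under [X in _ +i* X]eq_Rintegral do rewrite mul0r sin0.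
  by rewrite !integral_cst mul1r mul0r.
by rewrite integral_cos// integral_sin.
Qed.

Lemma cintegrable_expi k : cintegrable (expi k).
Proof.
apply: (cintegrable_le (cmeasurable_expi k) (Rint_cst 1)) => t.
by rewrite rnorm_expi.
Qed.

Definition trig_sum (u : nat -> R[i]) (m n : nat) (t : R) : R[i] :=
  \sum_(m <= j < n) u j * expi j t.

Lemma trig_sum_L2 u m n : square_integrable (trig_sum u m n).
Proof. by apply: L2_sum => i; apply: L2Z; exact: L2_expi. Qed.

(** The orthogonality of the characters, with a shift by k for the sake of
autocorrelations. *)
Lemma trig_sum_inner (u v : nat -> R[i]) m n m' n' (k : int) :
  circle_integral (fun t => trig_sum u m n t * Num.conj (trig_sum v m' n' t * expi k t)) =
  (2 * pi)%:C * \sum_(m <= i < n) \sum_(m' <= j < n')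
    (if (i%:Z - j%:Z - k == 0) then u i * Num.conj (v j) else 0).
Proof.
have E t : trig_sum u m n t * Num.conj (trig_sum v m' n' t * expi k t) =
  \sum_(i <- index_iota m n) \sum_(j <- index_iota m' n')
    (u i * Num.conj (v j)) * expi (i%:Z - j%:Z - k) t.
  rewrite rmorphM mulrA rmorph_sum /= -mulrA mulr_suml; apply: eq_bigr => i _.
  rewrite mulr_suml mulr_sumr; apply: eq_bigr => j _.
  by rewrite rmorphM !expiD !expiN /=; ring.
rewrite (eq_circle_integral E).
have ce i j : cintegrable (fun t => (u i * Num.conj (v j)) * expi (i%:Z - j%:Z - k) t).
  by apply: cintegrableZ; exact: cintegrable_expi.
have inner_sum i := circle_integral_sum (index_iota m' n') (ce i).
have [_ ->] := circle_integral_sum (index_iota m n) (fun i => (inner_sum i).1).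
rewrite mulr_sumr; apply: eq_bigr => i _; rewrite (inner_sum i).2 mulr_sumr.
apply: eq_bigr => j _; rewrite circle_integralZ; last exact: cintegrable_expi.
by rewrite circle_integral_expi; case: ifP => _; rewrite ?mulr0// mulrC.
Qed.

Lemma trig_sum_sqint u m n :
  sqint (trig_sum u m n) = (2 * pi) * \sum_(m <= i < n) rnorm (u i) ^+ 2.
Proof.
apply: (@complexI R); rewrite -(L2_self (trig_sum_L2 u m n)).
transitivity (circle_integral (fun t => trig_sum u m n t *
    Num.conj (trig_sum u m n t * expi 0 t))).
  by apply: eq_circle_integral => t; rewrite expi0 mulr1.
rewrite trig_sum_inner [RHS]rmorphM [in RHS]rmorph_sum; congr (_ * _).
apply: eq_big_nat => i /andP[mi i_n].
rewrite (bigD1_seq i) ?iota_uniq ?mem_index_iota ?mi//= subrr subr0 eqxx.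
rewrite big1 ?addr0 ?rnorm_sqr// => j ji.
by rewrite subr0 subr_eq0 eqz_nat eq_sym (negbTE ji).
Qed.

End circle_L2.

(** * The theorem of Riesz and Fischer *)
Section fatou_L2.
Context {R : realType}.
Local Notation mu := (@lebesgue_measure R).
Local Notation circle := (`[0, 2 * pi]%classic : set R).
Local Notation integrable g := (mu.-integrable circle (EFin \o g)).
Local Notation integral g := (\int[mu]_(t in circle) g t).

Lemma rnorm_sqr_measurable (f : R -> R[i]) : cmeasurable f ->
  measurable_fun circle (fun t => rnorm (f t) ^+ 2).
Proof.
move=> [f1 f2]; have := measurable_funD (measurable_funX 2 f1) (measurable_funX 2 f2).
by congr (measurable_fun circle _); apply/funext => t /=; rewrite rnorm_sqrE.
Qed.

Lemma rnorm_measurable (f : R -> R[i]) : cmeasurable f ->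
  measurable_fun circle (fun t => rnorm (f t)).
Proof.
move=> /rnorm_sqr_measurable mf.
have ms : measurable_fun setT (@Num.sqrt R) by apply: continuous_measurable_fun; exact: sqrt_continuous.
have := measurableT_comp ms mf.
by congr (measurable_fun circle _); apply/funext => t /=; rewrite sqrtr_sqr ger0_norm ?rnorm_ge0.
Qed.

Lemma Re_cvg (x : nat -> R[i]^o) (l : R[i]^o) : x @ \oo --> l ->
  complex.Re (x n : R[i]) @[n --> \oo] --> complex.Re (l : R[i]).
Proof.
move=> /cvg_rnormP xl; apply/cvgrPdist_lt => e /xl[N xN]; exists N => // n Nn.
rewrite distrC; apply: le_lt_trans (xN _ Nn); have := Re_le_rnorm ((x n : R[i]) - l).
by rewrite raddfB.
Qed.

Lemma Im_cvg (x : nat -> R[i]^o) (l : R[i]^o) : x @ \oo --> l ->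
  complex.Im (x n : R[i]) @[n --> \oo] --> complex.Im (l : R[i]).
Proof.
move=> /cvg_rnormP xl; apply/cvgrPdist_lt => e /xl[N xN]; exists N => // n Nn.
rewrite distrC; apply: le_lt_trans (xN _ Nn); have := Im_le_rnorm ((x n : R[i]) - l).
by rewrite raddfB.
Qed.

(** Fatou's lemma for the squares of the norms, where the lower limit is almost
everywhere a limit. *)
Lemma fatou_sqint (v : nat -> R -> R[i]) (f : R -> R[i]) (c : R) :
  (forall k, square_integrable (v k)) -> cmeasurable f ->
  {ae mu, forall t, circle t -> (v k t : R[i]^o) @[k --> \oo] --> (f t : R[i]^o)} ->
  (forall k, sqint (v k) <= c) ->
  square_integrable f /\ sqint f <= c.
Proof.
move=> Lv mf vf vc.
pose w k t := (rnorm (v k t) ^+ 2)%:E.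
have mw k : measurable_fun circle (w k).
  by apply/measurable_EFinP; apply: rnorm_sqr_measurable; exact: ((L2P _).1 (Lv k)).1.
have w0 k t : circle t -> (0 <= w k t)%E by move=> _; rewrite lee_fin sqr_ge0.
have fat := @fatou _ _ _ mu circle (measurable_itv _) w mw w0.
have mf2 : measurable_fun circle (fun t => (rnorm (f t) ^+ 2)%:E).
  by apply/measurable_EFinP; exact: rnorm_sqr_measurable.
have aew : {ae mu, forall t, circle t ->
    (rnorm (f t) ^+ 2)%:E = limn_einf (w ^~ t)}.
  apply: (aeS _ vf) => t vft tC; have {}vft := vft tC.
  have : w ^~ t @ \oo --> (rnorm (f t) ^+ 2)%:E.
    by apply: cvg_EFin; [exact: nearW|apply: cvgM; exact: cvg_rnorm vft].
  by move=> /cvg_limn_einf_sup[].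
have mlim : measurable_fun circle (fun t => limn_einf (w ^~ t)).
  have -> : (fun t => limn_einf (w ^~ t)) = (fun t => - limn_esup (fun k => - w k t))%E.
    apply/funext => t; rewrite -limn_einfN; congr limn_einf.
    by apply/funext => k; rewrite /comp oppeK.
  apply: measurableT_comp => //; apply: measurable_fun_limn_esup => k.
  exact: measurableT_comp.
have fE : (\int[mu]_(t in circle) (rnorm (f t) ^+ 2)%:E =
    \int[mu]_(t in circle) limn_einf (w ^~ t))%E.
  exact: ae_eq_integral.
have bound : (\int[mu]_(t in circle) (rnorm (f t) ^+ 2)%:E <= c%:E)%E.
  rewrite fE; apply: le_trans fat _; rewrite limn_einf_lim.
  apply: lime_le; first exact: is_cvg_einfs.
  apply: nearW => n; apply: (@le_trans _ _ (\int[mu]_(t in circle) w n t)%E).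
    by apply: ereal_inf_lbound; exists n => /=.
  by rewrite /w (integral_EFin ((L2P _).1 (Lv n)).2) lee_fin; exact: vc.
have fi : integrable (fun t => rnorm (f t) ^+ 2).
  apply/integrableP; split=> //=.
  under eq_integral do rewrite ger0_norm ?sqr_ge0//.
  by apply: le_lt_trans bound _; rewrite ltry.
split; first by apply/L2P.
by rewrite -lee_fin -(integral_EFin fi).
Qed.

End fatou_L2.

Section riesz_fischer.
Context {R : realType}.
Local Notation mu := (@lebesgue_measure R).
Local Notation circle := (`[0, 2 * pi]%classic : set R).
Local Notation integrable g := (mu.-integrable circle (EFin \o g)).
Local Notation integral g := (\int[mu]_(t in circle) g t).
Variable u : nat -> R[i].
Hypothesis cu : cvgn (series (fun n => rnorm (u n) ^+ 2)).

Let tail_small (e : R) : 0 < e -> exists N, forall n m, (N <= n)%N -> (n <= m)%N ->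
  \sum_(n <= k < m) rnorm (u k) ^+ 2 < e.
Proof.
move=> e0; have [N uN] := series_tail cu e0; exists N => n m Nn nm.
exact: le_lt_trans (ler_norm _) (uN n m Nn nm).
Qed.

(** The bound 4^-k on the tails makes the increments of the partial sums of index
psi k at most 2^-k in quadratic mean, which is summable. *)
Lemma fast_subsequence : exists psi : nat -> nat,
  (forall k, (k <= psi k <= psi k.+1)%N) /\
  (forall k n m, (psi k <= n)%N -> (n <= m)%N ->
    \sum_(n <= j < m) rnorm (u j) ^+ 2 < (4 ^+ k)^-1).
Proof.
have /choice[phi phiP] k : exists N, forall n m, (N <= n)%N -> (n <= m)%N ->
    \sum_(n <= j < m) rnorm (u j) ^+ 2 < (4 ^+ k)^-1.
  by apply: tail_small; rewrite invr_gt0 exprn_gt0.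
(* The sum makes psi monotone, the summand k makes it unbounded. *)
exists (fun k => k + \sum_(i < k.+1) phi i)%N; split=> [k|k n m kn nm].
  by rewrite leq_addr/= leq_add// [leqRHS]big_ord_recr leq_addr.
apply: phiP => //; apply: leq_trans kn.
by rewrite big_ord_recr/= addnA leq_addl.
Qed.

Section subsequence.
Variable psi : nat -> nat.
Hypothesis psi_mono : forall k, (k <= psi k <= psi k.+1)%N.
Hypothesis psi_tail : forall k n m, (psi k <= n)%N -> (n <= m)%N ->
  \sum_(n <= j < m) rnorm (u j) ^+ 2 < (4 ^+ k)^-1.

Let s k := trig_sum u 0 (psi k).
Let d k t := rnorm (s k.+1 t - s k t).

Let psi_le k : (psi k <= psi k.+1)%N. Proof. by have /andP[] := psi_mono k. Qed.
Let psi_ge k : (k <= psi k)%N. Proof. by have /andP[] := psi_mono k. Qed.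

Let sB m n t : (m <= n)%N -> trig_sum u 0 n t - trig_sum u 0 m t = trig_sum u m n t.
Proof.
by move=> mn; rewrite /trig_sum (big_cat_nat (leq0n m) mn)/= addrAC subrr add0r.
Qed.

Let dE k t : d k t = rnorm (trig_sum u (psi k) (psi k.+1) t).
Proof. by rewrite /d /s sB. Qed.

Let d_meas k : measurable_fun circle (d k).
Proof.
have := rnorm_measurable ((L2P _).1 (trig_sum_L2 u (psi k) (psi k.+1))).1.
by congr (measurable_fun circle _); apply/funext => t /=; rewrite dE.
Qed.

(** By Young's inequality d is at most (2^k d^2 + 2^-k) / 2. *)
Let d_integral k : integrable (d k) /\ integral (d k) <= 2 * pi / 2 ^+ k.
Proof.
have /L2P[_ i2] := trig_sum_L2 u (psi k) (psi k.+1).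
have k2 : 0 < (2 : R) ^+ k by rewrite exprn_gt0.
pose h t := 2^-1 * (2 ^+ k * rnorm (trig_sum u (psi k) (psi k.+1) t) ^+ 2 + (2 ^+ k)^-1).
have i3 := Rint_integrableZ (2 ^+ k) i2.
have i4 := Rint_cst ((2 : R) ^+ k)^-1.
have ih : integrable h by exact: Rint_integrableZ (Rint_integrableD i3 i4).
have dh t : d k t <= h t.
  rewrite dE /h; have := young (rnorm (trig_sum u (psi k) (psi k.+1) t)) 1 k2.
  rewrite mulr1 expr1n mulr1; lra.
have id : integrable (d k).
  apply: (Rint_le_integrable (d_meas k) ih) => t.
  by rewrite ger0_norm// rnorm_ge0.
split=> //; apply: le_trans (le_Rintegral _ id ih _) _ => //.
rewrite /h RintegralZl//; last exact: Rint_integrableD.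
rewrite RintegralD// RintegralZl// integral_cst -/(sqint _) trig_sum_sqint.
have t1 := ltW (psi_tail (leqnn (psi k)) (psi_le k)).
set S := \sum_(_ <= _ < _) _ in t1 *.
have t2 : 2 ^+ k * S <= (2 ^+ k)^-1.
  apply: (@le_trans _ _ (2 ^+ k * (4 ^+ k)^-1)); first by rewrite ler_pM2l.
  have -> : (4 : R) ^+ k = 2 ^+ k * 2 ^+ k by rewrite -exprMn -natrM.
  by rewrite invfM mulrA mulfV ?mul1r ?gt_eqF.
have p0 := @pi2_gt0 R; set P := 2 * pi in p0 *.
have := ler_wpM2l (ltW p0) t2; rewrite mulrCA => t3.
set I := (2 ^+ k)^-1 in t2 t3 *.
rewrite (mulrC P I) in t3 *; lra.
Qed.

(** The sum of the integrals of the increments is finite, hence so is almost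
everywhere the sum of the increments. *)
Lemma summable_ae : {ae mu, forall t, circle t -> cvgn (series (d ^~ t))}.
Proof.
have dfin : ((\int[mu]_(t in circle) (\sum_(0 <= k <oo) (d k t)%:E)) < +oo)%E.
  rewrite integral_nneseries//; last 2 first.
  - by move=> n; apply/measurable_EFinP; exact: d_meas.
  - by move=> n t _; rewrite lee_fin rnorm_ge0.
  apply: (@le_lt_trans _ _ (\sum_(0 <= k <oo) (2 * pi / 2 ^+ k)%:E)%E).
    apply: lee_nneseries => [k _ _|k _].
      by apply: integral_ge0 => t _; rewrite lee_fin rnorm_ge0.
    by rewrite (integral_EFin (d_integral k).1) lee_fin; exact: (d_integral k).2.
  have := @cvg_geometric_eseries_half R (2 * (2 * pi)) 0.
  rewrite /eseries /=.
  move=> /cvg_lim => /(_ (@ereal_hausdorff R)) h.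
  rewrite (_ : limn _ = (2 * (2 * pi) / 2 ^+ 0)%:E) ?ltry// -h; congr (limn _).
  apply/funext => n; apply: eq_bigr => k _; congr (_%:E).
  rewrite addn1 natrX exprS; field; by rewrite expf_neq0.
have d0 t : (0 <= \sum_(0 <= k <oo) (d k t)%:E)%E.
  by apply: nneseries_ge0 => n _ _; rewrite lee_fin rnorm_ge0.
have id : mu.-integrable circle (fun t => \sum_(0 <= k <oo) (d k t)%:E)%E.
  apply/integrableP; split.
    apply: (ge0_emeasurable_sum (P := xpredT)) => [k t _ _|k _].
      by rewrite lee_fin rnorm_ge0.
    by apply/measurable_EFinP; exact: d_meas.
  by under eq_integral do rewrite gee0_abs//.
have := @integrable_ae _ _ _ mu circle (measurable_itv _) _ id.
apply: filterS => t td tC; have := td tC; rewrite ge0_fin_numE// => tfin.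
have tS n : ((series (d ^~ t) n)%:E <= \sum_(0 <= k <oo) (d k t)%:E)%E.
  rewrite -sumEFin; apply: nneseries_lim_ge => k _ _.
  by rewrite lee_fin rnorm_ge0.
apply: nondecreasing_is_cvgn.
  by apply/nondecreasing_seqP => n; rewrite /series/= big_nat_recr//= lerDl rnorm_ge0.
exists (fine (\sum_(0 <= k <oo) (d k t)%:E)%E) => _ [n _ <-].
by rewrite -lee_fin fineK ?tS// ge0_fin_numE.
Qed.

(** Upper limits are measurable, which is why the limit function is defined by them
rather than by limits. *)
Lemma subsequence_limit : exists2 f : R -> R[i], cmeasurable f &
  {ae mu, forall t, circle t -> (s k t : R[i]^o) @[k --> \oo] --> (f t : R[i]^o)}.
Proof.
pose a k t := (complex.Re (s k t))%:E; pose b k t := (complex.Im (s k t))%:E.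
have ms k : cmeasurable (s k) := ((L2P _).1 (trig_sum_L2 u 0 (psi k))).1.
exists (fun t => fine (limn_esup (a ^~ t)) +i* fine (limn_esup (b ^~ t))).
  split=> /=; apply: measurableT_comp => //; apply: measurable_fun_limn_esup => k;
    apply/measurable_EFinP; [exact: (ms k).1|exact: (ms k).2].
apply: (aeS _ summable_ae) => t dt tC; have {}dt := dt tC.
have : cvgn (series (fun k => s k.+1 t - s k t : complex_line R)).
  exact: (@series_rnorm_cvg _ _ (d ^~ t)).
move=> /cvg_ex[/= l sl].
have {}sl : (s k t : R[i]^o) @[k --> \oo] --> (l + s 0 t : R[i]^o).
  have cs : (fun _ : nat => s 0 t : complex_line R) @ \oo --> (s 0 t : complex_line R).
    exact: cvg_cst.
  have := cvg_seqD sl cs.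
  apply: cvg_seq_ext => n; rewrite /series /=.
  by rewrite telescope_sumr// subrK.
have aE : limn_esup (a ^~ t) = (complex.Re (l + s 0 t))%:E.
  by apply: (cvg_limn_einf_sup _).2; apply: cvg_EFin; [exact: nearW|exact: Re_cvg sl].
have bE : limn_esup (b ^~ t) = (complex.Im (l + s 0 t))%:E.
  by apply: (cvg_limn_einf_sup _).2; apply: cvg_EFin; [exact: nearW|exact: Im_cvg sl].
rewrite aE bE /=; move: sl; congr (_ --> _).
by case: (l + s 0 t).
Qed.

(** [fatou_sqint] for the differences with a fixed partial sum. *)
Lemma subsequence_L2_limit : exists2 f : R -> R[i], square_integrable f &
  forall N (e : R), (forall m, (N <= m)%N -> \sum_(N <= j < m) rnorm (u j) ^+ 2 <= e) ->
    sqint (fun t => f t - trig_sum u 0 N t) <= (2 * pi) * e.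
Proof.
have [f mf sf] := subsequence_limit.
have main N (e : R) : (forall m, (N <= m)%N -> \sum_(N <= j < m) rnorm (u j) ^+ 2 <= e) ->
    square_integrable (fun t => f t - trig_sum u 0 N t) /\
    sqint (fun t => f t - trig_sum u 0 N t) <= (2 * pi) * e.
  move=> Ne.
  have Nk k : (N <= psi (k + N))%N by apply: leq_trans (psi_ge _); exact: leq_addl.
  have sNE k : trig_sum u N (psi (k + N)) = (fun t => s (k + N)%N t - trig_sum u 0 N t).
    by apply/funext => t; rewrite /s sB.
  apply: (@fatou_sqint _ (fun k => trig_sum u N (psi (k + N)))).
  - by move=> k; exact: trig_sum_L2.
  - have := cmeasurableD mf (cmeasurableM (cmeasurable_cst (-1))
      ((L2P _).1 (trig_sum_L2 u 0 N)).1).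
    by congr cmeasurable; apply/funext => t; rewrite mulN1r.
  - apply: (aeS _ sf) => t sft tC; have {}sft := sft tC.
    have cs : (fun _ : nat => trig_sum u 0 N t : R[i]^o) @ \oo --> (trig_sum u 0 N t : R[i]^o).
      exact: cvg_cst.
    rewrite -(cvg_shiftn N) in sft.
    have := cvg_seqB sft cs.
    by apply: cvg_seq_ext => k; rewrite sNE.
  - by move=> k; rewrite trig_sum_sqint ler_pM2l ?pi2_gt0//; exact: Ne.
exists f => [|N e /main[]//].
have [N Ne] := tail_small ltr01.
have [|L1 _] := main N 1; first by move=> m Nm; exact: ltW (Ne _ _ (leqnn N) Nm).
have := L2D L1 (trig_sum_L2 u 0 N); congr square_integrable.
by apply/funext => t; rewrite subrK.
Qed.

End subsequence.

Lemma riesz_fischer : exists2 f : R -> R[i], square_integrable f &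
  forall e : R, 0 < e -> exists N0, forall N, (N0 <= N)%N ->
    sqint (fun t => f t - trig_sum u 0 N t) <= e.
Proof.
have [psi [psi_mono psi_tail]] := fast_subsequence.
have [f Lf fN] := subsequence_L2_limit psi_mono psi_tail.
exists f => // e e0; have p0 := @pi2_gt0 R.
have [N0 N0e] := tail_small (divr_gt0 e0 p0); exists N0 => N N0N.
have -> : e = (2 * pi) * (e / (2 * pi)) by rewrite mulrCA mulfV ?mulr1// gt_eqF.
by apply: fN => m Nm; exact: ltW (N0e _ _ N0N Nm).
Qed.

End riesz_fischer.

(** * Inner functions and their autocorrelation *)
Section boundary_values.
Context {R : realType}.
Local Notation mu := (@lebesgue_measure R).
Local Notation circle := (`[0, 2 * pi]%classic : set R).
Local Notation integrable g := (mu.-integrable circle (EFin \o g)).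
Local Notation integral g := (\int[mu]_(t in circle) g t).
Implicit Types (u : nat -> R[i]) (f g : R -> R[i]).

Definition L2_cvg (fn : nat -> R -> R[i]) f :=
  [/\ forall n, square_integrable (fn n), square_integrable f &
    forall e : R, 0 < e -> exists N, forall n, (N <= n)%N ->
      sqint (fun t => f t - fn n t) <= e].

Lemma L2B f g : square_integrable f -> square_integrable g ->
  square_integrable (fun t => f t - g t).
Proof.
move=> Lf Lg; have := L2D Lf (L2Z (-1) Lg); congr square_integrable.
by apply/funext => t; rewrite mulN1r.
Qed.

Lemma sqint_ge0 f : 0 <= sqint f.
Proof. by apply: Rintegral_ge0 => t _; exact: sqr_ge0. Qed.

(** With h = f - f_n and k = g - g_n, the difference of the two integrals is the sum
of those of h conj(g), of f conj(k) and of - h conj(k), and [L2_bound] controls each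
of them. *)
Lemma L2_cvg_inner fn gn f g : L2_cvg fn f -> L2_cvg gn g ->
  (circle_integral (fun t => fn n t * Num.conj (gn n t)) : R[i]^o) @[n --> \oo] -->
  (circle_integral (fun t => f t * Num.conj (g t)) : R[i]^o).
Proof.
move=> [Lfn Lf fnf] [Lgn Lg gng]; apply/cvg_rnormP => e e0.
pose A := sqint f + sqint g + 1.
have A0 : 0 < A by rewrite ltr_wpDl ?addr_ge0 ?sqint_ge0.
(* With these choices f and g contribute less than e / 2 to the final estimate,
   and the differences with f_n and g_n at most e / 4. *)
pose eps := e / (2 * A).
have eps0 : 0 < eps by rewrite divr_gt0// mulr_gt0.
pose eta := e / (8 * (eps^-1 + 1)).
have epsV0 : 0 < eps^-1 by rewrite invr_gt0.
have eta0 : 0 < eta by rewrite divr_gt0// mulr_gt0// addr_gt0.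
have [N1 fN] := fnf _ eta0; have [N2 gN] := gng _ eta0.
exists (maxn N1 N2) => n; rewrite geq_max => /andP[/fN hf /gN hg].
pose h t := f t - fn n t; pose k t := g t - gn n t.
have Lh : square_integrable h by exact: L2B.
have Lk : square_integrable k by exact: L2B.
have E : circle_integral (fun t => f t * Num.conj (g t)) =
    circle_integral (fun t => fn n t * Num.conj (gn n t)) +
    (circle_integral (fun t => h t * Num.conj (g t)) +
     (circle_integral (fun t => f t * Num.conj (k t)) +
      (-1) * circle_integral (fun t => h t * Num.conj (k t)))).
  have i1 := L2_integrable (Lfn n) (Lgn n); have i2 := L2_integrable Lh Lg.
  have i3 := L2_integrable Lf Lk; have i4 := L2_integrable Lh Lk.
  rewrite -circle_integralZ// -circle_integralD//; last exact: cintegrableZ.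
  rewrite -circle_integralD//; last by apply: cintegrableD => //; exact: cintegrableZ.
  rewrite -circle_integralD//; last first.
    by apply: cintegrableD => //; apply: cintegrableD => //; exact: cintegrableZ.
  by apply: eq_circle_integral => t; rewrite /h /k !rmorphB /=; ring.
rewrite E opprD addrA subrr add0r rnormN.
apply: le_lt_trans (rnormD _ _) _; rewrite mulN1r.
apply: (@le_lt_trans _ _ (rnorm (circle_integral (fun t => h t * Num.conj (g t))) +
   (rnorm (circle_integral (fun t => f t * Num.conj (k t))) +
    rnorm (circle_integral (fun t => h t * Num.conj (k t)))))).
  by rewrite lerD2l; exact: rnormB.
have b1 := L2_bound epsV0 Lh Lg; have b2 := L2_bound eps0 Lf Lk.
have b3 := L2_bound ltr01 Lh Lk; rewrite invr1 !mul1r in b3; rewrite invrK in b1.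
move: b1 b2 b3 hf hg; rewrite -/(sqint h) -[sqint (fun t => f t - fn n t)]/(sqint h).
rewrite -[sqint (fun t => g t - gn n t)]/(sqint k).
set r1 := rnorm _; set r2 := rnorm _; set r3 := rnorm _ => b1 b2 b3 hf hg.
have c1 : eps * (sqint f + sqint g) < e / 2.
  have -> : e / 2 = eps * A by rewrite /eps; field; rewrite gt_eqF.
  by rewrite ltr_pM2l// ltrDl.
have c2 : (eps^-1 + 1) * (sqint h + sqint k) <= e / 4.
  have -> : e / 4 = (eps^-1 + 1) * (eta + eta).
    have : eps^-1 + 1 != 0 by rewrite gt_eqF ?addr_gt0.
    by rewrite /eta; move: (eps^-1 + 1) => b b0; field.
  by rewrite ler_pM2l ?addr_gt0// lerD.
move: c1 c2; rewrite !mulrDr !mulrDl !mul1r => c1 c2; lra.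
Qed.

Lemma L2_cvg_cst g : square_integrable g -> L2_cvg (fun=> g) g.
Proof.
move=> Lg; split=> // e e0; exists 0%N => n _.
rewrite /sqint; under eq_Rintegral do rewrite subrr rnorm0 expr0n.
by rewrite integral_cst mul0r ltW.
Qed.

Lemma L2_cvgM_expi fn f k : L2_cvg fn f ->
  L2_cvg (fun n t => fn n t * expi k t) (fun t => f t * expi k t).
Proof.
move=> [Lfn Lf fnf]; split=> [n||e /fnf[N fN]]; [exact: L2M_expi|exact: L2M_expi|].
exists N => n /fN; congr (_ <= _).
rewrite -[LHS](sqintM_expi _ k); congr sqint; apply/funext => t.
by rewrite mulrBl.
Qed.

Lemma L2_cvg_shift fn f k : L2_cvg fn f -> L2_cvg (fun n => fn (n + k)%N) f.
Proof.
move=> [Lfn Lf fnf]; split=> // e /fnf[N fN]; exists N => n Nn.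
by apply: fN; rewrite (leq_trans Nn)// leq_addr.
Qed.

Lemma fourier_coefE f k :
  fourier_coef f k = ((2 * pi)^-1)%:C * circle_integral (fun t => f t * Num.conj (expi k t)).
Proof. by []. Qed.

Let p0 : 2 * pi != 0 :> R. Proof. by rewrite gt_eqF// pi2_gt0. Qed.

Lemma trig_sum_coef u N (k : int) :
  ((2 * pi)^-1)%:C * circle_integral (fun t => trig_sum u 0 N t * Num.conj (expi k t)) =
  if k is Posz n then (if (n < N)%N then u n else 0) else 0.
Proof.
have one (t : R) : expi k t = trig_sum (fun=> 1) 0 1 t * expi k t.
  by rewrite /trig_sum big_nat1 mul1r expi0 mul1r.
transitivity (((2 * pi)^-1)%:C * circle_integral
    (fun t => trig_sum u 0 N t * Num.conj (trig_sum (fun=> 1) 0 1 t * expi k t))).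
  by congr (_ * _); apply: eq_circle_integral => t; rewrite -one.
rewrite trig_sum_inner mulrA -[X in X * _]rmorphM mulVf// mul1r.
under eq_bigr do rewrite big_nat1 subr0 rmorph1 mulr1 subr_eq0.
case: k {one} => n; last by rewrite big1.
case: ltnP => nN; last first.
  rewrite big_nat big1// => i /andP[_ iN]; rewrite eqz_nat ltn_eqF//.
  exact: leq_trans nN.
rewrite (bigD1_seq n) ?iota_uniq ?mem_index_iota//= eqxx big1 ?addr0// => i /negbTE.
by rewrite eqz_nat => ->.
Qed.

Lemma trig_sum_autocorrelation u N (k : nat) :
  circle_integral (fun t => trig_sum u 0 N t *
    Num.conj (trig_sum u 0 (N + k) t * expi (- k%:Z) t)) =
  (2 * pi)%:C * \sum_(0 <= n < N) u n * Num.conj (u (n + k)%N).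
Proof.
rewrite trig_sum_inner; congr (_ * _); apply: eq_big_nat => i /andP[_ iN].
rewrite (bigD1_seq (i + k)%N) ?iota_uniq ?mem_index_iota ?ltn_add2r//=.
rewrite opprK PoszD opprD addrA subrr add0r addNr eqxx big1 ?addr0// => j ji.
rewrite addrAC subr_eq0 -PoszD eqz_nat; case: eqP => // E.
by rewrite E eqxx in ji.
Qed.

(** The partial sums of the Fourier series converge in quadratic mean, so that
their Fourier coefficients and autocorrelations converge to those of the limit.  In
the autocorrelation the second factor is taken k terms longer, which makes the
partial autocorrelation a partial sum of the series. *)
Lemma riesz_fischer_boundary u :
  cvgn (series (fun n => rnorm (u n) ^+ 2)) ->
  exists2 f, boundary_function u f & forall k : nat,
    ((2 * pi)%:C * series (fun n => u n * Num.conj (u (n + k)%N)) N : R[i]^o) @[N --> \oo]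
    --> (circle_integral (fun t => f t * Num.conj (f t * expi (- k%:Z) t)) : R[i]^o).
Proof.
move=> cu; have [f Lf fN] := riesz_fischer cu.
have uf : L2_cvg (trig_sum u 0) f by split=> // n; exact: trig_sum_L2.
exists f => [|k]; last first.
  have := L2_cvg_inner uf (L2_cvgM_expi (- k%:Z) (L2_cvg_shift k uf)).
  by apply: cvg_seq_ext => N; exact: trig_sum_autocorrelation.
split=> // k; rewrite fourier_coefE.
have := cvg_seqZ (a := ((2 * pi)^-1)%:C) (L2_cvg_inner uf (L2_cvg_cst (L2_expi k))).
move=> /(@cvg_seq_ext R[i]^o _ _ _ (fun N => trig_sum_coef u N k)) /cvg_seq_unique; apply.
case: k => n; last exact: cvg_cst.
apply: cvg_near_cst; exists n.+1 => // N /=; by move=> ->.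
Qed.

Lemma circle_integral_expiM f k :
  circle_integral (fun t => f t * Num.conj (f t * expi (- k) t)) =
  integral (fun t => rnorm (f t) ^+ 2 * cos (k%:~R * t)) +i*
  integral (fun t => rnorm (f t) ^+ 2 * sin (k%:~R * t)).
Proof.
have E t : f t * Num.conj (f t * expi (- k) t) = (rnorm (f t) ^+ 2)%:C * expi k t.
  by rewrite rmorphM /= mulrA -rnorm_sqr expiN (@conjCK R[i]).
rewrite (eq_circle_integral E) /circle_integral.
congr (_ +i* _); apply: eq_Rintegral => t _.
  by rewrite Re_mul /= mul0r subr0.
by rewrite Im_mul /= mul0r addr0.
Qed.

Lemma L2_cintegrable f : square_integrable f -> cintegrable f.
Proof.
move=> Lf; have := L2_integrable Lf (L2_expi 0); congr cintegrable.
by apply/funext => t; rewrite expi0 rmorph1 mulr1.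
Qed.

Lemma trig_cos_le1 (k : int) (t : R) : `|cos (k%:~R * t)| <= 1.
Proof. by rewrite ler_norml cos_geN1 cos_le1. Qed.

Lemma trig_sin_le1 (k : int) (t : R) : `|sin (k%:~R * t)| <= 1.
Proof. by rewrite ler_norml sin_geN1 sin_le1. Qed.

(** The coefficients of index k and - k together give the integrals of the real and
imaginary parts of f against the cosine and the sine. *)
Lemma fourier_uniqueness f : cintegrable f -> (forall k, fourier_coef f k = 0) ->
  {ae mu, forall t, circle t -> f t = 0}.
Proof.
move=> [if1 if2] fk.
have mcos k := trig_measurable (@trig_cos R k).
have msin k := trig_measurable (@trig_sin R k).
have i1 k := integrableM_bounded if1 (mcos k) (trig_cos_le1 k).
have i2 k := integrableM_bounded if1 (msin k) (trig_sin_le1 k).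
have i3 k := integrableM_bounded if2 (mcos k) (trig_cos_le1 k).
have i4 k := integrableM_bounded if2 (msin k) (trig_sin_le1 k).
have ReIm k :
    integral (fun t => complex.Re (f t) * cos (k%:~R * t)) +
    integral (fun t => complex.Im (f t) * sin (k%:~R * t)) = 0 /\
    integral (fun t => complex.Im (f t) * cos (k%:~R * t)) -
    integral (fun t => complex.Re (f t) * sin (k%:~R * t)) = 0.
  have /eqP := fk k; rewrite mulf_eq0 (inj_eq (@complexI R) _ 0) invr_eq0 (negbTE p0) /=.
  rewrite eq_complex /= => /andP[/eqP h1 /eqP h2]; split.
    rewrite -RintegralD// -[RHS]h1; apply: eq_Rintegral => t _.
    by rewrite Re_mul /= mulrN opprK.
  rewrite -RintegralB// -[RHS]h2; apply: eq_Rintegral => t _.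
  by rewrite Im_mul /= mulrN addrC.
have cosN k (a : R -> R) : integral (fun t => a t * cos ((- k)%:~R * t)) =
    integral (fun t => a t * cos (k%:~R * t)).
  by apply: eq_Rintegral => t _; rewrite rmorphN mulNr cosN.
have sinN k (a : R -> R) : integrable (fun t => a t * sin (k%:~R * t)) -> integral (fun t => a t * sin ((- k)%:~R * t)) =
    (-1) * integral (fun t => a t * sin (k%:~R * t)).
  move=> ia.
  rewrite -RintegralZl//.
  by apply: eq_Rintegral => t _; rewrite rmorphN mulNr sinN mulrN mulN1r.
have sum0 (x y : R) : x + y = 0 -> x + (-1) * y = 0 -> x = 0 /\ y = 0 by split; lra.
have dif0 (x y : R) : x - y = 0 -> x - (-1) * y = 0 -> x = 0 /\ y = 0 by split; lra.
have [ReIm1 ReIm2] : (forall k, integral (fun t => complex.Re (f t) * cos (k%:~R * t)) = 0 /\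
    integral (fun t => complex.Im (f t) * sin (k%:~R * t)) = 0) /\
    (forall k, integral (fun t => complex.Im (f t) * cos (k%:~R * t)) = 0 /\
    integral (fun t => complex.Re (f t) * sin (k%:~R * t)) = 0).
  split=> k; have [h1 h2] := ReIm k; have := ReIm (- k); rewrite !cosN !sinN// => -[h3 h4].
    exact: sum0.
  exact: dif0.
have a1 : {ae mu, forall t, circle t -> complex.Re (f t) = 0}.
  by apply: fourier_uniqueness_real => // k; [exact: (ReIm1 k).1|exact: (ReIm2 k).2].
have a2 : {ae mu, forall t, circle t -> complex.Im (f t) = 0}.
  by apply: fourier_uniqueness_real => // k; [exact: (ReIm2 k).1|exact: (ReIm1 k).2].
apply: (ae2S _ a1 a2) => t f1 f2 tC; apply/eqP.
by rewrite eq_complex /= f1// f2// !eqxx.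
Qed.

(** This transfers properties from the boundary function which comes with an inner
function to the one constructed by [riesz_fischer_boundary]. *)
Lemma boundary_function_unique u f g : boundary_function u f -> boundary_function u g ->
  {ae mu, forall t, circle t -> f t = g t}.
Proof.
move=> [Lf fk] [Lg gk].
have iff := L2_cintegrable Lf; have ig := cintegrableZ (-1) (L2_cintegrable Lg).
have fgk k : fourier_coef (fun t => f t + (-1) * g t) k = 0.
  have i1 := L2_integrable Lf (L2_expi k); have i2 := L2_integrable Lg (L2_expi k).
  rewrite fourier_coefE.
  have -> : circle_integral (fun t => (f t + -1 * g t) * Num.conj (expi k t)) =
      circle_integral (fun t => f t * Num.conj (expi k t)) +
      (-1) * circle_integral (fun t => g t * Num.conj (expi k t)).
    rewrite -circle_integralZ// -circle_integralD//; last exact: cintegrableZ.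
    by apply: eq_circle_integral => t; rewrite mulrDl mulrA.
  by rewrite mulrDr mulrCA -!fourier_coefE fk gk mulN1r subrr.
apply: (aeS _ (fourier_uniqueness (cintegrableD iff ig) fgk)) => t fg tC.
by have /eqP := fg tC; rewrite mulN1r subr_eq0 => /eqP.
Qed.

(** A series of nonnegative numbers converges among the real numbers as soon as it
is bounded. *)
Lemma hardy2_cvg (u : nat -> R[i]) :
  hardy2 u -> cvgn (series (fun n => rnorm (u n) ^+ 2)).
Proof.
move=> /cvg_ex[/= l ul].
have uE n : series (fun n => `|u n| ^+ 2 : R[i]^o) n =
    (series (fun n => rnorm (u n) ^+ 2) n)%:C.
  rewrite /series /= rmorph_sum; apply: eq_bigr => k _.
  by rewrite rnormE rmorphXn.
have s0 n : 0 <= series (fun n => rnorm (u n) ^+ 2) n.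
  by apply: sumr_ge0 => k _; exact: sqr_ge0.
apply: nondecreasing_is_cvgn.
  by apply: nondecreasing_series => n _ _; exact: sqr_ge0.
have /cvg_rnorm := ul => rl.
have : cvgn (fun n => rnorm (series (fun n => `|u n| ^+ 2 : R[i]^o) n)).
  by apply/cvg_ex; exists (rnorm l).
move=> /cvg_seq_bounded/bounded_fun_has_ubound[M v_M].
exists M => _ [n _ <-]; apply: v_M; exists n => //.
by rewrite uE rnormR ger0_norm.
Qed.

(** The Fourier coefficients of |f|^2 - 1 vanish, where f is the boundary function. *)
Lemma inner_function_autocorrelation u :
  (forall k, series (fun n => u n * Num.conj (u (n + k)%N) : R[i]^o) @ \oo -->
    ((k == 0%N)%:R : R[i]^o)) -> inner_function u.
Proof.
move=> uk.
have hu : hardy2 u.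
  apply/cvg_ex; exists 1; have := uk 0%N; apply: cvg_seq_ext => N.
  by rewrite /series /=; apply: eq_bigr => n _; rewrite addn0 -normCK.
split=> //; have [f uf fk] := riesz_fischer_boundary (hardy2_cvg hu).
exists f => //; have /L2P[_ f2] := uf.1.
have fkE (k : nat) : circle_integral (fun t => f t * Num.conj (f t * expi (- k%:Z) t)) =
    (2 * pi)%:C * (k == 0%N)%:R.
  exact: cvg_seq_unique (fk k) (cvg_seqZ (a := (2 * pi)%:C) (uk k)).
pose h t := rnorm (f t) ^+ 2 + (-1).
have ih : integrable h by exact: Rint_integrableD (Rint_cst (-1)).
have hP k : integral (fun t => h t * cos (k%:~R * t)) = 0 /\
    integral (fun t => h t * sin (k%:~R * t)) = 0.
  have hnat (n : nat) : integral (fun t => h t * cos (n%:Z%:~R * t)) = 0 /\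
      integral (fun t => h t * sin (n%:Z%:~R * t)) = 0.
    have := fkE n; rewrite circle_integral_expiM.
    have -> : (2 * pi)%:C * (n == 0%N)%:R = (2 * pi * (n == 0%N)%:R)%:C :> R[i].
      by rewrite [RHS]rmorphM [X in _ = _ * X]rmorph_nat.
    case=> c1 s1.
    have ic := integrableM_bounded f2 (trig_measurable (trig_cos n)) (trig_cos_le1 n).
    have isn := integrableM_bounded f2 (trig_measurable (trig_sin n)) (trig_sin_le1 n).
    have ic1 := (@cintegrable_expi R n).1; have is1 := (@cintegrable_expi R n).2.
    have hE (p : R -> R) : integrable (fun t => rnorm (f t) ^+ 2 * p t) -> integrable p ->
        integral (fun t => h t * p t) =
        integral (fun t => rnorm (f t) ^+ 2 * p t) - integral p.
      move=> ip1 ip2; rewrite -RintegralB//.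
      by apply: eq_Rintegral => t _; rewrite mulrDl mulN1r.
    rewrite (hE _ ic ic1) (hE _ isn is1) c1 s1 integral_sin subr0.
    case: n {c1 s1 ic isn ic1 is1} => [|n] /=.
      under eq_Rintegral do rewrite mul0r cos0.
      by rewrite integral_cst mul1r mulr1 subrr.
    by rewrite integral_cos// mulr0 subrr.
  case: k => n; first exact: hnat.
  have [c1 s1] := hnat n.+1; rewrite NegzE; split.
    by rewrite -[RHS]c1; apply: eq_Rintegral => t _; rewrite rmorphN mulNr cosN.
  rewrite -[RHS](mulr0 (-1)) -[X in _ = _ * X]s1 -RintegralZl//.
    by apply: eq_Rintegral => t _; rewrite rmorphN mulNr sinN mulrN mulN1r.
  exact: integrableM_bounded ih (trig_measurable (trig_sin _)) (trig_sin_le1 _).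
have := fourier_uniqueness_real ih (fun k => (hP k).1) (fun k => (hP k).2).
apply: aeS => t ht tC; have {}ht := ht tC.
rewrite rnormE; have /eqP : rnorm (f t) ^+ 2 = 1 by move: ht; rewrite /h; lra.
by rewrite sqrp_eq1 ?rnorm_ge0// => /eqP ->.
Qed.

Lemma inner_function_norm u : inner_function u ->
  series (fun n => rnorm (u n) ^+ 2) @ \oo --> (1 : R).
Proof.
move=> [hu [f0 uf0 f01]]; have [f uf fk] := riesz_fischer_boundary (hardy2_cvg hu).
have f1 : {ae mu, forall t, circle t -> rnorm (f t) ^+ 2 = 1}.
  apply: (ae2S _ (boundary_function_unique uf uf0) f01) => t fE h tC.
  by rewrite fE// /rnorm h// expr1n.
have /L2P[[mf1 mf2] f2] := uf.1.
have fi : integral (fun t => rnorm (f t) ^+ 2) = 2 * pi.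
  rewrite -[RHS]mul1r -integral_cst /Rintegral; congr fine.
  apply: ae_eq_integral => //.
  - exact: measurable_int f2.
  - by apply: aeS f1 => t ft tC; rewrite ft.
have := cvg_seqZ (a := ((2 * pi)^-1)%:C) (fk 0%N); move=> /Re_cvg.
have -> : complex.Re (((2 * pi)^-1)%:C *: circle_integral (fun t => f t * Num.conj (f t * expi (- 0%:Z) t))) = 1.
  rewrite circle_integral_expiM.
  rewrite (_ : integral (fun t => rnorm (f t) ^+ 2 * cos _) = 2 * pi).
    by rewrite /= mul0r subr0 mulVf.
  by rewrite -[RHS]fi; apply: eq_Rintegral => t _; rewrite mul0r cos0 mulr1.
apply: cvg_seq_ext => N.
rewrite /GRing.scale /= mulrA -rmorphM mulVf// mul1r /series /= raddf_sum.
by apply: eq_bigr => n _; rewrite addn0 -rnorm_sqr.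
Qed.

End boundary_values.

(** * Coincidence of scalar characteristic functions *)
Section disc.
Context {R : realType}.

Lemma disc_fun_eq (u : nat -> R[i]) (z c : R[i]) :
  series (fun n => u n * z ^+ n : R[i]^o) @ \oo --> (c : R[i]^o) -> disc_fun u z = c.
Proof. by move=> h; exact: (cvg_lim (@norm_hausdorff _ R[i]^o) h). Qed.

Lemma disc_fun_cvg (u : nat -> R[i]) (b : R) (z : R[i]) :
  (forall n, rnorm (u n) <= b) -> rnorm z < 1 ->
  series (fun n => u n * z ^+ n : R[i]^o) @ \oo --> (disc_fun u z : R[i]^o).
Proof.
move=> ub z1.
have : cvgn (series (fun n => u n * z ^+ n : complex_line R)).
  apply: (@series_rnorm_cvg _ _ (geometric b (rnorm z))).
    move=> n; rewrite -[rnorm _]/(rnorm (u n * z ^+ n)) rnormM rnormX.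
    by rewrite ler_wpM2r ?exprn_ge0 ?rnorm_ge0.
  by apply: is_cvg_geometric_series; rewrite ger0_norm// rnorm_ge0.
exact.
Qed.

End disc.

Section coincidence.
Context {R : realType} {H : hilbertType R} (T : bop H H).
Variables (a : R) (e f : H).
Hypothesis T_contraction : forall x, rnorm (T x) <= rnorm x.
Hypothesis rk : rank_one_defects T a e f.

Let a0 : 0 < a. Proof. by case: rk. Qed.
Let e1 : rnorm e = 1. Proof. by case: rk. Qed.
Let f1 : rnorm f = 1. Proof. by case: rk. Qed.

Let DeP (x : defect_space T) : incl x = along e (incl x).
Proof.
have eE x' : x' - adjoint T (T x') = (a ^+ 2)%:C *: along e x' by case: rk.
exact/(defect_space_along e1 a0 eE)/set_mem/inclP.
Qed.

Let fE x : x - adjoint (adjoint T) (adjoint T x) = (a ^+ 2)%:C *: along f x.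
Proof. by rewrite adjointK; case: rk. Qed.

Let DfP (x : defect_space (adjoint T)) : incl x = along f (incl x).
Proof. exact/(defect_space_along f1 a0 fE)/set_mem/inclP. Qed.

Let De : csubspace_set (defect_space T) e.
Proof.
have eE x : x - adjoint T (T x) = (a ^+ 2)%:C *: along e x by case: rk.
by apply/(defect_space_along e1 a0 eE); rewrite /along inner_unit// scale1r.
Qed.

Let Df : csubspace_set (defect_space (adjoint T)) f.
Proof.
by apply/(defect_space_along f1 a0 fE); rewrite /along inner_unit// scale1r.
Qed.

Lemma coordinate_unitary (M : csubspace H) (g : H) : rnorm g = 1 ->
  csubspace_set M g -> (forall x : M, incl x = along g (incl x)) ->
  exists w : bop M (complex_line R), unitary w /\ forall x, w x = inner (incl x) g.
Proof.
move=> g1 Mg MP.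
pose c (x : M) : complex_line R := inner (incl x) g.
have lc : linear c by move=> b x y; rewrite /c /= innerDl innerZl.
have cN (x : M) : rnorm (c x) = rnorm x.
  by rewrite -[RHS]/(rnorm (incl x)) MP /along rnormZ g1 mulr1.
have [|w wE] := bounded_linear_bop lc (c := 1); first by move=> x; rewrite cN mul1r.
exists w; split=> //; split=> [x|y].
  by rewrite !rnormE wE cN.
exists ((y : R[i]) *: CSubspaceElt (mem_set Mg)).
by rewrite wE /c /= innerZl inner_unit// mulr1.
Qed.

(** The unitary maps are the coordinates along e and f. *)
Lemma coincide_char_coef (u : nat -> R[i]) :
  (forall n, char_coef T a e f n = u n) ->
  coincide (char_fun (T := T)) (scalar_fun (disc_fun u)).
Proof.
move=> uE; have [w [uw wE]] := coordinate_unitary e1 De DeP.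
have [ws [uws wsE]] := coordinate_unitary f1 Df DfP.
exists w, ws; split=> // z z1 x.
have z1' : rnorm z < 1 by rewrite -ltcR -rnormE.
have [c cc cE] := char_fun_along T_contraction rk z1'.
rewrite wE wsE cE innerZl inner_unit// mulr1 /scalar_fun.
suff -> : disc_fun u z = c by [].
apply: disc_fun_eq; apply: cvg_seq_ext cc => n.
by rewrite /series /=; apply: eq_bigr => k _; rewrite uE.
Qed.

(** The unitary maps send e and f to unimodular numbers, whose quotient is the
factor k.  Equality of the functions on the disc gives equality of coefficients by
[power_series_inj]. *)
Lemma char_coef_coincide (u : nat -> R[i]) (b : R) :
  (forall n, rnorm (u n) <= b) -> (forall n, rnorm (char_coef T a e f n) <= b) ->
  coincide (char_fun (T := T)) (scalar_fun (disc_fun u)) ->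
  exists2 k, rnorm k = 1 & forall n, u n = k * char_coef T a e f n.
Proof.
move=> ub cb [w [ws [[uw _] [uws _] wws]]].
pose eD : defect_space T := CSubspaceElt (mem_set De).
pose fD : defect_space (adjoint T) := CSubspaceElt (mem_set Df).
have w1 : rnorm (w eD : R[i]) = 1 by rewrite -[LHS]/(rnorm (w eD)) /rnorm uw.
have ws1 : rnorm (ws fD : R[i]) = 1 by rewrite -[LHS]/(rnorm (ws fD)) /rnorm uws.
pose k : R[i] := (ws fD : R[i]) / (w eD : R[i]).
have w0 : (w eD : R[i]) != 0 by rewrite -rnorm_eq0 w1 oner_eq0.
have k1 : rnorm k = 1.
  by have := rnormM k (w eD : R[i]); rewrite w1 mulr1 {1}/k divfK// => <-.
exists k => //.
apply: (@power_series_inj _ _ _ b) => // [n|z z1].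
  by rewrite rnormM k1 mul1r.
have [c cc cE] := char_fun_along T_contraction rk z1.
have zN : `|z| < 1 by rewrite rnormE ltcR.
exists (disc_fun u z); first exact: disc_fun_cvg ub z1.
have -> : disc_fun u z = k * c.
  have := wws z zN eD.
  have -> : char_fun z eD = c *: fD.
    by apply: val_inj; rewrite /= cE /= inner_unit// mulr1.
  rewrite bopZ /scalar_fun => E; apply: (mulIf w0).
  by rewrite [RHS]mulrAC /k divfK// [RHS]mulrC; exact: E.
have := cvg_seqZ (a := k) cc; apply: cvg_seq_ext => n.
rewrite /series /= scaler_sumr; apply: eq_bigr => i _.
by rewrite -mulrA.
Qed.

End coincidence.

(** * The correspondence *)
Lemma cvg_square_bounded {R : realType} (v : nat -> R) : (forall n, 0 <= v n) ->
  cvgn (series (fun n => v n ^+ 2)) -> exists b, forall n, v n <= b.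
Proof.
move=> v0 /cvg_seq_bounded/bounded_fun_has_ubound[M MP].
exists (M + 1) => n.
have : v n ^+ 2 <= M.
  apply: (@le_trans _ _ (series (fun n => v n ^+ 2) n.+1)); last by apply: MP; exists n.+1.
  rewrite /series /= big_nat_recr//= lerDr; apply: sumr_ge0 => k _; exact: sqr_ge0.
have := v0 n; nra.
Qed.

Lemma orbit_fcalc {R : realType} {K : hilbertType R} (V : bop K K) (u : nat -> R[i])
    (ys : K) : isometric V -> hardy2 u ->
  (forall i j, i != j -> inner (iter i V ys) (iter j V ys) = 0) ->
  series (fun n => u n *: iter n V ys) @ \oo --> fcalc u V ys.
Proof. by move=> isoV /hardy2_cvg hu yy; exact: orbit_series_cvg. Qed.

Lemma fcalc_eq {R : realType} {K : hilbertType R} (V : bop K K) (u : nat -> R[i])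
    (ys y : K) : series (fun n => u n *: iter n V ys) @ \oo --> y -> y = fcalc u V ys.
Proof. by move=> h; apply/esym; exact: (cvg_lim (@norm_hausdorff _ K) h). Qed.

Theorem corollary3p4 (R : realType) (K : hilbertType R) (H : csubspace K)
    (T : bop H H) (V : bop K K) (L Ls : set K) :
  C00 T ->
  isometric_dilation T V ->
  minimal_dilation H V ->
  wandering V L ->
  wandering V Ls ->
  Mplus V Ls = setT ->
  orthogonal_decomposition (csubspace_set H) (Mplus V L) ->
  ((exists (M : csubspace H) (TM : reducing T M),
       has_defects (restriction (proj1 TM)) 1%N)
   <->
   (exists (y ys : K) (u : nat -> R[i]),
       [/\ L y, Ls ys, y != 0, ys != 0 & inner_function u /\ y = fcalc u V ys]))
  /\
  (forall u : nat -> R[i], inner_function u ->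
     ((exists y ys : K,
         [/\ L y, Ls ys, y != 0, ys != 0 & y = fcalc u V ys])
      <->
      (exists (M : csubspace H) (TM : reducing T M),
         has_defects (restriction (proj1 TM)) 1%N /\
         coincide (char_fun (T := restriction (proj1 TM)))
                  (scalar_fun (disc_fun u))))).
Proof.
move=> T00 dilT minV wanL wanLs MLs decK.
have isoV := dilT.1.
have Tc : forall x, rnorm (T x) <= rnorm x.
  by have [Tc _ _] := T00; move=> x; rewrite -lecR -!rnormE; exact: Tc.
have Rc (M : csubspace H) (TM : reducing T M) x :
    rnorm (restriction (proj1 TM) x) <= rnorm x by exact: (Tc (incl x)).
have wys ys : Ls ys -> forall i j, i != j -> inner (iter i V ys) (iter j V ys) = 0.
  by move=> Lys i j ij; exact: wanLs.2.
(* The number |ys| / |y| in [pair_to_reducing] is 1: by Parseval's identity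
   |y|^2 = |ys|^2 sum_n |u_n|^2, and that sum is 1 for an inner function. *)
have backward (y ys : K) u : L y -> Ls ys -> y != 0 -> ys != 0 -> inner_function u ->
    y = fcalc u V ys -> exists (M : csubspace H) (TM : reducing T M),
      has_defects (restriction (proj1 TM)) 1 /\
      coincide (char_fun (T := restriction (proj1 TM))) (scalar_fun (disc_fun u)).
  move=> Ly Lys y0 ys0 iu yE.
  have uy := orbit_fcalc isoV iu.1 (wys _ Lys); rewrite -yE in uy.
  have [M [TM [a [e [f [rk cE]]]]]] :=
    pair_to_reducing dilT minV wanL wanLs MLs decK Ly Lys y0 ys0 uy.
  exists M, TM; split; first by apply/has_defects1P; exists a, e, f.
  apply: (coincide_char_coef (Rc M TM) rk) => n; rewrite cE.
  suff -> : rnorm ys = rnorm y.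
    by rewrite divff ?mulr1// rnorm_eq0.
  have p1 := orbit_parseval dilT wanLs Lys uy.
  have p2 := cvg_seqMr (c := rnorm ys ^+ 2) (inner_function_norm iu).
  have /eqP : rnorm y ^+ 2 = 1 * rnorm ys ^+ 2.
    apply: (cvg_unique (@norm_hausdorff _ _) p1); apply: cvg_seq_ext p2 => m.
    by rewrite /series /= mulr_suml.
  by rewrite mul1r eqrXn2 ?rnorm_ge0// => /eqP.
have forward (M : csubspace H) (TM : reducing T M) :
    has_defects (restriction (proj1 TM)) 1 -> exists y ys a e f,
      [/\ L y, Ls ys, rnorm y = 1, rnorm ys = 1 &
        rank_one_defects (restriction (proj1 TM)) a e f /\
        series (fun n => char_coef (restriction (proj1 TM)) a e f n *: iter n V ys) @ \oo --> y].
  move=> /has_defects1P[a [e [f rk]]].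
  have [y [ys [Ly Lys y1 ys1 uy]]] := reducing_to_pair dilT wanL wanLs MLs decK T00 rk.
  by exists y, ys, a, e, f.
have unit0 (x : K) : rnorm x = 1 -> x != 0.
  by move=> x1; rewrite -rnorm_eq0 x1 oner_eq0.
split.
  split=> [[M [TM /forward[y [ys [a [e [f [Ly Lys y1 ys1 [rk uy]]]]]]]]]|].
    set u := char_coef _ a e f in uy.
    exists y, ys, u; split; [by []|by []|exact: unit0|exact: unit0|].
    split; last exact: fcalc_eq.
    (* The orbit of y is orthonormal, as y is in L and has norm 1. *)
    apply: inner_function_autocorrelation => k.
    have := orbit_sum_correlation (k := k) isoV (wys _ Lys) uy.
    rewrite ys1 expr1n.
    have -> : inner (iter k V y) y = (k == 0%N)%:R.
      have [->|k0] := eqVneq k 0%N; first by rewrite /= inner_unit.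
      exact: (wanL.2 k 0%N).
    by apply: cvg_seq_ext => n; rewrite /series /=; apply: eq_bigr => i _; rewrite mulr1.
  move=> [y [ys [u [Ly Lys y0 ys0 [iu yE]]]]].
  have [M [TM [d _]]] := backward y ys u Ly Lys y0 ys0 iu yE.
  by exists M, TM.
move=> u iu; split=> [[y [ys [Ly Lys y0 ys0 yE]]]|]; first exact: (backward y ys).
move=> [M [TM [/forward[y [ys [a [e [f [Ly Lys y1 ys1 [rk uy]]]]]]] co]]].
have [b ub] := cvg_square_bounded (fun n => rnorm_ge0 (u n)) (hardy2_cvg iu.1).
have cb n : rnorm (char_coef (restriction (proj1 TM)) a e f n) <= 1.
  have := orbit_sum_inner isoV n (wys _ Lys) uy.
  rewrite ys1 expr1n mulr1 => <-.
  by apply: le_trans (cauchy_schwarz _ _) _; rewrite iter_rnorm// y1 ys1 mulr1.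
have [||k k1 uE] := @char_coef_coincide _ _ _ _ _ _ (Rc M TM) rk u (Num.max b 1) _ _ co.
- by move=> n; rewrite le_max ub.
- by move=> n; rewrite le_max cb orbT.
(* The unimodular factor of the coincidence goes into y. *)
exists (k *: y), ys; split=> //.
- exact: (subspaceZ wanL.1).
- by apply: unit0; rewrite rnormZ k1 y1 mulr1.
- exact: unit0.
apply: fcalc_eq; have := cvg_seqZ (a := k) uy; apply: cvg_seq_ext => n.
by rewrite /series /= scaler_sumr; apply: eq_bigr => i _; rewrite scalerA uE.
Qed.
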